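(* Consider a Lagrangian control system $$\dot q^i = v^i,\qquad \dot v^i = f^i(q,v,u),\qquad i=1,\dots,p,$$ with $m=p-1$ control inputs and a configuration flat output $y^j=\varphi^j(q)$, $j=1,\dots,p-1$, and the corresponding parameterization of the system variables $$q = F_q(y_{[0,R-2]}),\qquad v = F_v(y_{[0,R-1]}),\qquad u = F_u(y_{[0,R]}),\qquad R=(r^1,\dots,r^{p-1}).$$ Call a multi-index $\kappa=(\kappa^1,\dots,\kappa^{p-1})$ of form $(\ast)$ if $$\kappa^j=\begin{cases}4 & \text{for one } j\in\{1,\dots,p-1\}\text{ where } r^j=4,\\ 2 & \text{for all other } j.\end{cases}\qquad(\ast)$$ Then the following applies: (i) For every multi-index $\kappa$ of form $(\ast)$ there exists a quasi-static feedback law $u=\alpha(q,v,w,w_{[1]},\ldots)$ of the classical state such that the closed-loop system $\dot q=v$, $\dot v=f(q,v,\alpha(q,v,w,w_{[1]},\ldots))$ has the linear input-output behavior $y^j_{[\kappa^j]}=w^j$, $j=1,\dots,p-1$. Further, there exists at least one multi-index $\kappa$ of form $(\ast)$. (ii) An input-output behavior $y^j_{[\kappa^j]}=w^j$, $j=1,\dots,p-1$, with a multi-index $\kappa$ (with $\kappa\le R$ and $\#\kappa=2p$) that is not of form $(\ast)$ can either not be achieved by a quasi-static feedback law $u=\alpha(q,v,w,w_{[1]},\ldots)$ at all, or only by a quasi-static feedback law of this type which exhibits a singularity at equilibrium points.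
   Context: Notation. All objects are smooth and all statements are local. Subscripts in square brackets denote time derivatives: $y^j_{[\alpha]}$ is the $\alpha$-th time derivative of $y^j$. For multi-indices $A=(a^1,\dots,a^m)$, $B=(b^1,\dots,b^m)$ and an integer $c$: $A\pm c=(a^1\pm c,\dots,a^m\pm c)$; $A\le B$ means $a^j\le b^j$ for all $j$; $\#A=\sum_j a^j$; $y_{[A]}=(y^1_{[a^1]},\dots,y^m_{[a^m]})$; $y_{[0,A]}=(y^1_{[0,a^1]},\dots,y^m_{[0,a^m]})$ with $y^j_{[0,a^j]}=(y^j,y^j_{[1]},\dots,y^j_{[a^j]})$ (empty if $a^j<0$). $\partial_z F$ denotes the Jacobian matrix of $F$ with respect to the variables $z$; $F_q,F_v,F_u$ are regarded as functions of the independent coordinates $y^j_{[\alpha]}$. Lagrangian control system. The configuration space is a $p$-dimensional smooth manifold $\mathcal Q$ with local coordinates $q=(q^1,\dots,q^p)$. The Lagrangian $L(q,\dot q)$ is kinetic minus potential energy, and the external forces enter through a matrix $G(q)$ multiplying the control inputs $u=(u^1,\dots,u^m)$: $$\frac{\mathrm d}{\mathrm dt}\Big(\frac{\partial L}{\partial \dot q^i}\Big)-\frac{\partial L}{\partial q^i}=\sum_{j=1}^m G_{ij}(q)u^j,\qquad i=1,\dots,p.$$ Solving for $\ddot q$ gives the state-space form $\dot q=v$, $\dot v=f(q,v,u)$ with classical state $(q,v)$. Flatness. A system $\dot x=f(x,u)$ with $\dim x=n$, $\dim u=m$ is flat if there is an $m$-tuple of smooth functions $y^j=\varphi^j(x,u,u_{[1]},\ldots)$,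 $j=1,\dots,m$, depending on finitely many time derivatives of $u$ (defined on a state-input manifold with coordinates $(x,u,u_{[1]},\dots,u_{[l_u]})$, $l_u$ large enough), and smooth functions $F_x^i,F_u^j$ such that locally $x^i=F_x^i(y_{[0,R-1]})$ and $u^j=F_u^j(y_{[0,R]})$ for some multi-index $R=(r^1,\dots,r^m)$. Then $y$ is a flat output and these relations are the parameterizing map. The differentials $\mathrm d\varphi,\mathrm d\varphi_{[1]},\dots,\mathrm d\varphi_{[\beta]}$ are linearly independent for every $\beta$, and the parameterizing map is unique with a minimal multi-index $R$, where $r^j$ is the highest order of time derivative of $y^j$ required for expressing $x$ and $u$ by $y$ and its time derivatives; $R$ always denotes this minimal multi-index. Here $x=(q,v)$, $n=2p$, $F_x=(F_q,F_v)$, and for Lagrangian control systems $F_q$ depends on time derivatives of $y$ up to order $R-2$ only. A configuration flat output is a flat output depending only on the configuration variables, $y^j=\varphi^j(q)$; it is a smooth submersion from $\mathcal Q$ to a manifold with coordinates $(y^1,\dots,y^{p-1})$. Quasi-static feedback. A quasi-static feedback law of the classical state is an endogenous feedback law $u=\alpha(q,v,w,w_{[1]},\ldots)$ that may contain finitely many time derivatives of the new input $w=(w^1,\dots,w^m)$ and does not increase the order of the closed-loop dynamics (no additional controller states); the new input $w=y_{[\kappa]}$ is freely choosable. For $\kappa\le R$ with $\#\kappa=2p$, such a feedback achieving $y_{[\kappa]}=w$ exists if and only if the $2p\times2p$ Jacobian matrix $\partial_{y_{[0,\kappa-1]}}\begin{pmatrix} F_q \\ F_v \end{pmatrix}$ is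 regular (invertible). Equilibrium points and singularities. Equilibrium points are constant states and inputs $(x_s,u_s)$; they are parameterized by constant values $y_s$ of the flat output, with $y_{s,[1]}=y_{s,[2]}=\dots=0$. Throughout it is assumed that the flat parameterization is well defined locally around equilibrium points. The feedback law achieving $y_{[\kappa]}=w$ exhibits a singularity at an equilibrium point (is not well defined around it) when the $2p\times2p$ Jacobian matrix $\partial_{y_{[0,\kappa-1]}}\begin{pmatrix} F_q \\ F_v \end{pmatrix}$, evaluated at $y=y_s$ with all time derivatives of $y$ equal to zero, is not regular. *)

(* Defs.v *)
(* MathComp-Analysis. *)
From HB Require Import structures.
From mathcomp Require Import all_boot all_order all_algebra.
From mathcomp Require Import all_classical all_reals all_analysis.
Set Implicit Arguments.
Unset Strict Implicit.
Unset Printing Implicit Defensive.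
Import Order.TTheory GRing.Theory Num.Theory.
Import numFieldNormedType.Exports.
Local Open Scope classical_set_scope.
Local Open Scope ring_scope.

Section Smooth.
Context {R : realType} {V W : normedModType R}.

(* [V] is finite-dimensional in every use, so quantifying over all directions
   [v] amounts to quantifying over the partial derivatives. *)
Fixpoint Ck (k : nat) (A : set V) (f : V -> W) : Prop :=
  match k with
  | 0%N => forall x, A x -> {for x, continuous f}
  | k'.+1 => (forall x, A x -> differentiable f x) /\
             (forall v : V, Ck k' A (fun x => 'D_v f x))
  end.

Definition smooth (A : set V) (f : V -> W) : Prop := forall k, Ck k A f.

End Smooth.

Section Lagrangian.
Context {R : realType} {p : nat}.

(* Points of the tangent bundle are pairs [(q, v)]; [v M(q) v^T / 2] is the
   kinetic energy and [P] the potential energy. *)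
Definition lagrangian (M : 'rV[R]_p -> 'M[R]_p) (P : 'rV[R]_p -> R)
    (x : 'rV[R]_p * 'rV[R]_p) : R :=
  2^-1 * (x.2 *m M x.1 *m (x.2)^T) 0 0 - P x.1.

(* [d/dt (dL/dv^i) - dL/dq^i] at [x = (q, v)] for the acceleration [a]: by the
   chain rule, [d/dt] is the derivative in the direction [(v, a)]. *)
Definition euler_lagrange (L : 'rV[R]_p * 'rV[R]_p -> R)
    (x : 'rV[R]_p * 'rV[R]_p) (a : 'rV[R]_p) (i : 'I_p) : R :=
  'D_(x.2, a) (fun y => 'D_(0, delta_mx 0 i) L y) x
  - 'D_(delta_mx 0 i, 0) L x.

End Lagrangian.

(* [accel ((q, v), u)] is [f(q, v, u)] in [q' = v, v' = f(q, v, u)]. As the mass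
   matrix is invertible, [system_eq] determines it on [config]. *)
Record lagrangian_system (R : realType) (p m : nat) := LagrangianSystem {
  config : set 'rV[R]_p;
  mass : 'rV[R]_p -> 'M[R]_p;
  potential : 'rV[R]_p -> R;
  force : 'rV[R]_p -> 'M[R]_(p, m);
  accel : ('rV[R]_p * 'rV[R]_p) * 'rV[R]_m -> 'rV[R]_p;
  config_open : open config;
  mass_smooth : smooth config mass;
  potential_smooth : smooth config potential;
  force_smooth : smooth config force;
  accel_smooth : smooth [set xu | config xu.1.1] accel;
  mass_sym : forall q, config q -> (mass q)^T = mass q;
  mass_pos : forall q (v : 'rV[R]_p), config q -> v != 0 -> 0 < (v *m mass q *m v^T) 0 0;
  system_eq : forall x u i, config x.1 ->
    euler_lagrange (lagrangian mass potential) x (accel (x, u)) i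
    = \sum_j force x.1 i j * u 0 j }.

Section Jets.
Context {R : realType} {p m : nat}.

(* A point [((q, v), U)]: [U a] is the [a]-th time derivative of the input (of
   [u], or of the new input [w] in closed loop). Open sets and smooth functions
   live on the manifolds with coordinates [(q, v, U 0, ..., U l)]. *)
Definition jet : Type := ('rV[R]_p * 'rV[R]_p) * (nat -> 'rV[R]_m).

Definition trunc (k : nat) (U : nat -> 'rV[R]_m) : 'M[R]_(k, m) :=
  \matrix_(a < k) U a.

Definition lies_over (l : nat) (O : set (('rV[R]_p * 'rV[R]_p) * 'M[R]_(l.+1, m)))
    (z : jet) : Prop :=
  O (z.1, trunc l.+1 z.2).

Definition jet_diff (h : jet -> R) (z d : jet) : R :=
  derive1 (fun s : R => h (z.1 + s *: d.1, fun a => z.2 a + s *: d.2 a)) 0.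

(* Total time derivative along [q' = v, v' = acc, (U a)' = U (a + 1)]. *)
Definition total_deriv (acc : jet -> 'rV[R]_p) (h : jet -> R) (z : jet) : R :=
  jet_diff h z ((z.1.2, acc z), fun a => z.2 a.+1).

(* The [a]-th time derivative of [y^j = phi^j(q)]. *)
Definition output_deriv (acc : jet -> 'rV[R]_p) (phi : 'rV[R]_p -> 'rV[R]_m)
    (a : nat) (j : 'I_m) : jet -> R :=
  iter a (total_deriv acc) (fun z => phi z.1.1 0 j).

End Jets.

Arguments jet : clear implicits.

Section FlatSystem.
Context {R : realType} {p m : nat}.
Variables (S : lagrangian_system R p m) (phi : 'rV[R]_p -> 'rV[R]_m).

Definition open_loop (z : jet R p m) : 'rV[R]_p := accel S (z.1, z.2 0%N).

Definition yder (a : nat) (j : 'I_m) : jet R p m -> R :=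
  output_deriv open_loop phi a j.

Definition independent_differentials (z : jet R p m) : Prop :=
  forall (beta : nat) (c : 'M[R]_(beta.+1, m)),
    (forall d : jet R p m,
       \sum_(a < beta.+1) \sum_(j < m) c a j * jet_diff (yder a j) z d = 0) ->
    c = 0.

Definition submersion : Prop :=
  smooth (config S) phi /\
  forall q, config S q -> \rank (jacobian phi q) = m.

(* The coordinates [y^j_[a]], [a <= max_j r^j], form a matrix with entry
   [y^j_[a]] in row [a] and column [j]. *)
Definition height (r : 'I_m -> nat) : nat := (\max_(j < m) r j).+1.

Definition yjet (N : nat) (z : jet R p m) : 'M[R]_(N, m) :=
  \matrix_(a, j) yder a j z.

Definition pd (N n : nat) (F : 'M[R]_(N, m) -> 'rV[R]_n) (a : nat) (j : 'I_m)
    (Y : 'M[R]_(N, m)) : 'rV[R]_n :=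
  'D_(\matrix_(b < N, k < m) ((b == a :> nat) && (k == j))%:R) F Y.

(* [F] is a function of [y_[0, R - c]] only. *)
Definition function_upto (r : 'I_m -> nat) (c N n : nat)
    (F : 'M[R]_(N, m) -> 'rV[R]_n) : Prop :=
  forall Y Y' : 'M[R]_(N, m),
    (forall (a : 'I_N) j, (a + c <= r j)%N -> Y a j = Y' a j) -> F Y = F Y'.

(* Since [F_q] and [F_v] involve [y^j] only up to order [r^j - 1], the order
   [r^j] is required on the domain [O] precisely if [F_u] depends on it. *)
Definition minimal_on (r : 'I_m -> nat) (Fu : 'M[R]_(height r, m) -> 'rV[R]_m)
    (l : nat) (O : set (('rV[R]_p * 'rV[R]_p) * 'M[R]_(l.+1, m))) : Prop :=
  forall j, exists2 z, lies_over O z & pd Fu (r j) j (yjet (height r) z) != 0.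

Record flat_parameterization (r : 'I_m -> nat) (l : nat)
    (X : set (('rV[R]_p * 'rV[R]_p) * 'M[R]_(l.+1, m)))
    (D : set 'M[R]_(height r, m))
    (Fq Fv : 'M[R]_(height r, m) -> 'rV[R]_p)
    (Fu : 'M[R]_(height r, m) -> 'rV[R]_m) : Prop := FlatParameterization {
  flat_open : open X;
  flat_config : forall x, X x -> config S x.1.1;
  flat_range_open : open D;
  flat_range : forall z, lies_over X z -> D (yjet (height r) z);
  flat_Fq_smooth : smooth D Fq;
  flat_Fv_smooth : smooth D Fv;
  flat_Fu_smooth : smooth D Fu;
  flat_Fq_upto : function_upto r 2 Fq;
  flat_Fv_upto : function_upto r 1 Fv;
  flat_Fu_upto : function_upto r 0 Fu;
  flat_q : forall z, lies_over X z -> z.1.1 = Fq (yjet (height r) z);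
  flat_v : forall z, lies_over X z -> z.1.2 = Fv (yjet (height r) z);
  flat_u : forall z, lies_over X z -> z.2 0%N = Fu (yjet (height r) z);
  flat_independent : forall z, lies_over X z -> independent_differentials z;
  flat_minimal : minimal_on Fu X }.

Definition equilibrium (q : 'rV[R]_p) (u : 'rV[R]_m) : Prop :=
  config S q /\ accel S ((q, 0), u) = 0.

Definition constant_jet (q : 'rV[R]_p) (u : 'rV[R]_m) : jet R p m :=
  ((q, 0), fun a => if a is 0%N then u else 0).

(* [w_[i]], [i >= 0], for [w = y_[kappa]]. *)
Definition wjet (kappa : 'I_m -> nat) (z : jet R p m) : nat -> 'rV[R]_m :=
  fun i => \row_j yder (kappa j + i) j z.

Definition closed_loop (k : nat)
    (alpha : ('rV[R]_p * 'rV[R]_p) * 'M[R]_(k, m) -> 'rV[R]_m)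
    (z : jet R p m) : 'rV[R]_p :=
  accel S (z.1, alpha (z.1, trunc k z.2)).

(* Around the point [z0] there is a static law [u = alpha(q, v, w, w_[1], ...)],
   involving the first [k] of [w, w_[1], ...], such that
   - the closed loop, whose state is [(q, v)] and whose input [w] is free (its
     derivatives are independent coordinates), satisfies [y_[kappa] = w];
   - the law is endogenous: along the original system [w, w_[1], ...] are the
     functions [y_[kappa], y_[kappa + 1], ...] of [(q, v, u, u_[1], ...)], and
     the law returns [u] from them. *)
Definition quasi_static_feedback (kappa : 'I_m -> nat) (z0 : jet R p m) : Prop :=
  exists (k : nat) (A : set (('rV[R]_p * 'rV[R]_p) * 'M[R]_(k, m)))
         (alpha : ('rV[R]_p * 'rV[R]_p) * 'M[R]_(k, m) -> 'rV[R]_m),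
  [/\ open A /\ (forall x, A x -> config S x.1.1),
      smooth A alpha,
      forall z : jet R p m, A (z.1, trunc k z.2) ->
        forall j, output_deriv (closed_loop alpha) phi (kappa j) j z = z.2 0%N 0 j
    & exists (l : nat) (O : set (('rV[R]_p * 'rV[R]_p) * 'M[R]_(l.+1, m))),
        [/\ open O, lies_over O z0
          & forall z, lies_over O z -> A (z.1, trunc k (wjet kappa z)) /\
                      z.2 0%N = alpha (z.1, trunc k (wjet kappa z))]].

(* Jacobian of [(F_q, F_v)] with respect to [y_[0, kappa - 1]]. *)
Definition jacobian_upto (N : nat) (Fq Fv : 'M[R]_(N, m) -> 'rV[R]_p)
    (kappa : 'I_m -> nat) (Y : 'M[R]_(N, m)) :
    'M[R]_(p + p, \sum_(j < m) kappa j) :=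
  \mxrow_(j < m) col_mx
    (\matrix_(i < p, a < kappa j) pd Fq a j Y 0 i)
    (\matrix_(i < p, a < kappa j) pd Fv a j Y 0 i).

Definition equilibrium_yjet (N : nat) (q : 'rV[R]_p) : 'M[R]_(N, m) :=
  \matrix_(a, j) if a == 0 :> nat then phi q 0 j else 0.

Definition singular_at (N : nat) (Fq Fv : 'M[R]_(N, m) -> 'rV[R]_p)
    (kappa : 'I_m -> nat) (hkappa : (\sum_(j < m) kappa j = p + p)%N)
    (q : 'rV[R]_p) : Prop :=
  castmx (erefl, hkappa) (jacobian_upto Fq Fv kappa (equilibrium_yjet N q))
    \notin unitmx.

End FlatSystem.

Definition star (m : nat) (r kappa : 'I_m -> nat) : Prop :=
  exists2 j, r j = 4%N & forall i, kappa i = if i == j then 4%N else 2%N.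

(* Main.v *)
Require Import Defs.
From HB Require Import structures.
From mathcomp Require Import all_boot all_order all_algebra.
From mathcomp Require Import all_classical all_reals all_analysis.
Import Order.TTheory GRing.Theory Num.Theory.
Import numFieldNormedType.Exports.
Local Open Scope classical_set_scope.
Local Open Scope ring_scope.
Set Implicit Arguments.
Unset Strict Implicit.
Unset Printing Implicit Defensive.

(* Write the system as q'' = f(q, v, 0) + u B(q) (with f even in v) and put
   y_a = L_xi^a phi on the finite-dimensional space of (q, v, u, ..., u_[K-1]),
   xi being the truncated prolonged vector field. Flatness makes the
   differentials of finitely many y_a independent, so tangent vectors with
   prescribed dy_a exist ("vertical" ones change a single y^j_[b]).

   Orders: let P = dF_q/dy^j_[r-2] and k = dF_u/dy^j_[r], r = r^j; then
   P = k B and, J being the Jacobian of phi, P J = 0. If k B vanished on an open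
   set, shifting u along k would be a symmetry leaving every y_a unchanged, hence
   k = 0 by flatness, against minimality of R. So P <> 0 somewhere. If r >= 5,
   subtracting vertical vectors gives directions with dq = dv = 0 and arbitrary
   dy_2, so B J is invertible and P J = k B J = 0 forces P = 0. Hence r^j <= 4. As
   (q, v) is not a function of (y, y_[1]), some r^j = 4.

   (ii) Time reversal fixes equilibria and multiplies y_a by (-1)^a; so at an
   equilibrium dF_v only involves odd orders. A regular Jacobian then needs all
   kappa^j even, none of them is 0, and so kappa is (4, 2, ..., 2).

   (i) Where P <> 0 the matrix B has rank p - 1 and the input-free equation of
   motion is affine in y_[2] and contains neither theta'' nor theta', theta being
   the coordinate transverse to y. Solving it for y^j_[2] and differentiating
   twice expresses theta'' by (q, v, w, w_[1], w_[2]), which yields the law u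
   explicitly, without the implicit function theorem. *)

(** Jets have infinitely many input coordinates and carry no norm, while [Ck] and the flat maps live
    on normed spaces; hence the finite truncation. In (ii), parity alone does not determine kappa;
    the rest is a count of the rank p of dF_v against the odd orders below kappa, where p - m = 1 is
    the only excess. The statement is obtained as its second alternative. In (i), the law must give
    y_[kappa] = w in closed loop and return u in open loop. Both follow from the same functions of
    (q, v, w, w_[1], w_[2]): up to the last input derivative, every trajectory, open or closed,
    follows [base_field] plus an unknown multiple s of the kernel direction of J; y_[3] does not see
    s, and y_[4] is affine in it. Behind this is a single vector, vertical for y^j_[3]: it moves v
    along P and fixes q and y_[2], so theta' is absent from the input-free equation; it also changes
    y^j_[3] by 1, so the coefficient of s in y_[4] is not 0. As P <> 0 is known only at some point
    of each open set on which R is minimal, (i) is local at such points. *)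

(** * Directional derivatives and finite-dimensional spaces *)

Section Derivatives.
Context {R : realType}.
Implicit Types U V W : normedModType R.

Lemma derive_comp U V W (f : U -> V) (g : V -> W) x v :
  differentiable f x -> differentiable g (f x) ->
  'D_v (fun y => g (f y)) x = 'D_('D_v f x) g (f x).
Proof.
move=> df dg; have dgf := differentiable_comp df dg.
by rewrite -[fun y => g (f y)]/(g \o f) (deriveE _ dgf) diff_comp //= (deriveE _ df) (deriveE _ dg).
Qed.

Lemma derive_dirD V W (f : V -> W) x u v : differentiable f x ->
  'D_(u + v) f x = 'D_u f x + 'D_v f x.
Proof. by move=> df; rewrite !(deriveE _ df) linearD. Qed.

Lemma derive_dirZ V W (f : V -> W) x a v : differentiable f x ->
  'D_(a *: v) f x = a *: 'D_v f x.
Proof. by move=> df; rewrite !(deriveE _ df) linearZ. Qed.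

Lemma derive_dirN V W (f : V -> W) x v : differentiable f x ->
  'D_(- v) f x = - 'D_v f x.
Proof. by move=> df; rewrite !(deriveE _ df) linearN. Qed.

Lemma derive_dir_sum V W (f : V -> W) x (I : Type) (r : seq I) (P : pred I)
    (v : I -> V) : differentiable f x ->
  'D_(\sum_(i <- r | P i) v i) f x = \sum_(i <- r | P i) 'D_(v i) f x.
Proof.
move=> df; rewrite (deriveE _ df) linear_sum.
by apply: eq_bigr => i _; rewrite (deriveE _ df).
Qed.

Lemma lin_differentiable V W (f : V -> W) x : linear f -> continuous f ->
  differentiable f x.
Proof.
move=> lf cf.
pose fM := GRing.isLinear.Build _ _ _ _ _ lf.
pose fL : {linear V -> W} := HB.pack f fM.
exact: (@linear_differentiable R V W fL).
Qed.

Lemma lin_derive V W (f : V -> W) x v : linear f -> continuous f ->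
  'D_v f x = f v.
Proof.
move=> lf cf; rewrite (deriveE _ (lin_differentiable x lf cf)).
pose fM := GRing.isLinear.Build _ _ _ _ _ lf.
pose fL : {linear V -> W} := HB.pack f fM.
by rewrite (@diff_lin R V W fL).
Qed.



Lemma differentiable_near V W (f g : V -> W) x :
  (\near x, f x = g x) -> differentiable f x -> differentiable g x.
Proof.
move=> fg df.
have fx : f x = g x by exact: nbhs_singleton fg.
have dg : g \o shift x = cst (g x) + 'd f x +o_ (0 : V) id.
  have := diff_locally df => /eqaddoP fo.
  apply/eqaddoP => e e0.
  have := fo _ e0.
  have : \forall y \near (0 : V), f (y + x) = g (y + x).
    by rewrite (near_shift x) /=; near do rewrite /= sub0r subrK.
  move=> h1 h2; near=> y.
  have -> : (g \o shift x - (cst (g x) + 'd f x)) y = (f \o shift x - (cst (f x) + 'd f x)) y.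
    rewrite /= /shift fx; congr (_ - _).
    by apply/esym; near: y.
  by near: y.
apply/diff_locallyP.
have e : 'd g x = 'd f x :> (V -> W).
  by apply: diff_unique dg; exact: diff_continuous.
by rewrite e; split => //; exact: diff_continuous.
Unshelve. all: by end_near. Qed.

Lemma scale_bilinear V :
  bilinear_for
    (GRing.Scale.Law.clone _ _ *:%R _) (GRing.Scale.Law.clone _ _ *:%R _)
    (@GRing.scale R V : R -> V -> V).
Proof.
split=> [u'|u] a x y /=.
- by rewrite scalerDl scalerA.
- by rewrite scalerDr !scalerA mulrC.
Qed.

Lemma is_diff_scale_pair V (p : R * V) :
  is_diff p (fun q => q.1 *: q.2 : V) (fun q => p.1 *: q.2 + q.1 *: p.2).
Proof.
pose bM := bilinear_isBilinear.Build R R V V _ _ _ (scale_bilinear V).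
pose b : {bilinear R -> V -> V} := HB.pack (@GRing.scale R V : R -> V -> V) bM.
have cb : continuous (fun q : R * V => b q.1 q.2) by exact: scale_continuous.
apply: DiffDef; last by rewrite (@diff_bilin R R V V b).
exact: (@differentiable_bilin R R V V b).
Qed.

Lemma differentiable_scale V W (a : V -> R) (f : V -> W) x :
  differentiable a x -> differentiable f x ->
  differentiable (fun y => a y *: f y) x.
Proof.
move=> da df; have dp := differentiable_pair da df.
have := @ex_diff _ _ _ _ _ _ _ (is_diff_scale_pair (a x, f x)).
exact: (differentiable_comp dp).
Qed.

Lemma derive_scale V W (a : V -> R) (f : V -> W) x v :
  differentiable a x -> differentiable f x ->
  'D_v (fun y => a y *: f y) x = a x *: 'D_v f x + 'D_v a x *: f x.
Proof.
move=> da df; have dp := differentiable_pair da df.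
have h := is_diff_scale_pair (a x, f x).
have dh := @ex_diff _ _ _ _ _ _ _ h.
rewrite (@derive_comp _ _ _ (fun y => (a y, f y)) (fun q : R * W => q.1 *: q.2)) //.
rewrite (deriveE _ dh) (@diff_val _ _ _ _ _ _ _ h) /=.
by rewrite (deriveE _ dp) diff_pair //= (deriveE _ da) (deriveE _ df).
Qed.

Lemma derive_pair U V W (f : U -> V) (g : U -> W) x v :
  differentiable f x -> differentiable g x ->
  'D_v (fun y => (f y, g y)) x = ('D_v f x, 'D_v g x).
Proof.
move=> df dg; have dp := differentiable_pair df dg.
by rewrite (deriveE _ dp) diff_pair //= (deriveE _ df) (deriveE _ dg).
Qed.

(* [normedModType] carries no dimension; a finite basis with continuous
   coordinates is what the chain rule for [Ck] needs. *)
Definition fin_dim V := exists n (e : 'I_n -> V) (c : 'I_n -> V -> R),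
  (forall i, linear (c i : V -> R^o) /\ continuous (c i)) /\
  forall v, v = \sum_i c i v *: e i.

Lemma fin_dim_R : fin_dim (R : normedModType R).
Proof.
exists 1%N, (fun=> 1), (fun _ x => x); split => [i|v]; last first.
  by rewrite big_ord1 [_ *: _]mulr1.
by split => // x; exact: cvg_id.
Qed.

Lemma fin_dim_mx a b : fin_dim ('M[R]_(a, b)).
Proof.
exists #|{: 'I_a * 'I_b}|, (fun k => delta_mx (enum_val k).1 (enum_val k).2),
  (fun k (M : 'M[R]_(a, b)) => M (enum_val k).1 (enum_val k).2); split => [k|M].
  split; last exact: coord_continuous.
  by move=> t x y; rewrite !mxE.
rewrite [LHS]matrix_sum_delta pair_big /=.
by rewrite (reindex (enum_val : 'I_#|{: 'I_a * 'I_b}| -> _)) //=; apply: onW_bij;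
  exact: enum_val_bij.
Qed.

Lemma fin_dim_pair V W : fin_dim V -> fin_dim W -> fin_dim (V * W)%type.
Proof.
move=> [n [e [c [cl ce]]]] [m [f [d [dl de]]]].
exists (n + m)%N, (fun k => match fintype.split k with inl i => (e i, 0) | inr j => (0, f j) end),
  (fun k v => match fintype.split k with inl i => c i v.1 | inr j => d j v.2 end);
    split => [k|[v w]].
  case: (fintype.split k) => i.
    split; first by move=> t x y /=; exact: (cl i).1.
    by move=> x; apply: (@continuous_comp _ _ _ fst (c i)); [exact: cvg_fst|exact: (cl i).2].
  split; first by move=> t x y /=; exact: (dl i).1.
  by move=> x; apply: (@continuous_comp _ _ _ snd (d i)); [exact: cvg_snd|exact: (dl i).2].
rewrite big_split_ord /=.
under eq_bigr => i _ do rewrite (unsplitK (inl i)) /=.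
under [X in _ + X]eq_bigr => i _ do rewrite (unsplitK (inr i)) /=.
transitivity (\sum_i (c i v *: e i, 0 : W) + \sum_j (0 : V, d j w *: f j)); last first.
  by congr (_ + _); apply: eq_bigr => i _; congr (_, _); rewrite /= ?scaler0.
have l (I : finType) (F : I -> V) : \sum_i (F i, 0 : W) = (\sum_i F i, 0).
  elim/big_ind2 : _ => // x y x' y' -> ->; congr (_, _) => //=; exact: addr0.
have r (I : finType) (F : I -> W) : \sum_i (0 : V, F i) = (0, \sum_i F i).
  elim/big_ind2 : _ => // x y x' y' -> ->; congr (_, _) => //=; exact: addr0.
rewrite l r; congr (_, _) => /=; rewrite ?addr0 ?add0r; [exact: ce|exact: de].
Qed.

Lemma lin_continuous V W (f : V -> W) : fin_dim V -> linear f -> continuous f.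
Proof.
move=> [n [e [c [cl ce]]]] lf.
pose fM := GRing.isLinear.Build _ _ _ _ _ lf.
pose fL : {linear V -> W} := HB.pack f fM.
have -> : f = fun v => \sum_i c i v *: f (e i).
  apply: funext => v; rewrite {1}(ce v) -[f]/(fL : V -> W) linear_sum.
  by apply: eq_bigr => i _; rewrite linearZ.
move=> x.
have h (r : seq 'I_n) : {for x, continuous (fun v => \sum_(i <- r) c i v *: f (e i))}.
  elim: r => [|i r IH].
    have -> : (fun v => \sum_(i <- [::]) c i v *: f (e i)) = fun=> 0 :> W.
      by apply: funext => v; rewrite big_nil.
    exact: cvg_cst.
  have -> : (fun v => \sum_(i <- i :: r) c i v *: f (e i)) =
            fun v => c i v *: f (e i) + \sum_(i <- r) c i v *: f (e i).
    by apply: funext => v; rewrite big_cons.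
  by apply: cvgD => //; apply: cvgZr_tmp; exact: (cl i).2.
exact: h.
Qed.

(** * Closure properties of [Ck] *)

Section Ck.
Implicit Types k : nat.

Lemma Ck_diff k V W (A : set V) (f : V -> W) x : Ck k.+1 A f -> A x ->
  differentiable f x.
Proof. by case=> h _; exact: h. Qed.

Lemma CkW k V W (A : set V) (f : V -> W) : Ck k.+1 A f -> Ck k A f.
Proof.
elim: k f => [|k IH] f; first by case=> h _ x Ax; exact/differentiable_continuous/h.
by case=> h1 h2; split => // v; apply: IH.
Qed.

Lemma Ck_sub k V W (A B : set V) (f : V -> W) : A `<=` B -> Ck k B f -> Ck k A f.
Proof.
move=> AB; elim: k f => [|k IH] f /=; first by move=> h x /AB; exact: h.
by case=> h1 h2; split => [x /AB|v]; [exact: h1|exact: IH].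
Qed.

Lemma open_near V (A : set V) x (P : V -> Prop) : open A -> A x ->
  (forall y, A y -> P y) -> \near x, P x.
Proof. by move=> oA Ax h; apply: filterS h _; exact: open_nbhs_nbhs. Qed.

Lemma derive_ext V W (A : set V) (f g : V -> W) x v : open A -> A x ->
  (forall y, A y -> f y = g y) -> 'D_v f x = 'D_v g x.
Proof. by move=> oA Ax h; apply: near_eq_derive; exact: open_near h. Qed.

(** [Ck] speaks of total functions, whose values off [A] are arbitrary; openness of [A] lets a
    formula valid on [A] replace the function at every order. *)
Lemma Ck_ext k V W (A : set V) (f g : V -> W) : open A ->
  (forall y, A y -> f y = g y) -> Ck k A f -> Ck k A g.
Proof.
move=> oA; elim: k f g => [|k IH] f g fg /=.
  move=> h x Ax; change (g @ x --> g x); rewrite -(fg x Ax); apply: cvg_trans (h x Ax).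
  by apply: near_eq_cvg; apply: open_near oA Ax _ => y Ay; rewrite fg.
case=> h1 h2; split => [x Ax|v].
  by apply: differentiable_near (h1 x Ax); exact: open_near fg.
by apply: IH (h2 v) => y Ay; apply: derive_ext fg.
Qed.

Lemma Ck_cst k V W (A : set V) (w : W) : Ck k A (fun=> w).
Proof.
elim: k w => [|k IH] w /=; first by move=> x _; exact: cvg_cst.
split => [x _|v]; first exact: differentiable_cst.
have -> : (fun x : V => 'D_v (fun=> w) x) = fun=> 0; last exact: IH.
by apply: funext => x; exact: derive_cst.
Qed.

Lemma Ck_lin k V W (A : set V) (f : V -> W) : linear f -> continuous f -> Ck k A f.
Proof.
move=> lf cf; case: k => [|k] /=; first by move=> x _; exact: cf.
split => [x _|v]; first exact: lin_differentiable.
have -> : 'D_v f = fun=> f v; last exact: Ck_cst.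
by apply: funext => x; exact: lin_derive.
Qed.

Lemma Ck_add k V W (A : set V) (f g : V -> W) : open A -> Ck k A f -> Ck k A g ->
  Ck k A (fun x => f x + g x).
Proof.
move=> oA; elim: k f g => [|k IH] f g /=.
  by move=> hf hg x Ax; apply: cvgD; [exact: hf|exact: hg].
move=> [f1 f2] [g1 g2]; split => [x Ax|v].
  by apply: differentiableD; [exact: f1|exact: g1].
apply: Ck_ext (IH _ _ (f2 v) (g2 v)) => // x Ax; apply/esym.
by rewrite deriveD //; apply: diff_derivable; [exact: f1|exact: g1].
Qed.

Lemma Ck_scale k V W (A : set V) (a : V -> R) (f : V -> W) : open A ->
  Ck k A a -> Ck k A f -> Ck k A (fun x => a x *: f x).
Proof.
move=> oA; elim: k a f => [|k IH] a f.
  by move=> ha hf x Ax; apply: cvgZ; [exact: ha|exact: hf].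
move=> ca cf; split => [x Ax|v].
  by apply: differentiable_scale; [exact: ca.1|exact: cf.1].
apply: (@Ck_ext _ _ _ _ (fun x => a x *: 'D_v f x + 'D_v a x *: f x)) => //.
  by move=> x Ax; rewrite derive_scale //; [exact: ca.1|exact: cf.1].
apply: Ck_add => //; apply: IH; try exact: CkW; [exact: cf.2|exact: ca.2].
Qed.

Lemma Ck_linl k U V W (A : set U) (f : U -> V) (g : V -> W) : open A ->
  linear g -> continuous g -> Ck k A f -> Ck k A (fun x => g (f x)).
Proof.
move=> oA lg cg; elim: k f => [|k IH] f.
  by move=> hf x Ax; apply: (@continuous_comp _ _ _ f g); [exact: hf|exact: cg].
move=> cf; split => [x Ax|v].
  by apply: differentiable_comp; [exact: cf.1|exact: lin_differentiable].
apply: (@Ck_ext _ _ _ _ (fun x => g ('D_v f x))) => //; last exact/IH/cf.2.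
move=> x Ax; have df := cf.1 x Ax; have dg := lin_differentiable (f x) lg cg.
by rewrite (derive_comp _ df dg) (lin_derive _ _ lg cg).
Qed.

Lemma Ck_sum k V W (A : set V) (I : Type) (r : seq I) (P : pred I) (f : I -> V -> W) : open A ->
  (forall i, P i -> Ck k A (f i)) -> Ck k A (fun x => \sum_(i <- r | P i) f i x).
Proof.
move=> oA h; elim: r => [|i r IH].
  by apply: Ck_ext (Ck_cst _ _ (0 : W)) => // x _; rewrite big_nil.
case Pi : (P i); last by apply: Ck_ext IH => // x _; rewrite big_cons Pi.
by apply: (Ck_ext _ _ (Ck_add oA (h i Pi) IH)) => // x _; rewrite big_cons Pi.
Qed.

(** By the chain rule [g] is differentiated in the direction ['D_v f x], which varies with [x],
    while [Ck] controls fixed directions. Expanding in a basis leaves products of coordinates with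
    fixed partials, to which the induction applies. *)
Lemma Ck_comp k U V W (A : set U) (B : set V) (f : U -> V) (g : V -> W) :
  fin_dim V -> open A -> open B -> (forall x, A x -> B (f x)) ->
  Ck k A f -> Ck k B g -> Ck k A (fun x => g (f x)).
Proof.
move=> [n [e [c [cl ce]]]] oA oB AB; elim: k f g AB => [|k IH] f g AB.
  by move=> hf hg x Ax; apply: (@continuous_comp _ _ _ f g); [exact: hf|exact/hg/AB].
move=> cf cg; split => [x Ax|v].
  by apply: differentiable_comp; [exact: cf.1|exact/cg.1/AB].
apply: (@Ck_ext _ _ _ _ (fun x => \sum_i c i ('D_v f x) *: 'D_(e i) g (f x))) => //.
  move=> x Ax; have dg := cg.1 _ (AB _ Ax).
  rewrite (derive_comp v (cf.1 x Ax) dg) [in RHS](ce ('D_v f x)) (derive_dir_sum _ _ _ dg).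
  by apply: eq_bigr => i _; rewrite derive_dirZ.
apply: Ck_sum => // i _; apply: Ck_scale => //.
  by apply: (Ck_linl oA (cl i).1 (cl i).2); exact: cf.2.
by apply: (IH _ (fun y => 'D_(e i) g y)) => //; [exact: CkW|exact: cg.2].
Qed.

Lemma Ck_inv k V (A : set V) (f : V -> R) : open A -> (forall x, A x -> f x != 0) ->
  Ck k A f -> Ck k A (fun x => (f x)^-1).
Proof.
move=> oA f0; elim: k => [|k IH] cf.
  by move=> x Ax; apply: cvgV; [exact: f0|exact: cf].
split => [x Ax|v]; first by apply: differentiableV; [exact: cf.1|exact: f0].
have ic := IH (CkW cf).
apply: (@Ck_ext _ _ _ _ (fun x => - ((f x)^-1 *: ((f x)^-1 *: 'D_v f x)))) => //.
  move=> x Ax; rewrite (deriveV (f0 x Ax) (diff_derivable (cf.1 x Ax))).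
  by rewrite scalerA -scaleNr expr2 invfM.
apply: (@Ck_linl _ _ _ _ _ _ -%R) => //.
- by move=> a x y; rewrite opprD scalerN.
- exact: opp_continuous.
- by apply: Ck_scale => //; apply: Ck_scale => //; exact: cf.2.
Qed.
End Ck.
End Derivatives.

Global Hint Extern 0 (fin_dim _) =>
  solve [repeat first [apply: fin_dim_mx | apply: fin_dim_R | apply: fin_dim_pair]] : core.

(** * Calculus of smooth scalar and matrix functions *)

Section SmoothFunctions.
Context {R : realType}.
Implicit Types U V W : normedModType R.

Lemma smooth_diff V W (A : set V) (f : V -> W) x : smooth A f -> A x ->
  differentiable f x.
Proof. by move=> sf; exact: (Ck_diff (sf 1%N)). Qed.

Lemma smooth_subset V W (A B : set V) (f : V -> W) : A `<=` B -> smooth B f -> smooth A f.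
Proof. by move=> AB sf k; exact: Ck_sub (sf k). Qed.

Lemma smooth_ext V W (A : set V) (f g : V -> W) : open A ->
  (forall y, A y -> f y = g y) -> smooth A f -> smooth A g.
Proof. by move=> oA fg sf k; exact: Ck_ext (sf k). Qed.

Lemma smooth_cst V W (A : set V) (w : W) : smooth A (fun=> w).
Proof. by move=> k; exact: Ck_cst. Qed.

Lemma smooth_lin V W (A : set V) (f : V -> W) : fin_dim V -> linear f -> smooth A f.
Proof. by move=> fV lf k; apply: Ck_lin => //; exact: lin_continuous. Qed.

Lemma smooth_add V W (A : set V) (f g : V -> W) : open A -> smooth A f -> smooth A g ->
  smooth A (fun x => f x + g x).
Proof. by move=> oA sf sg k; exact: Ck_add. Qed.

Lemma smooth_scale V W (A : set V) (a : V -> R) (f : V -> W) : open A ->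
  smooth A a -> smooth A f -> smooth A (fun x => a x *: f x).
Proof. by move=> oA sf sg k; exact: Ck_scale. Qed.

Lemma smooth_mul V (A : set V) (a f : V -> R) : open A ->
  smooth A a -> smooth A f -> smooth A (fun x => a x * f x).
Proof. exact: (@smooth_scale V (R : normedModType R)). Qed.

Lemma smooth_opp V W (A : set V) (f : V -> W) : open A -> smooth A f ->
  smooth A (fun x => - f x).
Proof.
move=> oA sf; apply: (@smooth_ext _ _ _ (fun x => (-1) *: f x)) => //.
  by move=> x _; rewrite scaleN1r.
by apply: smooth_scale => //; exact: smooth_cst.
Qed.

Lemma smooth_minus V W (A : set V) (f g : V -> W) : open A -> smooth A f -> smooth A g ->
  smooth A (fun x => f x - g x).
Proof. by move=> oA sf sg; apply: smooth_add => //; exact: smooth_opp. Qed.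

Lemma smooth_sum V W (A : set V) (I : Type) (r : seq I) (P : pred I) (f : I -> V -> W) :
  open A -> (forall i, P i -> smooth A (f i)) ->
  smooth A (fun x => \sum_(i <- r | P i) f i x).
Proof. by move=> oA sf k; apply: Ck_sum => // i /sf. Qed.

Lemma smooth_prod V (A : set V) (I : Type) (r : seq I) (P : pred I) (f : I -> V -> R) :
  open A -> (forall i, P i -> smooth A (f i)) ->
  smooth A (fun x => \prod_(i <- r | P i) f i x).
Proof.
move=> oA h; elim: r => [|i r IH].
  apply: (@smooth_ext V (R : normedModType R) A (fun=> 1)) => //; last exact: smooth_cst.
  by move=> x _; rewrite big_nil.
case Pi : (P i); last by apply: (smooth_ext oA _ IH) => x _; rewrite big_cons Pi.
by apply: (smooth_ext oA _ (smooth_mul oA (h i Pi) IH)) => x _; rewrite big_cons Pi.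
Qed.

Lemma smooth_linl U V W (A : set U) (g : V -> W) (f : U -> V) : fin_dim V -> open A ->
  linear g -> smooth A f -> smooth A (fun x => g (f x)).
Proof. by move=> fV oA lg sf k; apply: Ck_linl => //; exact: lin_continuous. Qed.

Lemma smooth_comp U V W (A : set U) (B : set V) (g : V -> W) (f : U -> V) :
  fin_dim V -> open A -> open B -> (forall x, A x -> B (f x)) ->
  smooth A f -> smooth B g -> smooth A (fun x => g (f x)).
Proof. by move=> fV oA oB AB sf sg k; exact: (@Ck_comp _ _ _ _ _ _ B). Qed.

Lemma smooth_inv V (A : set V) (f : V -> R) : open A -> (forall x, A x -> f x != 0) ->
  smooth A f -> smooth A (fun x => (f x)^-1).
Proof. by move=> oA f0 sf k; exact: Ck_inv. Qed.

Lemma smooth_derive V W (A : set V) (f : V -> W) v : smooth A f -> smooth A ('D_v f).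
Proof. by move=> sf k; exact: (sf k.+1).2. Qed.

(** Smoothness of iterated Lie derivatives rests on this; the moving direction is again expanded in
    a basis. *)
Lemma smooth_derive_field V W (A : set V) (f : V -> W) (xi : V -> V) : fin_dim V ->
  open A -> smooth A f -> smooth A xi -> smooth A (fun x => 'D_(xi x) f x).
Proof.
move=> [n [e [c [cl ce]]]] oA sf sxi.
apply: (@smooth_ext _ _ _ (fun x => \sum_i c i (xi x) *: 'D_(e i) f x)) => //.
  move=> x Ax; have df := smooth_diff sf Ax.
  rewrite [in RHS](ce (xi x)) (derive_dir_sum _ _ _ df).
  by apply: eq_bigr => i _; rewrite derive_dirZ.
apply: smooth_sum => // i _; apply: smooth_scale => //; last exact: smooth_derive.
by move=> k; apply: (Ck_linl oA (cl i).1 (cl i).2).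
Qed.

Lemma smooth_pair U V W (A : set U) (f : U -> V) (g : U -> W) : fin_dim V -> fin_dim W ->
  open A -> smooth A f -> smooth A g -> smooth A (fun x => (f x, g x)).
Proof.
move=> fV fW oA sf sg.
have s1 : smooth A (fun x => (f x, 0 : W)).
  apply: (@smooth_linl U V (V * W)%type A (fun y => (y, 0 : W))) => //.
  by move=> a x y; congr (_, _) => /=; rewrite scaler0 addr0.
have s2 : smooth A (fun x => (0 : V, g x)).
  apply: (@smooth_linl U W (V * W)%type A (fun y => (0 : V, y))) => //.
  by move=> a x y; congr (_, _) => /=; rewrite scaler0 addr0.
apply: (smooth_ext oA _ (smooth_add oA s1 s2)) => x _.
by congr (_, _) => /=; rewrite ?addr0 ?add0r.
Qed.

Lemma smooth_snd U V W (A : set U) (f : U -> V * W) : fin_dim V -> fin_dim W ->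
  open A -> smooth A f -> smooth A (fun x => (f x).2).
Proof. by move=> fV fW oA; apply: smooth_linl => //; exact: fin_dim_pair. Qed.

Lemma smooth_id U (A : set U) : fin_dim U -> smooth A id.
Proof. by move=> fU; exact: smooth_lin. Qed.

Lemma smooth_coord V a b (A : set V) (f : V -> 'M[R]_(a, b)) i j : open A ->
  smooth A f -> smooth A (fun x => f x i j).
Proof.
move=> oA; apply: (@smooth_linl _ _ (R : normedModType R) _ (fun M : 'M[R]_(a, b) => M i j)) => //.
by move=> t x y; rewrite !mxE.
Qed.

Lemma smooth_mx V a b (A : set V) (f : V -> 'M[R]_(a, b)) : open A ->
  (forall i j, smooth A (fun x => f x i j)) -> smooth A f.
Proof.
move=> oA sf.
apply: (@smooth_ext _ _ _ (fun x => \sum_i \sum_j f x i j *: delta_mx i j)) => //.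
  by move=> x _; rewrite -matrix_sum_delta.
apply: smooth_sum => // i _; apply: smooth_sum => // j _; apply: smooth_scale => //.
exact: smooth_cst.
Qed.

Lemma smooth_mulmx V a b c (A : set V) (f : V -> 'M[R]_(a, b)) (g : V -> 'M[R]_(b, c)) :
  open A -> smooth A f -> smooth A g -> smooth A (fun x => f x *m g x).
Proof.
move=> oA sf sg; apply: smooth_mx => // i j.
apply: (@smooth_ext _ _ _ (fun x => \sum_k f x i k * g x k j)) => //.
  by move=> x _; rewrite mxE.
by apply: smooth_sum => // k _; apply: smooth_mul => //; exact: smooth_coord.
Qed.

Lemma smooth_det V n (A : set V) (f : V -> 'M[R]_n) : open A -> smooth A f ->
  smooth A (fun x => \det (f x)).
Proof.
move=> oA sf; rewrite /determinant; apply: smooth_sum => // s _.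
apply: smooth_mul => //; first exact: smooth_cst.
by apply: smooth_prod => // i _; exact: smooth_coord.
Qed.

Lemma smooth_invmx V n (A : set V) (f : V -> 'M[R]_n) : open A ->
  (forall x, A x -> f x \in unitmx) -> smooth A f -> smooth A (fun x => invmx (f x)).
Proof.
move=> oA uf sf.
(* Cramer's rule: the inverse is rational in the entries. *)
apply: (@smooth_ext _ _ _ (fun x => (\det (f x))^-1 *: \adj (f x))) => //.
  by move=> x Ax; rewrite /invmx (uf x Ax).
apply: smooth_scale => //.
  apply: smooth_inv => //; last exact: smooth_det.
  by move=> x Ax; have := uf x Ax; rewrite unitmxE unitfE.
apply: smooth_mx => // i j.
apply: (@smooth_ext _ _ _ (fun x => cofactor (f x) j i)) => //.
  by move=> x _; rewrite mxE.
rewrite /cofactor; apply: smooth_mul => //; first exact: smooth_cst.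
apply: smooth_det => //; apply: smooth_mx => // k l.
apply: (@smooth_ext _ _ _ (fun x => f x (lift j k) (lift i l))) => //.
  by move=> x _; rewrite !mxE.
exact: smooth_coord.
Qed.

Lemma derive_coord V a b (f : V -> 'M[R]_(a, b)) x v i j : differentiable f x ->
  'D_v (fun y => f y i j) x = ('D_v f x) i j.
Proof.
move=> df; have l : linear (fun M : 'M[R]_(a, b) => M i j : R).
  by move=> t y z; rewrite !mxE.
have c : continuous (fun M : 'M[R]_(a, b) => M i j : R) by exact: coord_continuous.
by rewrite (@derive_comp _ _ _ (R : normedModType R) f (fun M : 'M[R]_(a, b) => M i j) x v df
  (lin_differentiable _ l c)) (lin_derive _ _ l c).
Qed.

Lemma derive_linl U V W (f : U -> V) (g : V -> W) x v : fin_dim V -> linear g ->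
  differentiable f x -> 'D_v (fun y => g (f y)) x = g ('D_v f x).
Proof.
move=> fV lg df; have cg := lin_continuous fV lg.
by rewrite (derive_comp v df (lin_differentiable _ lg cg)) (lin_derive _ _ lg cg).
Qed.

Lemma differentiable_linl U V W (f : U -> V) (g : V -> W) x : fin_dim V -> linear g ->
  differentiable f x -> differentiable (fun y => g (f y)) x.
Proof.
move=> fV lg df; have cg := lin_continuous fV lg.
exact: (differentiable_comp df (lin_differentiable _ lg cg)).
Qed.

Lemma derive_add V W (f g : V -> W) x v : differentiable f x -> differentiable g x ->
  'D_v (fun y => f y + g y) x = 'D_v f x + 'D_v g x.
Proof. by move=> df dg; apply: (deriveD (diff_derivable df) (diff_derivable dg)). Qed.

Lemma derive_sums V W (I : Type) (r : seq I) (P : pred I) (f : I -> V -> W) x v :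
  (forall i, P i -> differentiable (f i) x) ->
  differentiable (fun y => \sum_(i <- r | P i) f i y) x /\
  'D_v (fun y => \sum_(i <- r | P i) f i y) x = \sum_(i <- r | P i) 'D_v (f i) x.
Proof.
move=> df; elim: r => [|i r [d IH]].
  rewrite big_nil; have -> : (fun y => \sum_(i <- [::] | P i) f i y) = fun=> 0.
    by apply: funext => y; rewrite big_nil.
  by split; [exact: differentiable_cst|exact: derive_cst].
case Pi : (P i); last first.
  rewrite big_cons Pi; have -> // : (fun y => \sum_(i <- i :: r | P i) f i y) = fun y => \sum_(i
    <- r | P i) f i y.
  by apply: funext => y; rewrite big_cons Pi.
have di := df i Pi.
rewrite big_cons Pi -IH; have -> : (fun y => \sum_(i <- i :: r | P i) f i y) = fun y => f i y +
  \sum_(i <- r | P i) f i y.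
  by apply: funext => y; rewrite big_cons Pi.
by split; [exact: differentiableD|exact: derive_add].
Qed.

Lemma derive_mulmx V a b c (f : V -> 'M[R]_(a, b)) (g : V -> 'M[R]_(b, c)) x v :
  differentiable f x -> differentiable g x ->
  differentiable (fun y => f y *m g y) x /\
  'D_v (fun y => f y *m g y) x = 'D_v f x *m g x + f x *m 'D_v g x.
Proof.
move=> df dg.
have dfc i k : differentiable (fun y => f y i k) x.
  apply: (@differentiable_linl _ _ _ f (fun M : 'M[R]_(a, b) => M i k : R)) => //.
  by move=> t y z; rewrite !mxE.
have dgc k j : differentiable (fun y => g y k j) x.
  apply: (@differentiable_linl _ _ _ g (fun M : 'M[R]_(b, c) => M k j : R)) => //.
  by move=> t y z; rewrite !mxE.
have E : (fun y => f y *m g y) = fun y => \sum_i \sum_j \sum_k f y i k *: (g y k j *: delta_mx i j).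
  apply: funext => y; rewrite [LHS]matrix_sum_delta.
  apply: eq_bigr => i _; apply: eq_bigr => j _; rewrite mxE scaler_suml.
  by apply: eq_bigr => k _; rewrite scalerA.
have d1 i j k : differentiable (fun y => g y k j *: (delta_mx i j : 'M[R]_(a, c))) x.
  by apply: differentiable_scale => //; exact: differentiable_cst.
have d2 i j k : differentiable (fun y => f y i k *: (g y k j *: (delta_mx i j : 'M[R]_(a, c)))) x.
  exact: differentiable_scale.
have s1 i j := derive_sums (index_enum _) v (fun k (_ : true) => d2 i j k).
have s2 i := derive_sums (index_enum _) v (fun j (_ : true) => (s1 i j).1).
have [s3 s4] := derive_sums (index_enum _) v (fun i (_ : true) => (s2 i).1).
rewrite E; split => //; rewrite s4 [RHS]matrix_sum_delta.
apply: eq_bigr => i _; rewrite (s2 i).2; apply: eq_bigr => j _; rewrite (s1 i j).2.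
rewrite !mxE -big_split scaler_suml; apply: eq_bigr => k _ /=.
rewrite (derive_scale v (dfc i k) (d1 i j k)) (derive_scale v (dgc k j) (differentiable_cst _ _)).
rewrite derive_cst scaler0 add0r !derive_coord //.
by rewrite !scalerA -scalerDl addrC.
Qed.
End SmoothFunctions.

(** * Euler-Lagrange equations *)

Section Mechanics.
Context {R : realType} {p m : nat}.
Implicit Types (q v a : 'rV[R]_p) (x : 'rV[R]_p * 'rV[R]_p) (u : 'rV[R]_m).

Lemma open_comp_fst (V W : normedModType R) (A : set V) : open A ->
  open [set x : V * W | A x.1].
Proof.
by move=> oA; apply: (@open_comp _ _ (fst : V * W -> V) A) => // x _; exact: cvg_fst.
Qed.

(** The kinetic energy is quadratic in the velocity, so [dL/dv] is [v *m M], and its time derivative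
    contributes [a *m M] and terms quadratic in [v]. This form exhibits the two facts used later:
    affine in [a], even in [v]. *)
Lemma euler_lagrangeE (A : set 'rV[R]_p) (M : 'rV[R]_p -> 'M[R]_p) (P : 'rV[R]_p -> R)
    x a i : open A -> smooth A M -> smooth A P ->
  (forall q, A q -> (M q)^T = M q) -> A x.1 ->
  euler_lagrange (lagrangian M P) x a i =
    (a *m M x.1) 0 i + (x.2 *m 'D_x.2 M x.1) 0 i
    - 2^-1 * (x.2 *m 'D_(delta_mx 0 i) M x.1 *m x.2^T) 0 0
    + 'D_(delta_mx 0 i) P x.1.
Proof.
move=> oA sM sP symM Ax.
pose V := ('rV[R]_p * 'rV[R]_p)%type.
have fst_lin : linear (fst : V -> 'rV[R]_p) by [].
have snd_lin : linear (snd : V -> 'rV[R]_p) by [].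
have dfst (y : V) : differentiable (fst : V -> 'rV[R]_p) y.
  by apply: lin_differentiable => //; exact: lin_continuous.
have dsnd (y : V) : differentiable (snd : V -> 'rV[R]_p) y.
  by apply: lin_differentiable => //; exact: lin_continuous.
have Dfst (y d : V) : 'D_d (fst : V -> 'rV[R]_p) y = d.1.
  by apply: lin_derive => //; exact: lin_continuous.
have Dsnd (y d : V) : 'D_d (snd : V -> 'rV[R]_p) y = d.2.
  by apply: lin_derive => //; exact: lin_continuous.
have dM (y d : V) : A y.1 -> differentiable (fun z : V => M z.1) y /\
    'D_d (fun z : V => M z.1) y = 'D_(d.1) M y.1.
  move=> Ay; have dM := smooth_diff sM Ay.
  split; first exact: (differentiable_comp (dfst y) dM).
  by rewrite (@derive_comp _ _ _ _ fst M y d (dfst y) dM) Dfst.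
have dP (y d : V) : A y.1 -> differentiable (fun z : V => P z.1) y /\
    'D_d (fun z : V => P z.1) y = 'D_(d.1) P y.1.
  move=> Ay; have dP := smooth_diff sP Ay.
  split; first exact: (differentiable_comp (dfst y) dP).
  by rewrite (@derive_comp _ _ _ (R : normedModType R) fst P y d (dfst y) dP) Dfst.
have dp (y d : V) : A y.1 -> differentiable (fun z : V => z.2 *m M z.1) y /\
    'D_d (fun z : V => z.2 *m M z.1) y = d.2 *m M y.1 + y.2 *m 'D_(d.1) M y.1.
  move=> Ay; have [d1 D1] := dM y d Ay.
  by have [d2 D2] := derive_mulmx d (dsnd y) d1; rewrite D2 D1 Dsnd.
have tr_lin : linear (@trmx R 1 p) by move=> ? ? ?; rewrite linearP.
have dL (y d : V) : A y.1 -> 'D_d (lagrangian M P) y =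
    2^-1 * ((d.2 *m M y.1 + y.2 *m 'D_(d.1) M y.1) *m y.2^T + y.2 *m M y.1 *m d.2^T) 0 0
    - 'D_(d.1) P y.1.
  move=> Ay; have [d1 D1] := dp y d Ay; have [d2 D2] := dP y d Ay.
  have d3 := differentiable_linl (@fin_dim_mx R 1 p) tr_lin (dsnd y).
  have D3 := derive_linl d (@fin_dim_mx R 1 p) tr_lin (dsnd y).
  have [d4 D4] := derive_mulmx d d1 d3.
  have l5 : linear (fun N : 'M[R]_1 => 2^-1 * N 0 0 : R).
    by move=> t z w; rewrite !mxE mulrDr mulrCA.
  have d5 := differentiable_linl (@fin_dim_mx R 1 1) l5 d4.
  have D5 := derive_linl d (@fin_dim_mx R 1 1) l5 d4.
  rewrite /lagrangian (deriveB (diff_derivable d5) (diff_derivable d2)).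
  by rewrite D5 D4 D3 D1 D2 Dsnd.
have dLv (y : V) : A y.1 -> 'D_(0, delta_mx 0 i) (lagrangian M P) y = (y.2 *m M y.1) 0 i.
  move=> Ay; rewrite dL //=.
  rewrite (deriveE _ (smooth_diff sM Ay)) linear0 mulmx0 addr0.
  rewrite (deriveE _ (smooth_diff sP Ay)) linear0 subr0.
  (* Symmetry of [M] makes the two halves of the derivative of the quadratic form equal, which
     cancels the factor [2^-1]. *)
  have -> : (delta_mx 0 i : 'rV[R]_p) *m M y.1 *m y.2^T = (y.2 *m M y.1 *m (delta_mx 0 i)^T)^T.
    by rewrite !trmx_mul trmxK symM // mulmxA.
  rewrite trmx_delta -colE !mxE.
  set c := \sum_j _.
  by rewrite -[c + c]mulr2n -[c *+ 2]mulr_natl mulrA mulVf ?mul1r // pnatr_eq0.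
rewrite /euler_lagrange.
have oA1 : open [set y : V | A y.1] by exact: open_comp_fst.
rewrite (@derive_ext _ _ _ [set y : V | A y.1] _ (fun y : V => (y.2 *m M y.1) 0 i)) //.
have [d1 D1] := dp x (x.2, a) Ax.
rewrite (derive_coord _ _ _ d1) D1 dL //= mul0mx add0r trmx0 mulmx0 addr0.
by rewrite [in LHS]mxE opprB addrA addrAC.
Qed.

Section System.
Variable S : lagrangian_system R p m.

Definition drift x : 'rV[R]_p := accel S (x, 0).

(** Read off at velocity [0], since the input enters the acceleration with coefficients that depend
    on [q] alone. *)
Definition input_mx q : 'M[R]_(m, p) :=
  \matrix_j (accel S ((q, 0), delta_mx 0 j) - accel S ((q, 0), 0)).

Lemma mass_unit q : config S q -> mass S q \in unitmx.
Proof.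
move=> cq; rewrite -row_free_unit -kermx_eq0; apply/negPn/negP => /rowV0Pn [v].
move=> /sub_kermxP vM v0; have := mass_pos cq v0.
by rewrite vM mul0mx mxE ltxx.
Qed.

Let EL0 x : 'rV[R]_p := \row_i ((x.2 *m 'D_x.2 (mass S) x.1) 0 i
    - 2^-1 * (x.2 *m 'D_(delta_mx 0 i) (mass S) x.1 *m x.2^T) 0 0
    + 'D_(delta_mx 0 i) (potential S) x.1).

Let accel_mass x u : config S x.1 ->
  accel S (x, u) *m mass S x.1 + EL0 x = u *m (force S x.1)^T.
Proof.
move=> cx; apply/rowP => i.
have := system_eq u i cx.
rewrite (euler_lagrangeE _ _ (@config_open _ _ _ S) (@mass_smooth _ _ _ S)
  (@potential_smooth _ _ _ S) (@mass_sym _ _ _ S) cx) => E.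
rewrite [LHS]mxE [X in _ + X = _]mxE !addrA E mxE.
by apply: eq_bigr => j _; rewrite mxE mulrC.
Qed.

Let accelE x u : config S x.1 ->
  accel S (x, u) = (u *m (force S x.1)^T - EL0 x) *m invmx (mass S x.1).
Proof.
by move=> cx; rewrite -(accel_mass u cx) addrK mulmxK // mass_unit.
Qed.

(** Solving for the acceleration multiplies the forces by the inverse mass matrix, and both factors
    depend on [q] only. *)
Lemma accel_affine x u : config S x.1 ->
  accel S (x, u) = drift x + u *m input_mx x.1.
Proof.
move=> cx; rewrite /drift !accelE // mul0mx sub0r mulmxBl mulNmx addrC; congr (_ + _).
rewrite -mulmxA; congr (_ *m _); apply/row_matrixP => j; rewrite rowK.
rewrite !(accelE _ (x := (x.1, 0))) // mul0mx sub0r -mulmxBl opprK subrK.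
by rewrite rowE mulmxA.
Qed.

(** Velocities enter the equation of motion only through quadratic terms. This parity is the origin
    of the time reversal symmetry. *)
Lemma accel_even q v u : config S q -> accel S ((q, - v), u) = accel S ((q, v), u).
Proof.
move=> cq; rewrite !accelE //=; congr ((_ - _) *m _).
have dM := smooth_diff (@mass_smooth _ _ _ S) cq.
apply/rowP => i; rewrite [LHS]mxE [RHS]mxE /= (derive_dirN v dM).
by rewrite [(- v)^T]linearN !mulNmx !mulmxN !opprK.
Qed.

Lemma accel_smooth_at u : smooth [set x | config S x.1] (fun x => accel S (x, u)).
Proof.
apply: (@smooth_comp _ _ (('rV[R]_p * 'rV[R]_p) * 'rV[R]_m)%type _ _ [set xu | config S xu.1.1]
  (accel S) (fun x => (x, u))) => //.
- exact/open_comp_fst/config_open.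
- exact: (open_comp_fst (open_comp_fst (@config_open _ _ _ S))).
- by apply: smooth_pair => //; [exact/open_comp_fst/config_open|exact: smooth_id|exact: smooth_cst].
- exact: accel_smooth.
Qed.

Lemma drift_smooth : smooth [set x | config S x.1] drift.
Proof. exact: accel_smooth_at. Qed.

Lemma input_mx_smooth : smooth (config S) input_mx.
Proof.
have oC := @config_open _ _ _ S.
have s u : smooth (config S) (fun q => accel S ((q, 0), u)).
  apply: (@smooth_comp _ _ ('rV[R]_p * 'rV[R]_p)%type _ _ [set x | config S x.1]
    (fun x => accel S (x, u)) (fun q => (q, 0))) => //.
  - exact/open_comp_fst/config_open.
  - by apply: smooth_pair => //; [exact: smooth_id|exact: smooth_cst].
  - exact: accel_smooth_at.
apply: smooth_mx => // j i.
apply: (@smooth_ext _ _ (R : normedModType R) _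
  (fun q => (accel S ((q, 0), delta_mx 0 j) - accel S ((q, 0), 0)) 0 i)) => //.
  by move=> q _; rewrite [RHS]mxE.
by apply: smooth_coord => //; apply: smooth_minus.
Qed.
End System.
End Mechanics.

(** * Output derivatives on finite jets *)

Section LinearSurjectivity.
Context {R : realType}.

(** Duality in finite dimension: a nonzero column of the cokernel of the matrix of [L] would be a
    nontrivial relation satisfied by all [L d], which the hypothesis excludes. *)
Lemma linear_surj (V : normedModType R) a b (L : V -> 'M[R]_(a, b)) :
  fin_dim V -> linear L ->
  (forall c : 'M[R]_(a, b), (forall d, \sum_i \sum_j c i j * L d i j = 0) -> c = 0) ->
  forall Y, exists d, L d = Y.
Proof.
move=> [n [e [c [cl ce]]]] lL inj Y.
pose LM := GRing.isLinear.Build _ _ _ _ _ lL.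
pose LL : {linear V -> 'M[R]_(a, b)} := HB.pack L LM.
pose A : 'M[R]_(n, a * b) := \matrix_k mxvec (L (e k)).
have [/eqP cok|/negPf cok] := eqVneq (cokermx A) 0.
  have /submxP [u hu] : (mxvec Y <= A)%MS by apply: submx_full; rewrite -cokermx_eq0.
  exists (\sum_k u 0 k *: e k).
  apply: (can_inj mxvecK); rewrite hu -[L]/(LL : V -> _) !linear_sum mulmx_sum_row.
  by apply: eq_bigr => k _; rewrite !linearZ /= rowK.
have /negP : cokermx A != 0 by rewrite cok.
case; apply/eqP/trmx_inj/row_matrixP => i; rewrite trmx0 row0.
set v := row i _.
suff h : vec_mx v = 0 by rewrite -[v]vec_mxK h linear0.
apply: inj => d.
have Av k : \sum_i0 \sum_j (vec_mx v) i0 j * L (e k) i0 j = 0.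
  transitivity ((v *m (mxvec (L (e k)))^T) 0 0).
    rewrite mxE (reindex _ (curry_mxvec_bij _ _)) /=.
    rewrite pair_big /=; apply: eq_bigr => -[i1 j1] _ /=.
    by congr (_ * _); [rewrite mxE|rewrite [RHS]mxE mxvecE].
  have -> : v *m (mxvec (L (e k)))^T = (row k A *m col i (cokermx A))^T.
    by rewrite trmx_mul rowK /v tr_col.
  by rewrite colE mulmxA -row_mul mulmx_coker row0 mul0mx trmx0 mxE.
rewrite (ce d) -[L]/(LL : V -> _) linear_sum.
transitivity (\sum_k c k d * (\sum_i0 \sum_j (vec_mx v) i0 j * L (e k) i0 j)); last first.
  by apply: big1 => k _; rewrite Av mulr0.
under [RHS]eq_bigr => k _ do rewrite mulr_sumr.
rewrite [RHS]exchange_big /=; apply: eq_bigr => i0 _.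
under [RHS]eq_bigr => k _ do rewrite mulr_sumr.
rewrite [RHS]exchange_big /=; apply: eq_bigr => j _.
rewrite summxE mulr_sumr; apply: eq_bigr => k _.
have E : L (c k d *: e k) = c k d *: L (e k) by exact: (linearZZ LL).
by rewrite /= E [(_ *: L _) i0 j]mxE mulrCA.
Qed.
End LinearSurjectivity.

Section Truncation.
Context {R : realType} {p m : nat}.
Variables (K : nat).
Notation V := (('rV[R]_p * 'rV[R]_p) * 'M[R]_(K, m))%type.

(* Zero-padding sends [(q, v, U)] to a jet; such jets are closed under the prolonged
   dynamics, so no derivative is lost by truncating at [K]. *)
Definition pad (U : 'M[R]_(K, m)) (a : nat) : 'rV[R]_m :=
  if insub a is Some i then row i U else 0.

Lemma pad_ord U (i : 'I_K) : pad U i = row i U.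
Proof. by rewrite /pad valK. Qed.

Lemma pad_ge U a : (K <= a)%N -> pad U a = 0.
Proof. by move=> h; rewrite /pad insubF // ltnNge h. Qed.

Lemma pad_lin a : linear (pad ^~ a).
Proof.
by move=> t x y; rewrite /pad; case: insub => [i|]; rewrite ?linearP // scaler0 addr0.
Qed.

Lemma pad_trunc U a : (a < K)%N -> pad (trunc K U) a = U a.
Proof. by move=> h; rewrite -[a]/(val (Ordinal h)) pad_ord rowK. Qed.

Lemma trunc_pad U : trunc K (pad U) = U.
Proof. by apply/row_matrixP => i; rewrite rowK pad_ord. Qed.

Lemma trunc_lin k : linear (fun U : 'M[R]_(K, m) => trunc k (pad U)).
Proof. by move=> t x y; apply/row_matrixP => i; rewrite linearP /= !rowK pad_lin. Qed.

Definition embed (w : V) : jet R p m := (w.1, pad w.2).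

Definition shift_rows (U : 'M[R]_(K, m)) : 'M[R]_(K, m) := trunc K (fun a => pad U a.+1).

Lemma pad_shift U a : pad (shift_rows U) a = pad U a.+1.
Proof.
have [h|h] := ltnP a K; first by rewrite pad_trunc.
by rewrite !pad_ge // (leq_trans h).
Qed.

Lemma shift_rows_lin : linear shift_rows.
Proof. by move=> t x y; apply/row_matrixP => i; rewrite linearP /= !rowK pad_lin. Qed.

Lemma lies_over_open l (O : set (('rV[R]_p * 'rV[R]_p) * 'M[R]_(l.+1, m))) : open O ->
  open [set w : V | lies_over O (embed w)].
Proof.
move=> oO; apply: (@open_comp _ _ (fun w : V => (w.1, trunc l.+1 (pad w.2))) O) => // w _.
apply: lin_continuous => // t x y; congr (_, _).
exact: (trunc_lin l.+1 t x.2 y.2).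
Qed.

Lemma embedD (w d : V) (s : R) :
  embed (w + s *: d) = ((embed w).1 + s *: (embed d).1,
                        fun a => (embed w).2 a + s *: (embed d).2 a).
Proof. by congr (_, _); apply: funext => a /=; rewrite addrC pad_lin addrC. Qed.

Lemma derive1_line (W W' : normedModType R) (h : W -> W') (w d : W) :
  derive1 (fun s : R => h (w + s *: d)) 0 = 'D_d h w.
Proof.
rewrite /derive1 /derive; set F := (fun _ : R => _); set G := (fun _ : R => _).
suff -> : F = G by [].
by apply: funext => s; rewrite /F /G /= scale0r !addr0 [w + _]addrC.
Qed.

Lemma jet_diff_embed (h : jet R p m -> R) (w d : V) :
  jet_diff h (embed w) (embed d) = 'D_d (fun w' => h (embed w')) w.
Proof.
rewrite /jet_diff -derive1_line; congr (derive1 _ 0).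
by apply: funext => s; rewrite embedD.
Qed.
End Truncation.

Section OutputDerivatives.
Context {R : realType} {p m : nat}.
Variables (S : lagrangian_system R p m) (phi : 'rV[R]_p -> 'rV[R]_m) (K : nat).
Hypothesis phi_smooth : smooth (config S) phi.
Notation V := (('rV[R]_p * 'rV[R]_p) * 'M[R]_(K, m))%type.

Definition jet_field (w : V) : V :=
  ((w.1.2, accel S (w.1, pad w.2 0)), shift_rows w.2).

Definition Lie (h : V -> R) (w : V) : R := 'D_(jet_field w) h w.

Definition output (a : nat) (j : 'I_m) : V -> R := iter a Lie (fun w => phi w.1.1 0 j).

Lemma yder_embed a j w : yder S phi a j (embed w) = output a j w.
Proof.
elim: a w => [//|a IH] w.
rewrite /yder /output_deriv iterS -/(output_deriv _ _ _ _) -/(yder _ _ _ _) /total_deriv.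
have -> : ((((embed w).1).2, open_loop S (embed w)), fun b => (embed w).2 b.+1) = embed
  (jet_field w).
  by congr (_, _); apply: funext => b; rewrite /= pad_shift.
rewrite jet_diff_embed /output iterS -/(output a j) /Lie.
by have -> : (fun w' => output_deriv (open_loop S) phi a j (embed w')) = output a j by apply:
  funext => w'; exact: IH.
Qed.

(** Each total derivative brings in at most one further input derivative. The bound [i < a] is
    generous, as [y_[2]] is the first to contain the input, but it survives the induction as it
    stands. *)
Lemma yder_local a j (z z' : jet R p m) : z.1 = z'.1 ->
  (forall i, (i < a)%N -> z.2 i = z'.2 i) -> yder S phi a j z = yder S phi a j z'.
Proof.
elim: a z z' => [|a IH] z z' h1 h2; first by rewrite /yder /output_deriv /= h1.
rewrite /yder /output_deriv iterS -/(output_deriv _ _ _ _) -/(yder _ _ _ _) /total_deriv /jet_diff.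
congr (derive1 _ 0); apply: funext => s; apply: IH => /=.
  by rewrite h1 /open_loop h1 h2.
by move=> i ia; rewrite !h2 // (leq_trans ia).
Qed.

Lemma yder_trunc a j (z : jet R p m) : (a <= K)%N ->
  yder S phi a j z = output a j (z.1, trunc K z.2).
Proof.
move=> aK; rewrite -yder_embed; apply: yder_local => //= i ia.
by rewrite pad_trunc // (leq_trans ia).
Qed.

Definition config_chart : set V := [set w | config S w.1.1].

Lemma config_chart_open : open config_chart.
Proof. exact: (open_comp_fst (open_comp_fst (@config_open _ _ _ S))). Qed.

Lemma jet_field_smooth : smooth config_chart jet_field.
Proof.
have oC := config_chart_open.
have s1 : smooth config_chart (fun w : V => w.1) by apply: smooth_lin.
have s2 : smooth config_chart (fun w : V => w.2) by apply: smooth_lin.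
apply: smooth_pair => //; last first.
  by apply: (@smooth_linl _ _ _ _ _ (@shift_rows R m K)) => //; exact: shift_rows_lin.
apply: smooth_pair => //; first exact: smooth_snd.
apply: (@smooth_comp _ _ (('rV[R]_p * 'rV[R]_p) * 'rV[R]_m)%type _ _ [set xu | config S xu.1.1]
  (accel S) (fun w : V => (w.1, pad w.2 0))) => //.
- exact: (open_comp_fst (open_comp_fst (@config_open _ _ _ S))).
- apply: smooth_pair => //.
  by apply: (@smooth_linl _ _ _ _ _ (fun U => pad U 0)) => //; exact: pad_lin.
- exact: accel_smooth.
Qed.

Lemma output_smooth a j : smooth config_chart (output a j).
Proof.
elim: a => [|a IH].
  apply: smooth_coord; first exact: config_chart_open.
  apply: (@smooth_comp _ _ 'rV[R]_p _ _ (config S) phi (fun w : V => w.1.1)) => //.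
  - exact: config_chart_open.
  - exact: config_open.
  - by apply: smooth_lin.
apply: (@smooth_derive_field _ _ _ _ _ jet_field) => //; first exact: config_chart_open.
exact: jet_field_smooth.
Qed.

Lemma output_diff a j w : config_chart w -> differentiable (output a j) w.
Proof. by move=> cw; exact: smooth_diff (output_smooth a j) cw. Qed.

Lemma independent_surj w beta : config_chart w -> (beta < K)%N ->
  independent_differentials S phi (embed w) ->
  forall c : 'M[R]_(beta.+1, m), exists d : V,
    forall (a : 'I_beta.+1) j, 'D_d (output a j) w = c a j.
Proof.
move=> cw bK ind c.
pose L (d : V) : 'M[R]_(beta.+1, m) := \matrix_(a, j) 'D_d (output a j) w.
have [||c' hc'|d hd] := @linear_surj _ V _ _ L _ _ _ c.
- by [].
- move=> t x y; apply/matrixP => a j; have dY := output_diff a j cw.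
  by rewrite [LHS]mxE (derive_dirD _ _ dY) (derive_dirZ _ _ dY) [RHS]mxE [X in _ = X + _]mxE [L x
    a j]mxE [L y a j]mxE.
- apply: (ind beta) => d.
  (* Independence is tested against all jet directions; input components of order [K] and more are
     invisible to outputs of order at most [beta < K], so the direction may be truncated. *)
  rewrite -[RHS](hc' (d.1, trunc K d.2)).
  apply: eq_bigr => a _; apply: eq_bigr => j _; congr (_ * _); rewrite mxE.
  rewrite /jet_diff -derive1_line; congr (derive1 _ 0); apply: funext => s.
  rewrite -yder_embed; apply: yder_local => //= i ia.
  rewrite [w.2 + _]addrC pad_lin [RHS]addrC pad_trunc //.
  by rewrite (leq_trans ia) // -ltnS (leq_trans (ltn_ord a)) // ltnW.
- by exists d => a j; rewrite -hd mxE.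
Qed.
End OutputDerivatives.

(** * Symmetries of the prolonged system: time reversal and input shifts *)

Section Symmetries.
Context {R : realType}.

Lemma open_line (V : normedModType R) (A : set V) x d : open A -> A x ->
  exists2 s : R, s != 0 & A (x + s *: d).
Proof.
move=> oA Ax.
have c : {for 0, continuous (fun s : R => x + s *: d)}.
  by apply: cvgD; [exact: cvg_cst|apply: cvgZr_tmp; exact: cvg_id].
have : \forall s \near (0 : R), A (x + s *: d).
  by apply: c; rewrite scale0r addr0; exact: open_nbhs_nbhs.
move=> /nbhs_ballP [e /= e0 h]; exists (e / 2); first by rewrite gt_eqF // divr_gt0.
apply: h; rewrite /ball /= sub0r normrN gtr0_norm ?divr_gt0 //.
by rewrite ltr_pdivrMr // ltr_pMr // ltr1n.
Qed.

Context {p m : nat}.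
Variables (S : lagrangian_system R p m) (phi : 'rV[R]_p -> 'rV[R]_m) (K : nat).
Hypothesis phi_smooth : smooth (config S) phi.
Notation V := (('rV[R]_p * 'rV[R]_p) * 'M[R]_(K, m))%type.
Notation chart := (@config_chart R p m S K).
Notation xi := (@jet_field R p m S K).
Notation Y := (@output R p m S phi K).

Lemma output_dir0 a j w (e : 'M[R]_(K, m)) : (forall i, (i < a)%N -> pad e i = 0) ->
  'D_(0, e) (Y a j) w = 0.
Proof.
move=> e0; rewrite -derive1_line.
have -> : (fun s : R => Y a j (w + s *: (0, e))) = fun=> Y a j w.
  apply: funext => s; rewrite -!yder_embed; apply: yder_local => /=.
    by rewrite scaler0 addr0.
  by move=> i ia; rewrite [w.2 + _]addrC pad_lin e0 // scaler0 add0r.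
exact: derive1_cst.
Qed.

(* [Psi] maps trajectories to (for [s = -1] reversed) trajectories, except that it may
   spoil the last input derivative, on which the outputs considered do not depend. *)
Lemma output_symmetry (A : set V) (Psi : V -> V) (s : R) : open A -> A `<=` chart ->
  s * s = 1 ->
  (forall w, A w -> (Psi w).1.1 = w.1.1) ->
  (forall w, A w -> differentiable Psi w) ->
  (forall w, A w -> exists2 e : 'M[R]_(K, m), forall i, (i.+1 < K)%N -> pad e i = 0 &
     'D_(xi w) Psi w = s *: xi (Psi w) + (0, e)) ->
  forall a j w, (a <= K)%N -> A w -> Y a j (Psi w) = s ^+ a * Y a j w.
Proof.
move=> oA sA ss P1 dP DP; elim=> [|a IH] j w aK Aw.
  by rewrite expr0 mul1r /Y /= P1.
have cP : chart (Psi w) by rewrite /config_chart /= P1 //; exact: sA.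
have dY := output_diff phi_smooth a j cP.
have dY' := output_diff phi_smooth a j (sA _ Aw).
have [e e0 De] := DP w Aw.
have E : s * Y a.+1 j (Psi w) = s ^+ a * Y a.+1 j w.
  transitivity ('D_(xi w) (fun w' => Y a j (Psi w')) w).
    rewrite (@derive_comp _ _ _ (R : normedModType R) Psi (Y a j) w _ (dP w Aw) dY) De.
    rewrite (derive_dirD _ _ dY) (derive_dirZ _ _ dY) output_dir0 ?addr0 // => i ia.
    by apply: e0; exact: leq_trans aK.
  rewrite (@derive_ext _ _ (R : normedModType R) A _ (fun w' => s ^+ a *: Y a j w')) //.
    by rewrite (deriveZ _ (diff_derivable dY')).
  by move=> w' Aw'; rewrite IH // ltnW.
by rewrite exprS -mulrA -E mulrA ss mul1r.
Qed.

Definition reversal (w : V) : V :=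
  ((w.1.1, - w.1.2), trunc K (fun a => (-1) ^+ a *: pad w.2 a)).

Lemma pad_reversal w a : pad (reversal w).2 a = (-1) ^+ a *: pad w.2 a.
Proof.
have [h|h] := ltnP a K; first by rewrite /= pad_trunc.
by rewrite !pad_ge // scaler0.
Qed.

Lemma reversal_lin : linear reversal.
Proof.
move=> t [[q v] U] [[q' v'] U']; congr ((_, _), _) => /=.
  by rewrite opprD scalerN.
by apply/row_matrixP => i; rewrite linearP /= !rowK pad_lin scalerDr !scalerA mulrC.
Qed.

Lemma output_reversal a j w : (a <= K)%N -> chart w ->
  Y a j (reversal w) = (-1) ^+ a * Y a j w.
Proof.
move=> aK cw; apply: (@output_symmetry chart) => //.
- exact: config_chart_open.
- by rewrite mulrNN mulr1.
- move=> w' _; apply: lin_differentiable; first exact: reversal_lin.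
  by apply: lin_continuous => //; exact: reversal_lin.
- move=> w' cw'; exists 0; first by move=> i _; rewrite /pad; case: insub => // ?; exact: row0.
  rewrite lin_derive; last first.
  - by apply: lin_continuous => //; exact: reversal_lin.
  - exact: reversal_lin.
  rewrite addr0 scaleN1r; congr ((_, _), _) => /=.
  - by rewrite opprK.
  (* Acceleration is of even order in time, so it has to agree at [v] and [- v]. *)
  - case: w' cw' => [[q v] U] cq /=; rewrite (accel_even _ _ cq); congr (- accel S (_, _)).
    by have /= -> := pad_reversal ((q, v), U) 0; rewrite expr0 scale1r.
  - apply/row_matrixP => i; rewrite linearN /= !rowK pad_shift.
    by have /= -> := pad_reversal w' i.+1; rewrite exprS mulN1r scaleNr opprK.
Qed.

(** Prolongation of an input shift: if [u] changes by [e * k] along a trajectory, its derivatives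
    change by [e] times these rows. *)
Definition kernel_jet (k : V -> 'rV[R]_m) (w : V) : 'M[R]_(K, m) :=
  trunc K (fun a => iter a (fun h w => 'D_(xi w) h w) k w).

(* The flow [u_[a] += e * k_[a]] leaves the trajectories of [(q, v)] unchanged
   when [k B = 0], so it fixes every output derivative, and [u = Fu(y)] with it. *)
Lemma kernel_zero (XK : set V) N (Fu : 'M[R]_(N, m) -> 'rV[R]_m) (A : set V)
    (k : V -> 'rV[R]_m) :
  (0 < K)%N -> (N <= K.+1)%N ->
  open XK -> (forall w, XK w -> pad w.2 0 = Fu (\matrix_(a, j) Y a j w)) ->
  open A -> A `<=` XK -> A `<=` chart -> smooth A k ->
  (forall w, A w -> k w *m input_mx S w.1.1 = 0) ->
  forall w, A w -> k w = 0.
Proof.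
move=> K0 NK oX hFu oA AX Ac sk kB w Aw.
set LV := fun (h : V -> 'rV[R]_m) w => 'D_(xi w) h w.
have sxi : smooth A xi by apply: smooth_subset Ac _; exact: jet_field_smooth.
have sL a : smooth A (iter a LV k).
  by elim: a => [|a IH] //=; apply: smooth_derive_field.
pose G := kernel_jet k.
have sG : smooth A G.
  apply: smooth_mx => // a j.
  apply: (@smooth_ext _ _ (R : normedModType R) _ (fun w => iter a LV k w 0 j)) => //.
    by move=> y _; rewrite mxE.
  by apply: smooth_coord.
have padG y a : (a < K)%N -> pad (G y) a = iter a LV k y by move=> h; rewrite pad_trunc.
(* A nonzero step, small enough for the shifted point to stay where the input is a function of the
   outputs. *)
have [e e0 XP] := open_line (0, G w) oX (AX _ Aw).
pose Psi (y : V) : V := y + e *: (0, G y).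
have G0_lin : linear (fun U : 'M[R]_(K, m) => (0, U) : V).
  by move=> t x y; congr (_, _); rewrite /= scaler0 addr0.
have dG y : A y -> differentiable (fun z => (0, G z) : V) y /\
    forall d, 'D_d (fun z => (0, G z) : V) y = (0, 'D_d G y).
  move=> Ay; have d := smooth_diff sG Ay.
  split; first by apply: (differentiable_linl _ G0_lin).
  by move=> d'; rewrite (derive_linl d' _ G0_lin).
have YP a j y : (a <= K)%N -> A y -> Y a j (Psi y) = 1 ^+ a * Y a j y.
  move=> aK Ay; refine (@output_symmetry A Psi 1 oA Ac (mulr1 1) _ _ _ a j y aK Ay) => {a j y aK
    Ay}.
  - by move=> z _ /=; rewrite scaler0 addr0.
  - move=> z Az; apply: differentiableD; first by apply: lin_differentiable => // ?; exact: cvg_id.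
    by apply: differentiableZ; exact: (dG z Az).1.
  - move=> z Az; have [d1 D1] := dG z Az.
    (* The last row of [G] differentiates to the [K]-th derivative of [k], where [shift_rows] puts
       [0]; this is the defect that [output_symmetry] tolerates. *)
    exists (e *: trunc K (fun a => if a.+1 == K then iter K LV k z else 0)).
      move=> i iK; rewrite -[e *: _]addr0 pad_lin pad_trunc; last exact: ltnW.
      rewrite ltn_eqF // scaler0 add0r /pad; case: insub => // ?; exact: row0.
    have di : differentiable (id : V -> V) z by apply: lin_differentiable => // ?; exact: cvg_id.
    rewrite (derive_add _ di (differentiableZ _ d1)) derive_id.
    rewrite (deriveZ _ (diff_derivable d1)) D1 scale1r.
    case: z Az d1 D1 di => [[q v] U] Az d1 D1 di.
    congr ((_, _), _) => /=; rewrite ?scaler0 ?addr0 //.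
    + have cq : config S q := Ac _ Az.
      have -> : pad (U + e *: G ((q, v), U)) 0 = pad U 0 + e *: k ((q, v), U).
        by rewrite [U + _]addrC pad_lin padG // addrC.
      by rewrite !(accel_affine (x := (q, v))) // mulmxDl -scalemxAl kB // scaler0 addr0.
    + apply/row_matrixP => i; rewrite !linearD !linearZ /= !rowK.
      rewrite [U + _]addrC pad_lin -addrA addrC -addrA; congr (_ + _); rewrite -scalerDr;
        congr (_ *: _).
      have -> : row i ('D_(xi ((q, v), U)) G ((q, v), U)) = iter i.+1 LV k ((q, v), U).
        have dG1 := smooth_diff sG Az.
        have l : linear (fun M : 'M[R]_(K, m) => row i M) by move=> ? ? ?; rewrite linearP.
        rewrite -(derive_linl (xi ((q, v), U)) (@fin_dim_mx R K m) l dG1) iterS.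
        have -> : (fun y => row i (G y)) = iter i LV k; last by [].
        by apply: funext => y; rewrite rowK.
      have [iK|iK] := ltnP i.+1 K.
        by rewrite padG // ltn_eqF // add0r.
      have iK' : i.+1 == K by rewrite eqn_leq iK ltn_ord.
      by rewrite pad_ge // addr0 iK' (eqP iK').
(* At [w] and at the shifted point the input is the same function of the same outputs, so
   [e *: k w = 0]. *)
have := hFu _ XP; rewrite -/(Psi w).
have -> : \matrix_(a < N, j < m) Y a j (Psi w) = \matrix_(a, j) Y a j w.
  apply/matrixP => a j; rewrite !mxE YP // ?expr1n ?mul1r //.
  by rewrite -ltnS (leq_trans (ltn_ord a)).
rewrite -hFu; last exact: AX.
rewrite /Psi [w + _]addrC /= pad_lin padG // => /(canRL (addrK _)); rewrite subrr.
by move/eqP; rewrite scaler_eq0 (negPf e0) => /eqP.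
Qed.
End Symmetries.

Lemma kernel_line (F : fieldType) m (J : 'M[F]_(m.+1, m)) (P x : 'rV[F]_m.+1) :
  \rank J = m -> P != 0 -> P *m J = 0 -> x *m J = 0 -> exists t, x = t *: P.
Proof.
move=> rJ P0 PJ xJ.
have rk : \rank (kermx J) = 1%N by rewrite mxrank_ker rJ subSnn.
have Pk : (P <= kermx J)%MS by apply/sub_kermxP.
have kP : (kermx J <= P)%MS.
  by rewrite -(geq_leqif (mxrank_leqif_sup Pk)) rk rank_rV P0.
have /sub_rVP [t ->] : (x <= P)%MS by apply: submx_trans kP; apply/sub_kermxP.
by exists t.
Qed.

Lemma rank_solve (F : fieldType) n m (J : 'M[F]_(n, m)) (y : 'rV[F]_m) :
  \rank J = m -> exists x, x *m J = y.
Proof.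
move=> rJ; have /submxP [x ->] : (y <= J)%MS.
  by apply: submx_full; rewrite /row_full rJ.
by exists x.
Qed.

Lemma derive_affine (R : realType) (V W : normedModType R) (h : V -> W) w d c :
  (forall s : R, h (w + s *: d) = h w + s *: c) -> 'D_d h w = c.
Proof.
move=> hs; rewrite -derive1_line.
have -> : (fun s : R => h (w + s *: d)) = fun s => h w + s *: c by apply: funext.
have lin : linear (fun s : R => s *: c) by move=> t x y; rewrite scalerDl scalerA.
have d1 : differentiable (fun s : R => s *: c) 0.
  by apply: lin_differentiable => //; apply: lin_continuous => //; exact: fin_dim_R.
rewrite derive1E (derive_add _ (differentiable_cst _ _) d1) derive_cst add0r lin_derive ?scale1r //.
by apply: lin_continuous => //; exact: fin_dim_R.
Qed.

(** * Output derivatives of orders 0, 1 and 2 in coordinates *)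

Section FirstDerivatives.
Context {R : realType} {p m : nat}.
Variables (S : lagrangian_system R p m) (phi : 'rV[R]_p -> 'rV[R]_m) (K : nat).
Hypothesis phi_smooth : smooth (config S) phi.
Notation V := (('rV[R]_p * 'rV[R]_p) * 'M[R]_(K, m))%type.
Notation chart := (@config_chart R p m S K).
Notation xi := (@jet_field R p m S K).
Notation Y := (@output R p m S phi K).
Notation J := (jacobian phi).
Notation B := (input_mx S).

Lemma derive_phi q d : config S q -> 'D_d phi q = d *m J q.
Proof. by move=> cq; rewrite deriveEjacobian //; exact: smooth_diff phi_smooth cq. Qed.

Lemma jacobian_smooth : smooth (config S) J.
Proof.
have oC := @config_open _ _ _ S.
apply: smooth_mx => // i j.
apply: (@smooth_ext _ _ (R : normedModType R) _ (fun q => 'D_(delta_mx 0 i) phi q 0 j)) => //.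
  by move=> q cq; rewrite derive_phi // -rowE mxE.
by apply: smooth_coord => //; exact: smooth_derive.
Qed.

Lemma derive_output0 j (w d : V) : chart w -> 'D_d (Y 0 j) w = (d.1.1 *m J w.1.1) 0 j.
Proof.
move=> cw; have dphi := smooth_diff phi_smooth cw.
have dl : differentiable (fun w : V => w.1.1) w.
  by apply: lin_differentiable => //; exact: lin_continuous.
rewrite -derive_phi // -(lin_derive (f := fun w : V => w.1.1) w d) //; last exact: lin_continuous.
rewrite -(derive_comp d dl dphi) -derive_coord //.
exact: (differentiable_comp dl dphi).
Qed.

Lemma output1E j (w : V) : chart w -> Y 1 j w = (w.1.2 *m J w.1.1) 0 j.
Proof. by move=> cw; rewrite -[LHS]/('D_(xi w) (Y 0 j) w) derive_output0. Qed.

Lemma velocity_diff (w d : V) : chart w ->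
  differentiable (fun w : V => w.1.2 *m J w.1.1) w /\
  'D_d (fun w : V => w.1.2 *m J w.1.1) w =
    d.1.2 *m J w.1.1 + w.1.2 *m 'D_(d.1.1) J w.1.1.
Proof.
move=> cw; have dJ := smooth_diff jacobian_smooth cw.
have l1 : differentiable (fun w : V => w.1.1) w.
  by apply: lin_differentiable => //; exact: lin_continuous.
have l2 : differentiable (fun w : V => w.1.2) w.
  by apply: lin_differentiable => //; exact: lin_continuous.
have l3 : differentiable (fun w : V => J w.1.1) w by exact: (differentiable_comp l1 dJ).
have E1 : 'D_d (fun w : V => w.1.1) w = d.1.1 by rewrite lin_derive //; exact: lin_continuous.
have E2 : 'D_d (fun w : V => w.1.2) w = d.1.2 by rewrite lin_derive //; exact: lin_continuous.
have E3 : 'D_d (fun w : V => J w.1.1) w = 'D_(d.1.1) J w.1.1 by rewrite (derive_comp d l1 dJ) E1.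
by have [d1 D1] := derive_mulmx d l2 l3; rewrite E2 E3 in D1.
Qed.

Lemma derive_output1 j (w d : V) : chart w ->
  'D_d (Y 1 j) w = (d.1.2 *m J w.1.1 + w.1.2 *m 'D_(d.1.1) J w.1.1) 0 j.
Proof.
move=> cw; rewrite (@derive_ext _ _ _ chart _ (fun w => (w.1.2 *m J w.1.1) 0 j)) //.
- by rewrite (derive_coord _ _ _ (velocity_diff d cw).1) (velocity_diff d cw).2.
- exact: config_chart_open.
- by move=> y cy; exact: output1E.
Qed.

(** The part of [y_[2]] quadratic in the velocity; the rest is the acceleration times [J]. *)
Definition phi_curvature (x : 'rV[R]_p * 'rV[R]_p) : 'rV[R]_m := x.2 *m 'D_(x.2) J x.1.

Definition acceleration (w : V) : 'rV[R]_p := accel S (w.1, pad w.2 0).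

Lemma output2E j (w : V) : chart w ->
  Y 2 j w = (phi_curvature w.1 + acceleration w *m J w.1.1) 0 j.
Proof. by move=> cw; rewrite -[LHS]/('D_(xi w) (Y 1 j) w) derive_output1 // addrC. Qed.

Lemma acceleration_fibre (w d : V) s : chart w -> d.1 = 0 ->
  acceleration (w + s *: d) = acceleration w + s *: (pad d.2 0 *m B w.1.1).
Proof.
move=> cw d0; rewrite /acceleration.
have -> : (w + s *: d).1 = w.1 by rewrite /= d0 scaler0 addr0.
rewrite !(accel_affine (x := w.1)) // [_.2]/= [w.2 + _]addrC pad_lin mulmxDl -scalemxAl.
by rewrite -addrA [_ *: _ + _]addrC.
Qed.

Lemma derive_acceleration (w d : V) : chart w -> d.1 = 0 ->
  'D_d acceleration w = pad d.2 0 *m B w.1.1.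
Proof. by move=> cw d0; apply: derive_affine => s; exact: acceleration_fibre. Qed.

Lemma derive_output2 j (w d : V) : chart w -> d.1 = 0 ->
  'D_d (Y 2 j) w = (pad d.2 0 *m B w.1.1 *m J w.1.1) 0 j.
Proof.
move=> cw d0; apply: derive_affine => s.
have e1 : (w + s *: d).1 = w.1 by rewrite /= d0 scaler0 addr0.
rewrite !output2E //; last by rewrite /config_chart /= d0 /= scaler0 addr0.
rewrite acceleration_fibre // e1 mulmxDl -scalemxAl addrA.
by rewrite [LHS]mxE [X in _ + X = _]mxE.
Qed.
End FirstDerivatives.

(** * Orders of the flat parameterization *)

Lemma sum_pick (R : nzRingType) (W : lmodType R) N m (F : nat -> 'I_m -> W) b j : (b < N)%N ->
  \sum_(a < N) \sum_(i < m) ((a == b :> nat) && (i == j))%:R *: F a i = F b j.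
Proof.
move=> bN; rewrite (bigD1 (Ordinal bN)) //= (bigD1 j) //= !eqxx scale1r.
rewrite big1 => [|i ij]; last by rewrite (negPf ij) andbF scale0r.
rewrite addr0 big1 ?addr0 // => a ab; apply: big1 => i _.
have -> : (a == b :> nat) = false; last by rewrite scale0r.
by apply: contraNF ab => /eqP e; apply/eqP/val_inj.
Qed.

Section FlatChart.
Context {R : realType} {m : nat}.
Local Notation p := m.+1.
Variables (S : lagrangian_system R p m) (phi : 'rV[R]_p -> 'rV[R]_m)
  (r : 'I_m -> nat) (l : nat)
  (X : set (('rV[R]_p * 'rV[R]_p) * 'M[R]_(l.+1, m)))
  (D : set 'M[R]_(height r, m))
  (Fq Fv : 'M[R]_(height r, m) -> 'rV[R]_p)
  (Fu : 'M[R]_(height r, m) -> 'rV[R]_m).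
Hypothesis hphi : submersion S phi.
Hypothesis hF : flat_parameterization S phi X D Fq Fv Fu.
Local Notation N := (height r).
(* Enough input derivatives for [X], for [y_[0, N + 1]], and for [y_[6]], which
   enters the feedback through [w_[2]]. *)
Local Notation K := (height r + l + 8)%N.
Local Notation V := (('rV[R]_p * 'rV[R]_p) * 'M[R]_(K, m))%type.
Local Notation chart := (@config_chart R p m S K).
Local Notation xi := (@jet_field R p m S K).
Local Notation Y := (@output R p m S phi K).
Local Notation J := (jacobian phi).
Local Notation B := (input_mx S).

Definition flat_chart : set V := [set w | lies_over X (embed w)].
Local Notation XK := flat_chart.

Definition flat_jet (w : V) : 'M[R]_(N, m) := \matrix_(a, j) Y a j w.

Lemma flat_chart_open : open XK.
Proof. exact: lies_over_open (flat_open hF). Qed.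

Lemma flat_chart_sub : XK `<=` chart.
Proof. by move=> w; exact: (flat_config hF). Qed.

Lemma trunc_trunc k (U : nat -> 'rV[R]_m) : (k <= K)%N -> trunc k (pad (trunc K U)) = trunc k U.
Proof.
by move=> h; apply/row_matrixP => i; rewrite !rowK pad_trunc // (leq_trans (ltn_ord i)).
Qed.

Lemma lies_over_trunc (O : set (('rV[R]_p * 'rV[R]_p) * 'M[R]_(l.+1, m))) z :
  lies_over O z -> lies_over O (embed ((z.1, trunc K z.2) : V)).
Proof.
rewrite /lies_over /= trunc_trunc //.
by rewrite addnS ltnS -addnA addnC -addnA leq_addr.
Qed.

Lemma yjet_trunc z : yjet S phi N z = flat_jet (z.1, trunc K z.2).
Proof.
apply/matrixP => a j; rewrite !mxE (@yder_trunc _ _ _ S phi K) //.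
by rewrite (leq_trans (ltnW (ltn_ord a))) // -addnA leq_addr.
Qed.

Lemma yjet_embed w : yjet S phi N (embed w) = flat_jet w.
Proof. by apply/matrixP => a j; rewrite !mxE yder_embed. Qed.

Lemma flat_jet_range w : XK w -> D (flat_jet w).
Proof. by move=> h; rewrite -yjet_embed; exact: (flat_range hF). Qed.

Lemma config_eq w : XK w -> w.1.1 = Fq (flat_jet w).
Proof. by move=> h; rewrite -yjet_embed -(flat_q hF h). Qed.

Lemma velocity_eq w : XK w -> w.1.2 = Fv (flat_jet w).
Proof. by move=> h; rewrite -yjet_embed -(flat_v hF h). Qed.

Lemma input_eq w : XK w -> pad w.2 0 = Fu (flat_jet w).
Proof. by move=> h; rewrite -yjet_embed -(flat_u hF h). Qed.

Let phi_smooth : smooth (config S) phi := hphi.1.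

Lemma flat_jet_smooth : smooth chart flat_jet.
Proof.
apply: smooth_mx; first exact: config_chart_open.
move=> a j; apply: (@smooth_ext _ _ (R : normedModType R) _ (Y a j));
  first exact: config_chart_open.
  by move=> w _; rewrite mxE.
exact: output_smooth.
Qed.

Lemma derive_flat_jet w d : chart w -> 'D_d flat_jet w = \matrix_(a, j) 'D_d (Y a j) w.
Proof.
move=> cw; apply/matrixP => a j.
have E : (fun y => flat_jet y a j) = Y a j by apply: funext => y; rewrite mxE.
by rewrite [RHS]mxE -(derive_coord d a j (smooth_diff flat_jet_smooth cw)) E.
Qed.

(** The range reaches two orders past the rows of [flat_jet]: if some [r j = 4], it includes order
    6, the highest that occurs in [w_[2]]. *)
Lemma tangent_surj w : XK w -> forall c : nat -> 'I_m -> R,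
  exists d : V, forall a j, (a <= N.+1)%N -> 'D_d (Y a j) w = c a j.
Proof.
move=> Xw c.
have h : (N.+1 < K)%N by rewrite -addnA -[N.+1]addn1 ltn_add2l !addnS.
have [d hd] := independent_surj phi_smooth (flat_chart_sub Xw) h (flat_independent hF Xw)
  (\matrix_(a, j) c a j).
exists d => a j aN; have aN' : (a < N.+2)%N by [].
by have := hd (Ordinal aN') j; rewrite mxE.
Qed.

Lemma derive_flat_jet_comp n (H : 'M[R]_(N, m) -> 'rV[R]_n) w d : smooth D H -> XK w ->
  differentiable (fun w => H (flat_jet w)) w /\
  'D_d (fun w => H (flat_jet w)) w = \sum_(a < N) \sum_(j < m) 'D_d (Y a j) w *: pd H a j
    (flat_jet w).
Proof.
move=> sH Xw; have cw := flat_chart_sub Xw.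
have dYM := smooth_diff flat_jet_smooth cw.
have dH := smooth_diff sH (flat_jet_range Xw).
split; first exact: (differentiable_comp dYM dH).
rewrite (derive_comp d dYM dH) (derive_flat_jet _ cw) [X in 'D_X H _]matrix_sum_delta.
rewrite (derive_dir_sum _ _ _ dH); apply: eq_bigr => a _.
rewrite (derive_dir_sum _ _ _ dH); apply: eq_bigr => j _.
rewrite (derive_dirZ _ _ dH) mxE; congr (_ *: 'D_ _ _ _).
by apply/matrixP => b k; rewrite !mxE.
Qed.

(** A lift of the coordinate vector of [y^j_[b]]. It is not unique, but functions of [flat_jet]
    cannot tell two lifts apart. *)
Definition vertical (w d : V) (b : nat) (j : 'I_m) :=
  forall a i, (a <= N.+1)%N -> 'D_d (Y a i) w = ((a == b) && (i == j))%:R.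

Lemma vertical_exists w b j : XK w -> exists d, vertical w d b j.
Proof. by move=> Xw; have [d hd] := tangent_surj Xw (fun a i => ((a == b) && (i == j))%:R);
  exists d. Qed.

Lemma vertical_comp n (H : 'M[R]_(N, m) -> 'rV[R]_n) w d b j : smooth D H -> XK w ->
  vertical w d b j -> 'D_d (fun w => H (flat_jet w)) w = pd H b j (flat_jet w).
Proof.
move=> sH Xw vd; rewrite (derive_flat_jet_comp d sH Xw).2.
have [bN|bN] := ltnP b N; last first.
  rewrite big1 => [|a _]; last first.
    apply: big1 => i _; rewrite vd; last exact: (leqW (ltnW (ltn_ord a))).
    by rewrite ltn_eqF ?scale0r // (leq_trans (ltn_ord a)).
  rewrite /pd (_ : \matrix_(_, _) _ = 0) ?derive0 //.
  apply/matrixP => a i; rewrite !mxE ltn_eqF //.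
  by rewrite (leq_trans (ltn_ord a)).
rewrite -(sum_pick (fun a i => pd H a i (flat_jet w)) j bN).
apply: eq_bigr => a _; apply: eq_bigr => i _; congr (_ *: _).
exact: (vd _ _ (leqW (ltnW (ltn_ord a)))).
Qed.

Lemma derive_q (w d : V) : XK w -> d.1.1 = 'D_d (fun w => Fq (flat_jet w)) w.
Proof.
move=> Xw; rewrite -(@derive_ext _ _ _ XK (fun w : V => w.1.1)) ?lin_derive //.
- by apply: lin_continuous.
- exact: flat_chart_open.
- exact: config_eq.
Qed.

Lemma derive_v (w d : V) : XK w -> d.1.2 = 'D_d (fun w => Fv (flat_jet w)) w.
Proof.
move=> Xw; rewrite -(@derive_ext _ _ _ XK (fun w : V => w.1.2)) ?lin_derive //.
- by apply: lin_continuous.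
- exact: flat_chart_open.
- exact: velocity_eq.
Qed.

Lemma derive_u (w d : V) : XK w -> pad d.2 0 = 'D_d (fun w => Fu (flat_jet w)) w.
Proof.
have lu : linear (fun w : V => pad w.2 0) by move=> t x y; exact: pad_lin.
move=> Xw; rewrite -(@derive_ext _ _ _ XK (fun w : V => pad w.2 0)).
- rewrite (lin_derive _ _ lu) //; exact: lin_continuous.
- exact: flat_chart_open.
- by [].
- exact: input_eq.
Qed.

Lemma vertical_q w d b j : XK w -> vertical w d b j -> d.1.1 = pd Fq b j (flat_jet w).
Proof. by move=> Xw vd; rewrite (derive_q _ Xw) (vertical_comp (flat_Fq_smooth hF) Xw vd). Qed.

Lemma vertical_v w d b j : XK w -> vertical w d b j -> d.1.2 = pd Fv b j (flat_jet w).
Proof. by move=> Xw vd; rewrite (derive_v _ Xw) (vertical_comp (flat_Fv_smooth hF) Xw vd). Qed.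

Lemma vertical_u w d b j : XK w -> vertical w d b j -> pad d.2 0 = pd Fu b j (flat_jet w).
Proof. by move=> Xw vd; rewrite (derive_u _ Xw) (vertical_comp (flat_Fu_smooth hF) Xw vd). Qed.

Lemma function_upto_pd c n (H : 'M[R]_(N, m) -> 'rV[R]_n) a j :
  function_upto r c H -> function_upto r c (pd H a j).
Proof.
move=> hH Z Z' ZZ; rewrite /pd -!derive1_line; congr (derive1 _ 0).
by apply: funext => s; apply: hH => b i bi; rewrite !mxE ZZ.
Qed.

Lemma pd_eq0 c n (H : 'M[R]_(N, m) -> 'rV[R]_n) a j Z :
  function_upto r c H -> (r j < a + c)%N -> pd H a j Z = 0.
Proof.
move=> hH rj; rewrite /pd -derive1_line.
rewrite (_ : (fun _ => _) = fun=> H Z); first exact: derive1_cst.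
apply: funext => s; apply: hH => b i bi; rewrite !mxE.
case: eqP => [e|_]; last by rewrite mulr0 addr0.
case: eqP => [e'|_]; last by rewrite mulr0 addr0.
by move: bi; rewrite e e' leqNgt rj.
Qed.

Lemma smooth_pd n (H : 'M[R]_(N, m) -> 'rV[R]_n) a j : smooth D H -> smooth D (pd H a j).
Proof. exact: smooth_derive. Qed.

(* Along the system, the time derivative of [H(y_[0, R - c])] is affine in the
   highest derivative [y_[R - c + 1]], with coefficient the top partial of [H]. *)
Lemma top_derivative c n (H : 'M[R]_(N, m) -> 'rV[R]_n) w d b j : smooth D H ->
  function_upto r c H -> (b.+1 + c = (r j).+1)%N -> XK w -> vertical w d b.+1 j ->
  'D_d (fun w => 'D_(xi w) (fun w => H (flat_jet w)) w) w = pd H b j (flat_jet w).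
Proof.
move=> sH uH bc Xw vd; have cw := flat_chart_sub Xw.
rewrite (@derive_ext _ _ _ XK _ (fun w => \sum_(a < N) \sum_(i < m) Y a.+1 i w *: pd H a i
  (flat_jet w))); last first.
- by move=> y Xy; rewrite (derive_flat_jet_comp _ sH Xy).2.
- by [].
- exact: flat_chart_open.
have dpd a i := (derive_flat_jet_comp d (smooth_pd a i sH) Xw).1.
have d1 a i : differentiable (fun w => Y a.+1 i w *: pd H a i (flat_jet w)) w.
  by apply: differentiable_scale => //; exact: output_diff.
have s1 a := derive_sums (index_enum 'I_m) d (fun i (_ : true) => d1 a i).
rewrite (derive_sums (index_enum 'I_N) d (fun a (_ : true) => (s1 (nat_of_ord a)).1)).2.
have bN : (b < N)%N.
  have : (b <= r j)%N by rewrite -ltnS -bc leq_addr.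
  by move=> h; rewrite /height ltnS (leq_trans h) //; exact: leq_bigmax.
have E a i : (a < N)%N -> 'D_d (fun w => Y a.+1 i w *: pd H a i (flat_jet w)) w =
    ((a == b) && (i == j))%:R *: pd H a i (flat_jet w).
  move=> aN; rewrite (derive_scale _ (output_diff phi_smooth a.+1 i cw) (dpd a i)) (vertical_comp
    (smooth_pd a i sH) Xw vd).
  rewrite (pd_eq0 _ (function_upto_pd a i uH)) ?bc // scaler0 add0r vd ?eqSS //.
  exact: leq_trans aN _.
rewrite -(sum_pick (fun a i => pd H a i (flat_jet w)) j bN).
by apply: eq_bigr => a _; rewrite (s1 a).2; apply: eq_bigr => i _; rewrite E.
Qed.

(** As [v] is the time derivative of [q], the highest output derivative enters [F_v] with the top
    partial of [F_q] as coefficient. The next lemma repeats this from [F_v] to the acceleration. *)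
Lemma vertical_v_top w d b j : (b.+1 + 2 = (r j).+1)%N -> XK w -> vertical w d b.+1 j ->
  d.1.2 = pd Fq b j (flat_jet w).
Proof.
move=> bc Xw vd; rewrite -(top_derivative (flat_Fq_smooth hF) (flat_Fq_upto hF) bc Xw vd).
rewrite -[LHS](@lin_derive _ _ _ (fun w : V => w.1.2) w d); last first.
- exact: lin_continuous.
- by [].
apply: (@derive_ext _ _ _ XK); [exact: flat_chart_open|by []|].
by move=> y Xy; rewrite -derive_q.
Qed.

Lemma vertical_acc_top w d b j : (b.+1 + 1 = (r j).+1)%N -> XK w -> vertical w d b.+1 j ->
  'D_d (@acceleration R p m S K) w = pd Fv b j (flat_jet w).
Proof.
move=> bc Xw vd; rewrite -(top_derivative (flat_Fv_smooth hF) (flat_Fv_upto hF) bc Xw vd).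
apply: (@derive_ext _ _ _ XK); [exact: flat_chart_open|by []|].
by move=> y Xy; rewrite -derive_v.
Qed.
End FlatChart.

(** * The orders r^j are at most 4, and 4 is attained *)

Section OrderBound.
Context {R : realType} {m : nat}.
Local Notation p := m.+1.
Variables (S : lagrangian_system R p m) (phi : 'rV[R]_p -> 'rV[R]_m)
  (r : 'I_m -> nat) (l : nat)
  (X : set (('rV[R]_p * 'rV[R]_p) * 'M[R]_(l.+1, m)))
  (D : set 'M[R]_(height r, m))
  (Fq Fv : 'M[R]_(height r, m) -> 'rV[R]_p)
  (Fu : 'M[R]_(height r, m) -> 'rV[R]_m).
Hypothesis hphi : submersion S phi.
Hypothesis hF : flat_parameterization S phi X D Fq Fv Fu.
Local Notation N := (height r).
Local Notation K := (height r + l + 8)%N.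
Local Notation V := (('rV[R]_p * 'rV[R]_p) * 'M[R]_(K, m))%type.
Local Notation chart := (@config_chart R p m S K).
Local Notation xi := (@jet_field R p m S K).
Local Notation Y := (@output R p m S phi K).
Local Notation J := (jacobian phi).
Local Notation B := (input_mx S).
Local Notation XK := (@flat_chart R m r l X).
Local Notation YM := (@flat_jet R m S phi r l).
Let phi_smooth : smooth (config S) phi := hphi.1.

Let chartX (w : V) : XK w -> chart w. Proof. exact: (flat_chart_sub hF). Qed.

(* [theta_dir] also equals the top partials of [Fv] (in [y^j_[r j - 1]]) and of the
   acceleration (in [y^j_[r j]]). *)
Definition theta_dir (j : 'I_m) (w : V) : 'rV[R]_p := pd Fq (r j - 2) j (YM w).
Definition input_dir (j : 'I_m) (w : V) : 'rV[R]_m := pd Fu (r j) j (YM w).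

Lemma input_dir_smooth j : smooth XK (input_dir j).
Proof.
have oX := flat_chart_open (r := r) hF.
apply: (@smooth_comp _ _ _ _ _ D (pd Fu (r j) j) YM) => //.
- exact: flat_range_open hF.
- exact: (flat_jet_range hF).
- exact: (smooth_subset chartX (flat_jet_smooth r l hphi)).
- apply: smooth_pd; exact: flat_Fu_smooth hF.
Qed.

Lemma theta_dir_smooth j : smooth XK (theta_dir j).
Proof.
have oX := flat_chart_open (r := r) hF.
apply: (@smooth_comp _ _ _ _ _ D (pd Fq (r j - 2) j) YM) => //.
- exact: flat_range_open hF.
- exact: (flat_jet_range hF).
- exact: (smooth_subset chartX (flat_jet_smooth r l hphi)).
- apply: smooth_pd; exact: flat_Fq_smooth hF.
Qed.

Lemma height_gt j : (r j < N)%N.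
Proof. by rewrite /height ltnS; exact: leq_bigmax. Qed.

Lemma vertical_top_config j w d : (2 <= r j)%N -> XK w -> vertical S phi w d (r j - 2) j ->
  d.1.1 = theta_dir j w.
Proof. by move=> r2 Xw vd; rewrite (vertical_q hphi hF Xw vd). Qed.

Lemma vertical_top_velocity j w d : (2 <= r j)%N -> XK w -> vertical S phi w d (r j - 1) j ->
  d.1 = (0, theta_dir j w).
Proof.
move=> r2 Xw vd.
have e1 : d.1.1 = 0.
  rewrite (vertical_q hphi hF Xw vd); apply: pd_eq0 (flat_Fq_upto hF) _.
  by rewrite addn2 ltnS -addn1 subnK // ltnW.
have e2 : d.1.2 = theta_dir j w.
  have rE : (r j - 1 = (r j - 2).+1)%N by rewrite -subSn.
  rewrite rE in vd; apply: (vertical_v_top hphi hF _ Xw vd).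
  by rewrite addSn subnK.
by rewrite -e1 -e2; case: (d.1).
Qed.

(** A vector vertical at order [r j] moves inputs only. Its effect on the acceleration is computed
    twice: by the affine equation of motion, and as the derivative of [F_v] along the system. *)
Lemma vertical_top_input j w d : (2 <= r j)%N -> XK w -> vertical S phi w d (r j) j ->
  [/\ d.1 = 0, pad d.2 0 = input_dir j w & input_dir j w *m B w.1.1 = theta_dir j w].
Proof.
move=> r2 Xw vd.
have e1 : d.1.1 = 0.
  by rewrite (vertical_q hphi hF Xw vd); apply: pd_eq0 (flat_Fq_upto hF) _;
    rewrite -addSnnS leq_addr.
have e2 : d.1.2 = 0.
  by rewrite (vertical_v hphi hF Xw vd); apply: pd_eq0 (flat_Fv_upto hF) _; rewrite addn1.
have d0 : d.1 = 0 by rewrite [d.1]surjective_pairing e1 e2.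
have eu := vertical_u hphi hF Xw vd.
split => //; rewrite /input_dir -eu -(derive_acceleration (chartX Xw) d0).
have rE : r j = (r j - 1).+1 by rewrite -subSn // ?subSS ?subn0 // ltnW.
have vd' := vd; rewrite rE in vd'.
rewrite (vertical_acc_top hphi hF _ Xw vd'); last by rewrite addn1 -rE.
have [d' vd2] := vertical_exists hphi hF (r j - 1) j Xw.
by rewrite -(vertical_v hphi hF Xw vd2) (vertical_top_velocity r2 Xw vd2).
Qed.

Lemma theta_dirE j w : (2 <= r j)%N -> XK w ->
  input_dir j w *m B w.1.1 = theta_dir j w.
Proof.
move=> r2 Xw; have [d vd] := vertical_exists hphi hF (r j) j Xw.
by have [] := vertical_top_input r2 Xw vd.
Qed.

(** The vector vertical at order [r j - 2 >= 1] moves [q] along [theta_dir] but leaves [y = phi(q)]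
    fixed. *)
Lemma theta_dir_kernel j w : (3 <= r j)%N -> XK w -> theta_dir j w *m J w.1.1 = 0.
Proof.
move=> r3 Xw; have [d vd] := vertical_exists hphi hF (r j - 2) j Xw.
rewrite -(vertical_top_config _ Xw vd); last exact: ltnW.
apply/rowP => i; rewrite -(derive_output0 phi_smooth i d (chartX Xw)) vd // mxE.
by rewrite [(0 == _)%N]ltn_eqF // subn_gt0.
Qed.

(* Start from a direction with [dy = dy_[1] = 0] and [dy_[2] = eta], then cancel
   first [dq] and next [dv], both multiples of [theta_dir], with the vertical vectors
   at [(r j - 2, j)] and [(r j - 1, j)]; the former disturbs [dy_[2]] only if [r j = 4]. *)
Lemma fibre_directions j w (eta : 'rV[R]_m) : (4 <= r j)%N -> XK w -> theta_dir j w != 0 ->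
  exists (u : 'rV[R]_m) (t : R),
    u *m B w.1.1 *m J w.1.1 = eta - ((r j == 4%N)%:R * t) *: delta_mx 0 j.
Proof.
move=> r4 Xw P0; have cw := chartX Xw.
have r2 : (2 <= r j)%N by exact: ltnW (ltnW r4).
have r3 : (3 <= r j)%N by exact: ltnW r4.
have rN := height_gt j.
have N2 : (2 <= N.+1)%N by rewrite (leq_trans r2) // ltnW // ltnW.
have dY a i := output_diff phi_smooth a i cw.
have [d3 h3] := tangent_surj hphi hF Xw (fun a i => if a == 2 then eta 0 i else 0).
have [d2 v2] := vertical_exists hphi hF (r j - 2) j Xw.
have [d1 v1] := vertical_exists hphi hF (r j - 1) j Xw.
have q3 : d3.1.1 *m J w.1.1 = 0.
  by apply/rowP => i; rewrite -(derive_output0 phi_smooth i d3 cw) h3 // mxE.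
have [t ht] := kernel_line (hphi.2 _ cw) P0 (theta_dir_kernel r3 Xw) q3.
pose d4 := d3 - t *: d2.
have q4 : d4.1.1 = 0.
  by rewrite /d4 /= (vertical_top_config r2 Xw v2) ht subrr.
have D4 a i : 'D_d4 (Y a i) w = 'D_d3 (Y a i) w - t * 'D_d2 (Y a i) w.
  by rewrite /d4 (derive_dirD _ _ (dY a i)) (derive_dirN _ (dY a i)) (derive_dirZ _ _ (dY a i)).
have v4 : d4.1.2 *m J w.1.1 = 0.
  apply/rowP => i; have := derive_output1 phi_smooth i d4 cw.
  rewrite q4 derive0 mulmx0 addr0 => <-.
  rewrite D4 h3 ?(leq_trans _ N2) // v2 ?(leq_trans _ N2) // mxE /=.
  have -> : (1 == r j - 2)%N = false; last by rewrite mulr0 subr0.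
  by rewrite ltn_eqF // ltn_subRL.
have [s hs] := kernel_line (hphi.2 _ cw) P0 (theta_dir_kernel r3 Xw) v4.
pose d5 := d4 - s *: d1.
have d50 : d5.1 = 0.
  have e1 := vertical_top_velocity r2 Xw v1.
  have q5 : d5.1.1 = d4.1.1 - s *: d1.1.1 by [].
  have v5 : d5.1.2 = d4.1.2 - s *: d1.1.2 by [].
  by rewrite [d5.1]surjective_pairing q5 v5 q4 hs e1 /= scaler0 subr0 subrr.
exists (pad d5.2 0), t; apply/rowP => i.
rewrite -(derive_output2 phi_smooth i cw d50) /d5 (derive_dirD _ _ (dY 2 i)) (derive_dirN _ (dY 2
  i)) (derive_dirZ _ _ (dY 2 i)).
rewrite D4 h3 // v2 // v1 // /= [RHS]mxE [X in _ = _ + X]mxE [X in _ = _ - X]mxE [delta_mx 0 j 0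
  i]mxE.
have -> : (2 == r j - 1)%N = false.
  by rewrite ltn_eqF // ltn_subRL.
have -> : (2 == r j - 2)%N = (r j == 4%N).
  by rewrite -(eqn_add2r 2) subnK // eq_sym.
rewrite /= [s *: _]mulr0 subr0 ?eqxx /=.
by case: (r j == 4%N) => /=; rewrite ?mul1r ?mul0r ?mulr0.
Qed.

(** [kernel_zero] requires [k B = 0] on an open set, so [theta_dir] is shown to be nonzero at some
    point of [A], possibly other than the one given. *)
Lemma theta_dir_nonzero j (A : set V) : (2 <= r j)%N -> open A -> A `<=` XK ->
  (exists2 w, A w & input_dir j w != 0) -> exists2 w, A w & theta_dir j w != 0.
Proof.
move=> r2 oA AX [w Aw kw]; apply: contrapT => h.
case/negP: kw; apply/eqP.
have K0 : (0 < K)%N by rewrite addnS.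
have NK : (N <= K.+1)%N by rewrite -addnA leqW // leq_addr.
apply: (kernel_zero phi_smooth K0 NK (flat_chart_open hF) (input_eq hF) oA AX) Aw => //.
- by move=> y /AX /chartX.
- by apply: smooth_subset AX _; exact: input_dir_smooth.
- move=> y Ay; rewrite theta_dirE //; last exact: AX.
  by apply: contrapT => /eqP hy; apply: h; exists y.
Qed.

Lemma minimal_chart (O : set (('rV[R]_p * 'rV[R]_p) * 'M[R]_(l.+1, m))) j :
  minimal_on S phi Fu O -> exists2 w : V, lies_over O (embed w) & input_dir j w != 0.
Proof.
move=> /(_ j) [z Oz kz]; exists (z.1, trunc K z.2); first exact: (lies_over_trunc r Oz).
by rewrite /input_dir -yjet_trunc.
Qed.

Lemma order_le4 j : (r j <= 4)%N.
Proof.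
rewrite leqNgt; apply/negP => r5.
have r4 : (4 <= r j)%N by exact: ltnW.
have r2 : (2 <= r j)%N by exact: ltnW (ltnW r4).
have [w Xw P0] : exists2 w, XK w & theta_dir j w != 0.
  apply: theta_dir_nonzero => //; first exact: (flat_chart_open hF).
  by have [w Xw kw] := minimal_chart j (flat_minimal hF); exists w.
(* Here [r j <> 4], so the correction term of [fibre_directions] vanishes and every row lies in the
   row space of [B *m J]. *)
have BJ : B w.1.1 *m J w.1.1 \in unitmx.
  rewrite -row_full_unit -sub1mx; apply/row_subP => i.
  have [u [t]] := fibre_directions (row i 1%:M) r4 Xw P0.
  rewrite gtn_eqF // mul0r scale0r subr0 => <-.
  by rewrite -mulmxA submxMl.
case/negP: P0; apply/eqP; rewrite -(theta_dirE r2 Xw).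
have : input_dir j w *m (B w.1.1 *m J w.1.1) = 0.
  by rewrite mulmxA (theta_dirE r2 Xw) theta_dir_kernel // ltnW.
by move=> /(congr1 (mulmx^~ (invmx (B w.1.1 *m J w.1.1)))); rewrite mulmxK // mul0mx => ->;
  rewrite mul0mx.
Qed.

(** With all [r j <= 3], [F_q] would see [y] and [y_[1]] only. But [J] has one row more than
    columns, so [q] can move along its kernel with [y] fixed, and [nu] adjusts [v] so that [y_[1]]
    is fixed too. *)
Lemma order_ge4 : (exists w, XK w) -> exists j, r j = 4%N.
Proof.
move=> [w Xw]; have cw := chartX Xw; apply: contrapT => h.
have r3 j : (r j <= 3)%N.
  have := order_le4 j; rewrite leq_eqVlt => /orP [/eqP e|//].
  by case: h; exists j.
have rJ := hphi.2 _ cw.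
have /rowV0Pn [t /sub_kermxP tJ t0] : kermx (J w.1.1) != 0.
  by rewrite kermx_eq0 /row_free rJ neq_ltn ltnSn.
have [nu hnu] := rank_solve (- (w.1.2 *m 'D_t J w.1.1)) rJ.
pose d : V := ((t, nu), 0).
have Y0 i : 'D_d (Y 0 i) w = 0 by rewrite (derive_output0 phi_smooth i d cw) tJ mxE.
have Y1 i : 'D_d (Y 1 i) w = 0 by rewrite (derive_output1 phi_smooth i d cw) /= hnu addNr mxE.
case/negP: t0; apply/eqP; rewrite -[t]/(d.1.1) (derive_q hF d Xw).
rewrite (derive_flat_jet_comp hphi hF d (flat_Fq_smooth hF) Xw).2.
apply: big1 => -[[|[|a]] aN] _; apply: big1 => i _.
- by rewrite Y0 scale0r.
- by rewrite Y1 scale0r.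
- by rewrite (pd_eq0 _ (flat_Fq_upto hF)) ?scaler0 // (leq_ltn_trans (r3 i)) //= addn2.
Qed.
End OrderBound.

(** * Regularity at equilibria *)

(** The bound on the halves says that rounding down loses nothing, so every [kappa j] is even; the
    [m] positive halves then sum to [m.+1], which leaves a single excess unit. *)
Lemma even_weights m (kappa : 'I_m -> nat) :
  (\sum_j kappa j = m.+1 + m.+1)%N -> (m.+1 <= \sum_j (kappa j)./2)%N ->
  (forall j, 0 < kappa j)%N -> exists j, forall i, kappa i = if i == j then 4%N else 2%N.
Proof.
move=> sk hk k0.
have le j : ((kappa j)./2.*2 <= kappa j)%N by rewrite -{2}(odd_double_half (kappa j)) leq_addl.
have s2 : (\sum_j (kappa j)./2.*2 = \sum_j kappa j)%N.
  apply/eqP; rewrite eqn_leq leq_sum //= sk addnn.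
  rewrite (eq_bigr (fun j => 2 * (kappa j)./2)%N) => [|j _]; last by rewrite mul2n.
  by rewrite -big_distrr /= mul2n leq_double.
have ev j : kappa j = (kappa j)./2.*2.
  apply/eqP; rewrite eqn_leq le andbT leqNgt; apply/negP => lt.
  suff : (\sum_j (kappa j)./2.*2 < \sum_j kappa j)%N by rewrite s2 ltnn.
  rewrite (bigD1 j) //= [ltnRHS](bigD1 j) //= -addSn leq_add // leq_sum //.
have h1 j : (0 < (kappa j)./2)%N by have := k0 j; rewrite {1}(ev j) double_gt0.
have sh : (\sum_(j < m) (kappa j)./2 = m.+1)%N.
  apply: double_inj; rewrite -addnn -[RHS]addnn -sk -s2 -big_split /=.
  by apply: eq_bigr => j _; rewrite addnn.
have : (\sum_(j < m) ((kappa j)./2).-1 = 1)%N.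
  apply/eqP; rewrite -(eqn_add2r m) add1n -[X in _ == X]sh -[X in (_ + X)%N](card_ord m)
    -sum1_card -big_split /=.
  by apply/eqP/eq_bigr => j _; rewrite addn1 prednK.
move=> /eqP /sum_nat_eq1 [j [_ hj hi]]; exists j => i; rewrite (ev i).
case: eqP => [->|/eqP ij]; first by rewrite -(prednK (h1 j)) hj.
by rewrite -(prednK (h1 i)) (hi i) // eq_sym.
Qed.

Lemma row_free_castmx_unit (F : fieldType) n k (e : k = n) (A : 'M[F]_(n, k)) :
  castmx (erefl, e) A \in unitmx -> row_free A.
Proof. by move: A; case: n / e => A; rewrite castmx_id row_free_unit. Qed.

(** There are [(kappa j)./2] odd orders below [kappa j]; the matrix factors through these columns,
    [c.*2.+1] being the [c]-th odd order. *)
Lemma rank_odd_columns (F : fieldType) n m (kappa : 'I_m -> nat)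
    (f : 'I_m -> nat -> 'cV[F]_n) : (forall j a, ~~ odd a -> f j a = 0) ->
  (\rank (\mxrow_j (\matrix_(i < n, a < kappa j) f j a i ord0)) <= \sum_j (kappa j)./2)%N.
Proof.
move=> f0.
have -> : \mxrow_j (\matrix_(i < n, a < kappa j) f j a i ord0) =
    \mxrow_j (\matrix_(i < n, c < (kappa j)./2) f j c.*2.+1 i ord0) *m
    \mxblock_(k, j) (\matrix_(c < (kappa k)./2, a < kappa j)
       ((k == j) && (a == c.*2.+1 :> nat))%:R).
  rewrite mul_mxrow_mxblock; apply: eq_mxrow => j; apply/matrixP => i a.
  rewrite mxE summxE (bigD1 j) //= [X in _ + X]big1 => [|k kj]; last first.
    by rewrite mxE big1 // => c _; rewrite !mxE (negPf kj) mulr0.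
  rewrite addr0 mxE.
  have [oa|ea] := boolP (odd a); last first.
    rewrite f0 // mxE big1 // => c _; rewrite !mxE eqxx /=.
    case: eqP => [e|_]; last by rewrite mulr0.
    by move: ea; rewrite e /= odd_double.
  have aE : (a = (a./2).*2.+1 :> nat) by rewrite -[LHS](odd_double_half a) oa.
  have ca : (a./2 < (kappa j)./2)%N.
    have := ltn_ord a; rewrite {1}aE => h.
    by rewrite -ltn_double -ltnS (leq_trans h) // -{1}(odd_double_half (kappa j)) -[leqRHS]add1n
      leq_add2r; case: odd.
  rewrite (bigD1 (Ordinal ca)) //= !mxE -aE !eqxx mulr1 big1 ?addr0 // => c cn.
  rewrite !mxE ?eqxx /=; case: eqP => [e|_]; last by rewrite mulr0.
  case/eqP: cn; apply: val_inj => /=; rewrite e.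
  by rewrite -[c.*2.+1]/(true + c.*2)%N half_bit_double.
by apply: (leq_trans (mxrankM_maxl _ _)); exact: rank_leq_col.
Qed.

Section EquilibriumJacobian.
Context {R : realType} {m : nat}.
Local Notation p := m.+1.
Variables (S : lagrangian_system R p m) (phi : 'rV[R]_p -> 'rV[R]_m)
  (r : 'I_m -> nat) (l : nat)
  (X : set (('rV[R]_p * 'rV[R]_p) * 'M[R]_(l.+1, m)))
  (D : set 'M[R]_(height r, m))
  (Fq Fv : 'M[R]_(height r, m) -> 'rV[R]_p)
  (Fu : 'M[R]_(height r, m) -> 'rV[R]_m).
Hypothesis hphi : submersion S phi.
Hypothesis hF : flat_parameterization S phi X D Fq Fv Fu.
Local Notation N := (height r).
Local Notation K := (height r + l + 8)%N.
Local Notation V := (('rV[R]_p * 'rV[R]_p) * 'M[R]_(K, m))%type.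
Local Notation chart := (@config_chart R p m S K).
Local Notation xi := (@jet_field R p m S K).
Local Notation Y := (@output R p m S phi K).
Local Notation J := (jacobian phi).
Local Notation B := (input_mx S).
Local Notation XK := (@flat_chart R m r l X).
Local Notation YM := (@flat_jet R m S phi r l).
Let phi_smooth : smooth (config S) phi := hphi.1.

Let chartX (w : V) : XK w -> chart w. Proof. exact: (flat_chart_sub hF). Qed.

Definition equilibrium_point (q : 'rV[R]_p) (u : 'rV[R]_m) : V :=
  ((q, 0), trunc K (fun a => if a is 0 then u else 0)).

Variables (q : 'rV[R]_p) (u : 'rV[R]_m).
Hypothesis eq_qu : equilibrium S q u.
Hypothesis Xqu : lies_over X (constant_jet q u).
Let we : V := equilibrium_point q u.

Lemma embed_equilibrium : embed we = constant_jet q u.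
Proof.
congr (_, _); apply: funext => a /=; have [h|h] := ltnP a K; first by rewrite pad_trunc.
by rewrite pad_ge //; case: a h => //; rewrite addnS.
Qed.

Let Xe : XK we. Proof. by rewrite /flat_chart /= embed_equilibrium. Qed.

Lemma jet_field_equilibrium : xi we = 0.
Proof.
have pad0 a : pad we.2 a = if a is 0 then u else 0.
  by have := congr1 snd embed_equilibrium => /= ->.
congr ((_, _), _) => /=; first by rewrite pad0; exact: eq_qu.2.
by apply/row_matrixP => i; rewrite rowK pad0 row0.
Qed.

Lemma flat_jet_equilibrium : YM we = equilibrium_yjet phi N q.
Proof.
apply/matrixP => -[[|a] aN] j; rewrite !mxE //=.
by rewrite -[LHS]/('D_(xi we) (Y a j) we) jet_field_equilibrium derive0.
Qed.

Lemma reversal_equilibrium : reversal we = we.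
Proof.
congr ((_, _), _); first exact: oppr0.
apply/row_matrixP => i; rewrite !rowK -[pad _ i]/((embed we).2 i) embed_equilibrium /=.
by case: (nat_of_ord i) => [|n]; rewrite ?expr0 ?scale1r ?scaler0.
Qed.

Lemma derive_reversal_output a j (d : V) : (a <= K)%N ->
  'D_(reversal d) (Y a j) we = (-1) ^+ a * 'D_d (Y a j) we.
Proof.
move=> aK; have cw := chartX Xe.
have lr := @reversal_lin R p m K.
have dr : differentiable (@reversal R p m K) we.
  by apply: lin_differentiable => //; exact: lin_continuous.
have dY := output_diff phi_smooth a j cw.
have dY' : differentiable (Y a j) (reversal we) by rewrite reversal_equilibrium.
transitivity ('D_d (fun w => Y a j (reversal w)) we).
  rewrite (derive_comp d dr dY') reversal_equilibrium (lin_derive _ _ lr) //.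
  exact: lin_continuous.
rewrite (@derive_ext _ _ (R : normedModType R) chart _ (fun w => (-1) ^+ a *: Y a j w)) //.
- by rewrite (deriveZ _ (diff_derivable dY)).
- exact: config_chart_open.
- by move=> w cw'; exact: (output_reversal phi_smooth j aK cw').
Qed.

(** At a fixed point of the reversal, output differentials cannot distinguish the reversed lift of a
    coordinate vector of order [b] from its multiple by [(-1) ^+ b]. *)
Lemma vertical_reversal n (H : 'M[R]_(N, m) -> 'rV[R]_n) d b j : smooth D H ->
  vertical S phi we d b j ->
  'D_(reversal d) (fun w => H (YM w)) we = (-1) ^+ b *: pd H b j (YM we).
Proof.
move=> sH vd; rewrite (derive_flat_jet_comp hphi hF _ sH Xe).2 -(vertical_comp hphi hF sH Xe vd).
rewrite (derive_flat_jet_comp hphi hF _ sH Xe).2 scaler_sumr; apply: eq_bigr => a _.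
have aN : (a <= N.+1)%N := leqW (ltnW (ltn_ord a)).
have aK : (a <= K)%N by rewrite (leq_trans (ltnW (ltn_ord a))) // -addnA leq_addr.
rewrite scaler_sumr; apply: eq_bigr => i _; rewrite derive_reversal_output // vd // scalerA.
by case: eqP => [->|_] //=; rewrite !mulr0.
Qed.

(** Reversal flips the velocity component of a vertical vector, while the order contributes
    [(-1) ^+ b]; for even [b] the component is its own negative. *)
Lemma pd_Fv_even b j : ~~ odd b -> pd Fv b j (YM we) = 0.
Proof.
move=> ob; have [d vd] := vertical_exists hphi hF b j Xe.
have := vertical_reversal (flat_Fv_smooth hF) vd.
rewrite -(derive_v hF _ Xe) /= (vertical_v hphi hF Xe vd) -signr_odd (negPf ob) expr0 scale1r.
by move=> /eqP; rewrite eq_sym -addr_eq0 -mulr2n -scaler_nat scaler_eq0 pnatr_eq0 => /eqP.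
Qed.

(** The derivative of the identity [phi(F_q(y)) = y]. *)
Lemma pd_Fq_jacobian b j : (pd Fq b j (YM we) *m J q) = ((b == 0)%N)%:R *: delta_mx 0 j.
Proof.
have [d vd] := vertical_exists hphi hF b j Xe.
rewrite -(vertical_q hphi hF Xe vd); apply/rowP => i.
rewrite -[J q]/(J we.1.1) -(derive_output0 phi_smooth i d (chartX Xe)) vd // !mxE eqxx /= eq_sym.
by case: eqP => /= _; rewrite ?mul1r ?mul0r.
Qed.

Lemma regular_star (kappa : 'I_m -> nat) (hk : (\sum_(j < m) kappa j = p + p)%N) :
  (forall j, kappa j <= r j)%N ->
  castmx (erefl, hk) (jacobian_upto Fq Fv kappa (equilibrium_yjet phi N q)) \in unitmx ->
  star r kappa.
Proof.
move=> kr /row_free_castmx_unit; rewrite -flat_jet_equilibrium;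
  set Jm := jacobian_upto _ _ _ _ => fJ.
have rJ : \rank (J q) = m := hphi.2 _ (chartX Xe).
have k0 j : (0 < kappa j)%N.
  rewrite lt0n; apply/negP => /eqP kj0.
  (* The differential of [phi^j] meets only the column of [y^j] itself; were this column missing, it
     would annihilate the whole Jacobian. *)
  pose x : 'rV[R]_(p + p) := row_mx (col j (J q))^T 0.
  have x0 : x *m Jm = 0 *m Jm.
    rewrite /Jm /jacobian_upto !mul_mxrow; apply: eq_mxrow => i.
    rewrite mul_row_col !mul0mx addr0; apply/rowP => a; rewrite !mxE.
    transitivity ((pd Fq a i (YM we) *m J q) 0 j).
      by rewrite mxE; apply: eq_bigr => k _; rewrite !mxE mulrC.
    rewrite pd_Fq_jacobian !mxE eqxx /= (_ : (j == i) = false) ?mulr0 //.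
    by apply/eqP => ji; have := leq_ltn_trans (leq0n a) (ltn_ord a); rewrite -ji kj0.
  have := row_free_inj fJ x0 => /(congr1 lsubmx); rewrite row_mxKl linear0.
  move=> /(congr1 trmx); rewrite trmxK trmx0 colE => Jj.
  have fJt : row_free (J q)^T by rewrite /row_free mxrank_tr rJ.
  have : (delta_mx 0 j : 'rV[R]_m) *m (J q)^T = 0 *m (J q)^T.
    by rewrite mul0mx -trmx_delta -trmx_mul Jj trmx0.
  move=> /(row_free_inj fJt) /rowP /(_ j); rewrite !mxE !eqxx => /eqP.
  by rewrite oner_eq0.
have hb : (p <= \sum_j (kappa j)./2)%N.
  (* Selecting the rows of [F_v] in a regular Jacobian leaves rank [p], which the odd-order columns
     alone must provide. *)
  pose Sel : 'M[R]_(p, p + p) := row_mx 0 1%:M.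
  have rS : \rank (Sel *m Jm) = p.
    rewrite mxrankMfree // -mxrank_tr /Sel tr_row_mx.
    apply/eqP; rewrite -[_ == _]/(row_full _) trmx1 trmx0.
    by apply/row_fullP; exists (row_mx 0 1%:M); rewrite mul_row_col mul0mx add0r mulmx1.
  rewrite -rS /Jm /jacobian_upto mul_mxrow.
  have f0 j a : ~~ odd a -> (pd Fv a j (YM we))^T = 0.
    by move=> oa; rewrite pd_Fv_even // trmx0.
  apply: leq_trans (rank_odd_columns kappa f0); rewrite eq_leq //; congr (\rank _).
  apply: eq_mxrow => j; rewrite mul_row_col mul0mx add0r mul1mx.
  by apply/matrixP => i a; rewrite !mxE.
have [j hj] := even_weights hk hb k0.
(* Here [4 = kappa j <= r j <= 4]. *)
exists j => //; apply/eqP; rewrite eqn_leq (order_le4 hphi hF).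
by have := kr j; rewrite hj eqxx.
Qed.
End EquilibriumJacobian.

(** * The feedback law *)

Section Frames.
Variables (F : fieldType) (m : nat).

(** A constant column [e] completes [J] to a square matrix; its inverse depends smoothly on [J] and
    splits into a generator of the kernel of [J] and a section. *)
Definition frame (e : 'cV[F]_m.+1) (J : 'M[F]_(m.+1, m)) : 'M[F]_(1 + m) := row_mx e J.
Definition kernel_dir e J : 'rV[F]_m.+1 := usubmx (invmx (frame e J)).
Definition section_mx e J : 'M[F]_(m, m.+1) := dsubmx (invmx (frame e J)).

Lemma frameP e J : frame e J \in unitmx ->
  [/\ kernel_dir e J *m e = 1%:M, kernel_dir e J *m J = 0,
      section_mx e J *m J = 1%:M & e *m kernel_dir e J + J *m section_mx e J = 1%:M].
Proof.
move=> uf.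
have h1 : col_mx (kernel_dir e J) (section_mx e J) *m row_mx e J = 1%:M.
  by rewrite vsubmxK -/(frame e J) mulVmx.
have h2 : row_mx e J *m col_mx (kernel_dir e J) (section_mx e J) = 1%:M.
  by rewrite vsubmxK -/(frame e J) mulmxV.
rewrite mul_row_col in h2; rewrite mul_col_row scalar_mx_block in h1.
by have [-> -> _ ->] := eq_block_mx h1.
Qed.

(** Dual completion of [B] by a row [c]: the inverse provides the column killed by [B], which
    extracts the input-free equation, and a right inverse of [B], which recovers [u]. *)
Definition coframe (c : 'rV[F]_m.+1) (B : 'M[F]_(m, m.+1)) : 'M[F]_(1 + m) := col_mx c B.
Definition annihilator c B : 'cV[F]_m.+1 := lsubmx (invmx (coframe c B)).
Definition cosection_mx c B : 'M[F]_(m.+1, m) := rsubmx (invmx (coframe c B)).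

Lemma coframeP c B : coframe c B \in unitmx ->
  [/\ c *m annihilator c B = 1%:M, B *m annihilator c B = 0,
      B *m cosection_mx c B = 1%:M
    & annihilator c B *m c + cosection_mx c B *m B = 1%:M].
Proof.
move=> uf.
have h1 : row_mx (annihilator c B) (cosection_mx c B) *m col_mx c B = 1%:M.
  by rewrite hsubmxK -/(coframe c B) mulVmx.
have h2 : col_mx c B *m row_mx (annihilator c B) (cosection_mx c B) = 1%:M.
  by rewrite hsubmxK -/(coframe c B) mulmxV.
rewrite mul_row_col in h1; rewrite mul_col_row scalar_mx_block in h2.
by have [-> _ -> ->] := eq_block_mx h2.
Qed.

Lemma coframe_exists (B : 'M[F]_(m, m.+1)) : \rank B = m -> exists c, coframe c B \in unitmx.
Proof.
move=> rB; have /row_subPn [i hi] : ~~ (1%:M <= B)%MS.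
  by apply/negP => /mxrankS; rewrite mxrank1 rB ltnn.
exists (row i 1%:M); rewrite -row_full_unit /row_full eqn_leq rank_leq_col /=.
have lt : (B < coframe (row i 1%:M) B)%MS.
  rewrite /ltmx /coframe -!addsmxE addsmxSr /=.
  by apply: contra hi; apply: submx_trans; exact: addsmxSl.
by have := rank_ltmx lt; rewrite rB.
Qed.

Lemma frame_exists (J : 'M[F]_(m.+1, m)) : \rank J = m -> exists e, frame e J \in unitmx.
Proof.
move=> rJ; have [|c hc] := @coframe_exists J^T; first by rewrite mxrank_tr.
exists c^T; rewrite -unitmx_tr /frame.
suff -> : (row_mx c^T J : 'M[F]_(1 + m))^T = coframe c J^T by [].
by rewrite /coframe tr_row_mx trmxK.
Qed.
End Frames.

Section OpenPreimage.
Context {R : realType}.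

Lemma open_preimage (V W : normedModType R) (A : set V) (C : set W) (f : V -> W) :
  open A -> open C -> smooth A f -> open (A `&` f @^-1` C).
Proof.
move=> oA oC sf; rewrite openE => x [Ax Cx].
apply: filterI; first exact: open_nbhs_nbhs.
exact: ((sf 0%N) x Ax C (open_nbhs_nbhs (conj oC Cx))).
Qed.

Lemma open_unitmx (V : normedModType R) n (A : set V) (f : V -> 'M[R]_n) :
  open A -> smooth A f -> open [set x | A x /\ f x \in unitmx].
Proof.
move=> oA sf.
have -> : [set x | A x /\ f x \in unitmx] = A `&` (fun x => \det (f x)) @^-1` [set y : R | y != 0].
  by apply/seteqP; split => x [Ax ux]; split => //; move: ux; rewrite /= unitmxE unitfE.
apply: (@open_preimage V (R : normedModType R)) => //; last exact: smooth_det.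
Qed.
End OpenPreimage.

Section SmoothFrames.
Context {R : realType} {m : nat} {V : normedModType R}.
Variables (A : set V) (A_open : open A).

Lemma frame_smooth (e : 'cV[R]_m.+1) (f : V -> 'M[R]_(m.+1, m)) : smooth A f ->
  smooth A (fun x => frame e (f x)).
Proof.
move=> sf; apply: smooth_mx => // i j.
rewrite /frame; case: (splitP j) => k jk.
- apply: (@smooth_ext _ _ (R : normedModType R) _ (fun=> e i k)) => //; last exact: smooth_cst.
  move=> x _; have -> : j = lshift m k by exact: val_inj.
  by rewrite row_mxEl.
- apply: (@smooth_ext _ _ (R : normedModType R) _ (fun x => f x i k)) => //;
  last exact: smooth_coord.
  move=> x _; have -> : j = rshift 1 k by exact: val_inj.
  by rewrite row_mxEr.
Qed.

Lemma coframe_smooth (c : 'rV[R]_m.+1) (f : V -> 'M[R]_(m, m.+1)) : smooth A f ->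
  smooth A (fun x => coframe c (f x)).
Proof.
move=> sf; apply: smooth_mx => // i j.
rewrite /coframe; case: (splitP i) => k ik.
- apply: (@smooth_ext _ _ (R : normedModType R) _ (fun=> c k j)) => //; last exact: smooth_cst.
  move=> x _; have -> : i = lshift m k by exact: val_inj.
  by rewrite col_mxEu.
- apply: (@smooth_ext _ _ (R : normedModType R) _ (fun x => f x k j)) => //;
  last exact: smooth_coord.
  move=> x _; have -> : i = rshift 1 k by exact: val_inj.
  by rewrite col_mxEd.
Qed.
End SmoothFrames.

Section JetRepresentatives.
Context {R : realType} {p m : nat}.

(** Reduces closed-loop derivatives to finite dimension. The last row of the direction is the true
    [z.2 k], not the zero that [shift_rows] would put there. *)
Lemma total_deriv_rep k (acc : jet R p m -> 'rV[R]_p) (h : jet R p m -> R)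
    (A : set (('rV[R]_p * 'rV[R]_p) * 'M[R]_(k, m)))
    (H : ('rV[R]_p * 'rV[R]_p) * 'M[R]_(k, m) -> R) z : open A ->
  (forall y, A (y.1, trunc k y.2) -> h y = H (y.1, trunc k y.2)) ->
  A (z.1, trunc k z.2) ->
  total_deriv acc h z =
    'D_((z.1.2, acc z), trunc k (fun a => z.2 a.+1)) H (z.1, trunc k z.2).
Proof.
move=> oA hH Az; rewrite /total_deriv /jet_diff.
set w := (z.1, trunc k z.2); pose d := ((z.1.2, acc z), trunc k (fun a => z.2 a.+1)).
transitivity (derive1 (fun s : R => H (w + s *: d)) 0); last exact: derive1_line.
rewrite !derive1E.
have tr s : ((z.1 + s *: (z.1.2, acc z)), trunc k (fun a => z.2 a + s *: z.2 a.+1)) = w + s *: d.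
  by congr (_, _); apply/row_matrixP => i; rewrite /= linearD linearZ /= !rowK.
have c : {for 0, continuous (fun s : R => w + s *: d)}.
  by apply: cvgD; [exact: cvg_cst|apply: cvgZr_tmp; exact: cvg_id].
apply: near_eq_derive.
have : \forall s \near (0 : R), A (w + s *: d).
  by apply: c; rewrite scale0r addr0; exact: open_nbhs_nbhs.
apply: filterS => s As; rewrite hH /= tr //.
Qed.
End JetRepresentatives.

Lemma smooth_fst_comp (R : realType) (V V' W : normedModType R) (A : set V)
    (A' : set (V * V')) (f : V -> W) : fin_dim V -> fin_dim V' -> open A -> open A' ->
  (forall z, A' z -> A z.1) -> smooth A f -> smooth A' (fun z => f z.1).
Proof.
move=> fV fV' oA oA' AA sf; apply: (@smooth_comp _ _ _ _ A' A f fst) => //.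
by apply: smooth_lin => //; exact: fin_dim_pair.
Qed.

Lemma derive_line_ext (R : realType) (V V' W : normedModType R) (f : V -> W) (g : V' -> W)
    x d x' d' : (forall s : R, f (x + s *: d) = g (x' + s *: d')) ->
  'D_d f x = 'D_d' g x'.
Proof.
by move=> fg; rewrite -derive1_line -[RHS]derive1_line; congr (derive1 _ 0); apply: funext.
Qed.

(** * The explicit law on (q, v, w, w_[1], w_[2]) *)

Section ExplicitFeedback.
Context {R : realType} {m : nat}.
Local Notation p := m.+1.
Variables (S : lagrangian_system R p m) (phi : 'rV[R]_p -> 'rV[R]_m).
Hypothesis phi_smooth : smooth (config S) phi.
Variables (j0 : 'I_m) (e : 'cV[R]_p) (c : 'rV[R]_p).
Local Notation J := (jacobian phi).
Local Notation B := (input_mx S).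
Local Notation T := ('rV[R]_p * 'rV[R]_p)%type.
Local Notation Z := (('rV[R]_p * 'rV[R]_p) * 'M[R]_(3, m))%type.
Local Notation t q := (kernel_dir e (J q)).
Local Notation sec q := (section_mx e (J q)).
Local Notation ann q := (annihilator c (B q)).
Local Notation cosec q := (cosection_mx c (B q)).

(** Lets the annihilator of [B] act on output accelerations: [J *m multiplier] is the annihilator
    wherever the latter kills the kernel direction. *)
Definition multiplier (q : 'rV[R]_p) : 'cV[R]_m := sec q *m ann q.
Definition residual (x : T) : R :=
  (- (phi_curvature phi x *m multiplier x.1) - drift S x *m ann x.1) 0 0.

(* The input-free equation of motion is [y_[2] multiplier + residual = 0]; here it is
   solved for [y^j0_[2]], the rows of [z.2] standing for [w, w_[1], w_[2]]. *)
Definition solved2 (z : Z) : R :=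
  - ((\sum_(i | i != j0) multiplier z.1.1 i 0 * z.2 ord0 i) + residual z.1)
  / multiplier z.1.1 j0 0.
Definition target_output (z : Z) : 'rV[R]_m := \row_i if i == j0 then solved2 z else z.2 ord0 i.
(** Realizes the target [y_[2]] with no component along the kernel direction, which [y_[2]] leaves
    undetermined. *)
Definition base_acceleration (z : Z) : 'rV[R]_p := (target_output z - phi_curvature phi z.1) *m
  sec z.1.1.
(** A reference motion with [w_[3] = 0]; actual trajectories differ from it by a multiple of
    [kernel_field] and in the last row. *)
Definition base_field (z : Z) : Z := ((z.1.2, base_acceleration z), shift_rows z.2).
Definition kernel_field (z : Z) : Z := ((0, t z.1.1), 0).
Definition solved3 (z : Z) : R := 'D_(base_field z) solved2 z.
(** [y^j0_[4]] for the reference motion; a kernel acceleration [s] adds [s * kernel_gain]. *)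
Definition solved4 (z : Z) : R := 'D_(base_field z) solved3 z.
Definition kernel_gain (z : Z) : R := 'D_(kernel_field z) solved3 z.
(** The kernel acceleration is the one for which [y^j0_[4]] equals [w^j0], the entry
    [z.2 ord0 j0]. *)
Definition loop_acc (z : Z) : 'rV[R]_p :=
  base_acceleration z + ((z.2 ord0 j0 - solved4 z) / kernel_gain z) *: t z.1.1.
Definition feedback (z : Z) : 'rV[R]_m := (loop_acc z - drift S z.1) *m cosec z.1.1.

Variable E : set T.
Hypothesis E_open : open E.
Hypothesis E_config : forall x, E x -> config S x.1.
Hypothesis E_frame : forall x, E x -> frame e (J x.1) \in unitmx.
Hypothesis E_coframe : forall x, E x -> coframe c (B x.1) \in unitmx.
(** These three say that the input-free equation lacks theta'', is solvable for [y^j0_[2]], and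
    lacks theta'. *)
Hypothesis E_ann : forall x, E x -> t x.1 *m ann x.1 = 0.
Hypothesis E_mult : forall x, E x -> multiplier x.1 j0 0 != 0.
Hypothesis E_residual : forall x, E x -> 'D_(0, t x.1) residual x = 0.

Let EZ : set Z := [set z | E z.1].
Let EZ_open : open EZ. Proof. exact: open_comp_fst. Qed.

Let on_E n (f : 'rV[R]_p -> 'M[R]_(n.1, n.2)) : smooth (config S) f -> smooth E (fun x => f x.1).
Proof. by move=> sf; apply: (smooth_fst_comp (A := config S)) => //; exact: config_open. Qed.

Let on_EZ (W : normedModType R) (f : T -> W) : smooth E f -> smooth EZ (fun z => f z.1).
Proof. by move=> sf; apply: (smooth_fst_comp (A := E)). Qed.

Let J_smooth : smooth E (fun x : T => J x.1).
Proof. exact: (on_E (n := (p, m)) (jacobian_smooth phi_smooth)). Qed.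

Let B_smooth : smooth E (fun x : T => B x.1).
Proof. exact: (on_E (n := (m, p)) (input_mx_smooth S)). Qed.

Let frame_inv_smooth : smooth E (fun x : T => invmx (frame e (J x.1))).
Proof. by apply: smooth_invmx => //; exact: frame_smooth. Qed.

Let coframe_inv_smooth : smooth E (fun x : T => invmx (coframe c (B x.1))).
Proof. by apply: smooth_invmx => //; exact: coframe_smooth. Qed.

Let t_smooth : smooth E (fun x : T => t x.1).
Proof.
by apply: (@smooth_linl _ _ _ _ _ (@usubmx R 1 m p)) => // a x y; rewrite linearP.
Qed.

Let sec_smooth : smooth E (fun x : T => sec x.1).
Proof.
by apply: (@smooth_linl _ _ _ _ _ (@dsubmx R 1 m p)) => // a x y; rewrite linearP.
Qed.

Let ann_smooth : smooth E (fun x : T => ann x.1).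
Proof.
by apply: (@smooth_linl _ _ _ _ _ (@lsubmx R p 1 m)) => // a x y; rewrite linearP.
Qed.

Let cosec_smooth : smooth E (fun x : T => cosec x.1).
Proof.
by apply: (@smooth_linl _ _ _ _ _ (@rsubmx R p 1 m)) => // a x y; rewrite linearP.
Qed.

Lemma multiplier_smooth : smooth E (fun x : T => multiplier x.1).
Proof. exact: smooth_mulmx. Qed.

Let drift_sm : smooth E (drift S).
Proof. by apply: smooth_subset (drift_smooth S) => x; exact: E_config. Qed.

Let snd_smooth : smooth E (fun x : T => x.2). Proof. exact: smooth_lin. Qed.

Lemma phi_curvature_smooth : smooth E (phi_curvature phi).
Proof.
apply: smooth_mulmx => //.
apply: (@smooth_ext _ _ _ _ (fun x : T => 'D_(x.2, 0) (fun y : T => J y.1) x)) => //.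
apply: smooth_derive_field => //; apply: smooth_pair => //; exact: smooth_cst.
Qed.

Lemma residual_smooth : smooth E residual.
Proof.
apply: smooth_coord => //; apply: smooth_minus => //; last exact: smooth_mulmx.
apply: smooth_opp => //; apply: smooth_mulmx => //; first exact: phi_curvature_smooth.
exact: multiplier_smooth.
Qed.

Let W_smooth i j : smooth EZ (fun z : Z => z.2 i j).
Proof. by apply: smooth_coord => //; exact: smooth_lin. Qed.

Lemma solved2_smooth : smooth EZ solved2.
Proof.
have sm i : smooth EZ (fun z => multiplier z.1.1 i 0).
  by apply: smooth_coord => //; exact: (on_EZ multiplier_smooth).
rewrite /solved2; apply: smooth_mul => //; last first.
  by apply: smooth_inv => // z; exact: E_mult.
apply: smooth_opp => //; apply: smooth_add => //; last exact: (on_EZ residual_smooth).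
by apply: smooth_sum => // i _; apply: smooth_mul.
Qed.

Lemma base_acc_smooth : smooth EZ base_acceleration.
Proof.
apply: smooth_mulmx => //; last exact: (on_EZ sec_smooth).
apply: smooth_minus => //; last exact: (on_EZ phi_curvature_smooth).
apply: smooth_mx => // a i.
apply: (@smooth_ext _ _ (R : normedModType R) _ (if i == j0 then solved2 else fun z => z.2 ord0
  i)) => //.
  by move=> z _; rewrite mxE; case: eqP.
by case: eqP => _ //; exact: solved2_smooth.
Qed.

Lemma base_field_smooth : smooth EZ base_field.
Proof.
apply: smooth_pair => //.
  apply: smooth_pair => //; last exact: base_acc_smooth.
  exact: (on_EZ snd_smooth).
apply: (@smooth_linl _ _ _ _ _ (@shift_rows R m 3)) => //; first exact: shift_rows_lin.
exact: smooth_lin.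
Qed.

Lemma solved3_smooth : smooth EZ solved3.
Proof. by apply: smooth_derive_field => //; [exact: solved2_smooth|exact: base_field_smooth]. Qed.

Lemma solved4_smooth : smooth EZ solved4.
Proof. by apply: smooth_derive_field => //; [exact: solved3_smooth|exact: base_field_smooth]. Qed.

Lemma gain_smooth : smooth EZ kernel_gain.
Proof.
apply: smooth_derive_field => //; first exact: solved3_smooth.
apply: smooth_pair => //; last exact: smooth_cst.
by apply: smooth_pair => //; [exact: smooth_cst|exact: (on_EZ t_smooth)].
Qed.

Definition feedback_domain : set Z := EZ `&` kernel_gain @^-1` [set y | y != 0].
Local Notation FD := feedback_domain.

Lemma feedback_domain_open : open FD.
Proof.
by apply: (@open_preimage _ _ (R : normedModType R)) => //; exact: gain_smooth.
Qed.

Lemma feedback_smooth : smooth FD feedback.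
Proof.
have oF := feedback_domain_open.
have sub (W : normedModType R) (f : Z -> W) : smooth EZ f -> smooth FD f.
  by apply: smooth_subset => z [].
apply: smooth_mulmx => //; last exact/sub/(on_EZ cosec_smooth).
apply: smooth_minus => //; last exact/sub/(on_EZ drift_sm).
apply: smooth_add => //; first exact/sub/base_acc_smooth.
apply: smooth_scale => //; last exact/sub/(on_EZ t_smooth).
apply: smooth_mul => //.
  by apply: smooth_minus => //; apply: sub => //; exact: solved4_smooth.
by apply: smooth_inv => //; [move=> z []|exact/sub/gain_smooth].
Qed.

Let solved2_diff z : EZ z -> differentiable solved2 z.
Proof. exact: smooth_diff solved2_smooth. Qed.

Let solved3_diff z : EZ z -> differentiable solved3 z.
Proof. exact: smooth_diff solved3_smooth. Qed.

Lemma solved2_row z (V : 'M[R]_(3, m)) : (forall i, V ord0 i = 0) -> solved2 (z + (0, V)) =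
  solved2 z.
Proof.
move=> V0; rewrite /solved2 [(z + _).1]addr0; congr (- (_ + _) / _).
by apply: eq_bigr => i _; rewrite [(z + _).2 ord0 i]mxE V0 addr0.
Qed.

Lemma derive_solved2_row z (V : 'M[R]_(3, m)) : (forall i, V ord0 i = 0) -> 'D_(0, V) solved2 z = 0.
Proof.
move=> V0; apply: derive_affine => s; rewrite scaler0 addr0.
have -> : s *: (0, V) = (0, s *: V) :> Z by congr (_, _); exact: scaler0.
by apply: solved2_row => i; rewrite mxE V0 mulr0.
Qed.

(** Each derivative along [base_field] reaches one row further: [solved2] sees [w], [solved3] also
    [w_[1]]. Hence three rows suffice for [solved4], and [w_[3]] never enters. *)
Lemma solved3_row z (V : 'M[R]_(3, m)) : EZ z ->
  (forall (a : 'I_3) i, (a < 2)%N -> V a i = 0) -> solved3 (z + (0, V)) = solved3 z.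
Proof.
move=> Ez V0; rewrite /solved3.
have V00 i : V ord0 i = 0 by exact: V0.
have -> : base_field (z + (0, V)) = base_field z + (0, shift_rows V).
  have bE : base_acceleration (z + (0, V)) = base_acceleration z.
    rewrite /base_acceleration [(z + _).1]addr0; congr ((_ - _) *m _).
    by apply/rowP => i; rewrite !mxE solved2_row // V00 addr0.
  congr (_, _); rewrite /base_field /=; first by rewrite bE !addr0.
  by have := shift_rows_lin 1 z.2 V; rewrite !scale1r.
have tr v : 'D_v solved2 (z + (0, V)) = 'D_v solved2 z.
  by apply: derive_line_ext => s; rewrite addrAC; exact: solved2_row.
rewrite tr (derive_dirD _ _ (solved2_diff Ez)) derive_solved2_row ?addr0 // => i.
by rewrite /shift_rows mxE /pad insubT //= mxE V0.
Qed.

Lemma derive_solved3_row z (V : 'M[R]_(3, m)) : EZ z ->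
  (forall (a : 'I_3) i, (a < 2)%N -> V a i = 0) -> 'D_(0, V) solved3 z = 0.
Proof.
move=> Ez V0; apply: derive_affine => s; rewrite scaler0 addr0.
have -> : s *: (0, V) = (0, s *: V) :> Z by congr (_, _); exact: scaler0.
by apply: solved3_row => // a i a2; rewrite mxE V0 // mulr0.
Qed.

(** Only the velocity moves, and [solved2] depends on it through [residual] alone. *)
Lemma derive_solved2_kernel z : EZ z -> 'D_(kernel_field z) solved2 z = 0.
Proof.
move=> Ez; have dG := smooth_diff residual_smooth Ez.
pose k0 := - (\sum_(i | i != j0) multiplier z.1.1 i 0 * z.2 ord0 i) / multiplier z.1.1 j0 0.
pose k1 := - (multiplier z.1.1 j0 0)^-1.
transitivity ('D_(0, t z.1.1) (fun x => k0 + k1 *: residual x) z.1).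
  apply: derive_line_ext => s; rewrite /solved2 /= !scaler0 !addr0 -[k1 *: _]/(k1 * _) /k0 /k1.
  by rewrite opprD mulrDl; congr (_ + _); rewrite !mulNr mulrC.
rewrite (derive_add _ (differentiable_cst _ _) (differentiableZ _ dG)) derive_cst.
by rewrite (deriveZ _ (diff_derivable dG)) E_residual // scaler0 addr0.
Qed.

(** The value is free of [s]: a kernel acceleration does not reach [y^j0_[3]]. As [W] is arbitrary
    beyond row 0, open-loop and closed-loop motions are both covered. *)
Lemma derive_solved2_trajectory z (s : R) (W : 'M[R]_(3, m)) : EZ z ->
  (forall i, W ord0 i = shift_rows z.2 ord0 i) ->
  'D_((z.1.2, base_acceleration z + s *: t z.1.1), W) solved2 z = solved3 z.
Proof.
move=> Ez hW; have d := solved2_diff Ez.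
have -> : ((z.1.2, base_acceleration z + s *: t z.1.1), W) =
    base_field z + s *: kernel_field z + (0, W - shift_rows z.2) :> Z.
  by congr ((_, _), _) => /=; rewrite ?scaler0 ?addr0 // addrC subrK.
rewrite !(derive_dirD _ _ d) (derive_dirZ _ _ d) derive_solved2_kernel // scaler0 addr0.
by rewrite derive_solved2_row ?addr0 // => i; rewrite [LHS]mxE hW [X in _ + X]mxE subrr.
Qed.

(** The first order at which [s] appears; solving for [s] is the feedback. *)
Lemma derive_solved3_trajectory z (s : R) (W : 'M[R]_(3, m)) : EZ z ->
  (forall (a : 'I_3) i, (a < 2)%N -> W a i = shift_rows z.2 a i) ->
  'D_((z.1.2, base_acceleration z + s *: t z.1.1), W) solved3 z = solved4 z + s * kernel_gain z.
Proof.
move=> Ez hW; have d := solved3_diff Ez.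
have -> : ((z.1.2, base_acceleration z + s *: t z.1.1), W) =
    base_field z + s *: kernel_field z + (0, W - shift_rows z.2) :> Z.
  by congr ((_, _), _) => /=; rewrite ?scaler0 ?addr0 // addrC subrK.
rewrite !(derive_dirD _ _ d) (derive_dirZ _ _ d).
by rewrite derive_solved3_row ?addr0 // => a i a2; rewrite [LHS]mxE hW // [X in _ + X]mxE subrr.
Qed.

Lemma target_multiplier z : EZ z -> (target_output z *m multiplier z.1.1) 0 0 + residual z.1 = 0.
Proof.
move=> Ez; have l0 := E_mult Ez.
rewrite mxE (bigD1 j0) //= mxE eqxx /solved2 mulNr mulNr divfK // -addrA.
rewrite [X in _ + (X + _)](eq_bigr (fun i => multiplier z.1.1 i 0 * z.2 ord0 i)) ?addNr //.
by move=> i ij; rewrite mxE (negPf ij) mulrC.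
Qed.

Lemma loop_acc_jacobian z : EZ z ->
  loop_acc z *m J z.1.1 = target_output z - phi_curvature phi z.1.
Proof.
move=> Ez; have [_ tJ sJ _] := frameP (E_frame Ez).
by rewrite mulmxDl -scalemxAl tJ scaler0 addr0 -mulmxA sJ mulmx1.
Qed.

(** An acceleration is attainable by an input exactly if the annihilator kills its difference from
    the drift; [solved2] is defined to achieve this. *)
Lemma annihilate z : EZ z -> (loop_acc z - drift S z.1) *m ann z.1.1 = 0.
Proof.
move=> Ez; apply/matrixP => i j; rewrite !ord1 [RHS]mxE -(target_multiplier Ez).
rewrite mulmxBl mulmxDl -scalemxAl E_ann // scaler0 addr0 -mulmxA mulmxBl /residual.
transitivity ((target_output z *m multiplier z.1.1 +
  (- (phi_curvature phi z.1 *m multiplier z.1.1) - drift S z.1 *m ann z.1.1)) 0 0).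
  by rewrite addrA.
by rewrite [LHS]mxE.
Qed.

Lemma loop_accel z : EZ z -> accel S (z.1, feedback z) = loop_acc z.
Proof.
move=> Ez; have [_ _ _ h] := coframeP (E_coframe Ez).
rewrite accel_affine; last exact: E_config.
rewrite /feedback -mulmxA.
have -> : cosec z.1.1 *m B z.1.1 = 1%:M - ann z.1.1 *m c by rewrite -h addrC addKr.
by rewrite mulmxBr mulmx1 mulmxA annihilate // mul0mx subr0 addrC subrK.
Qed.

Lemma closed_loop_output (z : jet R p m) i : FD (z.1, trunc 3 z.2) ->
  output_deriv (closed_loop S feedback) phi (if i == j0 then 4%N else 2%N) i z = z.2 0%N 0 i.
Proof.
set od := output_deriv (closed_loop S feedback) phi.
have odS a k y : od a.+1 k y = total_deriv (closed_loop S feedback) (od a k) y by [].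
have oC := @config_chart_open R p m S 3.
pose cl := closed_loop S feedback.
have od1 k y : config S y.1.1 -> od 1 k y = output S phi 1 k ((y.1, trunc 3 y.2) : Z).
  move=> cq; have cy : config_chart S ((y.1, trunc 3 y.2) : Z) by exact: cq.
  have h0 (y' : jet R p m) : config_chart S ((y'.1, trunc 3 y'.2) : Z) ->
    od 0 k y' = output S phi 0 k ((y'.1, trunc 3 y'.2) : Z) by [].
  by rewrite odS (total_deriv_rep cl oC h0 cy) (derive_output0 phi_smooth k _ cy) (output1E
    phi_smooth k cy).
have od2 k y : FD (y.1, trunc 3 y.2) -> od 2 k y = target_output (y.1, trunc 3 y.2) 0 k.
  move=> [Ey _]; have cy : config_chart S ((y.1, trunc 3 y.2) : Z) by exact: E_config Ey.
  have h1 (y' : jet R p m) : config_chart S ((y'.1, trunc 3 y'.2) : Z) ->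
    od 1 k y' = output S phi 1 k ((y'.1, trunc 3 y'.2) : Z) by exact: od1.
  rewrite odS (total_deriv_rep cl oC h1 cy) (derive_output1 phi_smooth k _ cy) /=.
  by rewrite /cl /closed_loop (loop_accel Ey) (loop_acc_jacobian Ey) subrK.
have row_shift y (a : 'I_3) k : (a < 2)%N ->
    trunc 3 (fun b => y.2 b.+1) a k = shift_rows (trunc 3 y.2) a k :> R.
  by move=> a2; rewrite !mxE pad_trunc.
have field y : EZ (y.1, trunc 3 y.2) -> closed_loop S feedback y = loop_acc (y.1, trunc 3 y.2).
  by move=> Ey; rewrite /closed_loop (loop_accel Ey).
have od3 y : FD (y.1, trunc 3 y.2) -> od 3 j0 y = solved3 (y.1, trunc 3 y.2).
  move=> Fy; have [Ey _] := Fy.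
  have h2 (y' : jet R p m) : FD (y'.1, trunc 3 y'.2) -> od 2 j0 y' = solved2 (y'.1, trunc 3 y'.2).
    by move=> Fy'; rewrite (od2 _ _ Fy') mxE eqxx.
  rewrite odS (total_deriv_rep cl feedback_domain_open h2 Fy) /cl (field _ Ey).
  apply: (derive_solved2_trajectory (z := (y.1, trunc 3 y.2))) => // k.
  exact: row_shift.
have od4 y : FD (y.1, trunc 3 y.2) -> od 4 j0 y = y.2 0%N 0 j0.
  move=> Fy; have [Ey g0] := Fy.
  rewrite odS (total_deriv_rep cl feedback_domain_open od3 Fy) /cl (field _ Ey).
  rewrite (derive_solved3_trajectory (z := (y.1, trunc 3 y.2))) //; last first.
    by move=> a k a2; exact: row_shift.
  by rewrite divfK // addrC subrK mxE.
move=> Fz; case: eqP => [->|/eqP ij]; first exact: od4.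
by rewrite od2 // mxE (negPf ij) mxE.
Qed.
End ExplicitFeedback.

(** * Open loop: validity of the explicit law and recovery of u *)

Section OpenLoop.
Context {R : realType} {m : nat}.
Local Notation p := m.+1.
Variables (S : lagrangian_system R p m) (phi : 'rV[R]_p -> 'rV[R]_m)
  (r : 'I_m -> nat) (l : nat)
  (X : set (('rV[R]_p * 'rV[R]_p) * 'M[R]_(l.+1, m)))
  (D : set 'M[R]_(height r, m))
  (Fq Fv : 'M[R]_(height r, m) -> 'rV[R]_p)
  (Fu : 'M[R]_(height r, m) -> 'rV[R]_m).
Hypothesis hphi : submersion S phi.
Hypothesis hF : flat_parameterization S phi X D Fq Fv Fu.
Local Notation N := (height r).
Local Notation K := (height r + l + 8)%N.
Local Notation V := (('rV[R]_p * 'rV[R]_p) * 'M[R]_(K, m))%type.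
Local Notation chart := (@config_chart R p m S K).
Local Notation xi := (@jet_field R p m S K).
Local Notation Y := (@output R p m S phi K).
Local Notation J := (jacobian phi).
Local Notation B := (input_mx S).
Local Notation XK := (@flat_chart R m r l X).
Local Notation YM := (@flat_jet R m S phi r l).
Let phi_smooth : smooth (config S) phi := hphi.1.

Let chartX (w : V) : XK w -> chart w. Proof. exact: (flat_chart_sub hF). Qed.
Local Notation T := ('rV[R]_p * 'rV[R]_p)%type.
Local Notation Z := (('rV[R]_p * 'rV[R]_p) * 'M[R]_(3, m))%type.
Variable (j0 : 'I_m).
Hypothesis r4 : r j0 = 4%N.
Local Notation P := (theta_dir (l := l) S phi Fq j0).

Let le4 : (4 <= r j0)%N. Proof. by rewrite r4. Qed.
Let le3 : (3 <= r j0)%N. Proof. by rewrite r4. Qed.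
Let le2 : (2 <= r j0)%N. Proof. by rewrite r4. Qed.

(* The row space of [B] surjects by [J] onto a complement of [delta_mx 0 j0] and
   contains the vector [P w] of the kernel of [J]. *)
Lemma input_mx_rank w : XK w -> P w != 0 -> \rank (B w.1.1) = m.
Proof.
move=> Xw P0; have PJ := theta_dir_kernel hphi hF le3 Xw.
have PB := theta_dirE hphi hF le2 Xw.
apply/eqP; rewrite eqn_leq rank_leq_row /= -(mxrank_mul_ker (B w.1.1) (J w.1.1)).
have h1 : (m <= \rank (B w.1.1 *m J w.1.1) + 1)%N.
  have s1 : (1%:M <= B w.1.1 *m J w.1.1 + (delta_mx 0 j0 : 'rV[R]_m))%MS.
    apply/row_subP => i.
    have [u [t h]] := fibre_directions hphi hF (row i 1%:M) le4 Xw P0.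
    have -> : row i (1%:M : 'M[R]_m) = u *m (B w.1.1 *m J w.1.1) + ((r j0 == 4%N)%:R * t) *:
      delta_mx 0 j0.
      by rewrite mulmxA h subrK.
    by apply: addmx_sub_adds; [exact: submxMl|exact: scalemx_sub].
  have := mxrankS s1; rewrite mxrank1 => h; apply: (leq_trans h).
  by apply: (leq_trans (mxrank_adds_leqif _ _).1); rewrite leq_add2l rank_leq_row.
apply: (leq_trans h1); rewrite leq_add2l.
have Pk : (P w <= B w.1.1 :&: kermx (J w.1.1))%MS.
  by rewrite sub_capmx -{1}PB submxMl /=; apply/sub_kermxP.
by have := mxrankS Pk; rewrite rank_rV P0.
Qed.

Section Local.
Variables (e : 'cV[R]_p) (c : 'rV[R]_p) (i0 : 'I_p).
Variable (O : set (('rV[R]_p * 'rV[R]_p) * 'M[R]_(l.+1, m))).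
Hypotheses (O_open : open O) (OX : O `<=` X).
Local Notation t q := (kernel_dir e (J q)).
Local Notation ann q := (annihilator c (B q)).
Local Notation mult := (multiplier S phi e c).
Local Notation resid := (residual S phi e c).

Definition framed : set T :=
  [set x | [/\ config S x.1, frame e (J x.1) \in unitmx & coframe c (B x.1) \in unitmx]].

Lemma framed_open : open framed.
Proof.
have oC : open [set x : T | config S x.1] by exact/open_comp_fst/config_open.
have sJ : smooth [set x : T | config S x.1] (fun x : T => J x.1).
  by apply: (smooth_fst_comp (A := config S)) => //; [exact: config_open|exact: jacobian_smooth].
have sB : smooth [set x : T | config S x.1] (fun x : T => B x.1).
  by apply: (smooth_fst_comp (A := config S)) => //; [exact: config_open|exact: input_mx_smooth].
have o1 := open_unitmx oC (frame_smooth oC e sJ).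
have o2 := open_unitmx oC (coframe_smooth oC c sB).
have -> : framed = [set x : T | config S x.1 /\ frame e (J x.1) \in unitmx] `&`
    [set x : T | config S x.1 /\ coframe c (B x.1) \in unitmx].
  by apply/seteqP; split => x; [case|case=> [[? ?] [? ?]]].
exact: openI.
Qed.

(** [theta_dir <> 0] is recorded by one fixed entry [i0], so that openness is that of a scalar
    preimage. *)
Definition regular_set : set V :=
  [set w | [/\ lies_over O (embed w), P w 0 i0 != 0 & framed w.1]].
Local Notation A1 := regular_set.

Let OK_open : open [set w : V | lies_over O (embed w)].
Proof. exact: lies_over_open. Qed.

Let OKX w : lies_over O (embed w) -> XK w. Proof. exact: OX. Qed.

Lemma regular_set_open : open A1.
Proof.
have o1 : open ([set w : V | lies_over O (embed w)] `&` (fun w => P w 0 i0) @^-1` [set y : R | y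
  != 0]).
  apply: (@open_preimage _ _ (R : normedModType R)) => //.
  apply: smooth_coord => //; apply: smooth_subset (theta_dir_smooth hphi hF j0).
  by move=> w; exact: OKX.
have o2 : open [set w : V | framed w.1] by exact/open_comp_fst/framed_open.
have -> : A1 = ([set w : V | lies_over O (embed w)] `&` (fun w => P w 0 i0) @^-1` [set y : R | y
  != 0])
    `&` [set w : V | framed w.1].
  by apply/seteqP; split => w; [case|case=> [[? ?] ?]].
exact: openI.
Qed.

Let AX w : A1 w -> XK w. Proof. by case=> /OKX. Qed.

Definition theta_scale (w : V) : R := (P w *m e) 0 0.

Lemma theta_dir_frame w : A1 w -> P w = theta_scale w *: t w.1.1 /\ theta_scale w != 0.
Proof.
move=> Aw; have [_ Pi [_ fw _]] := Aw; have [_ _ _ h] := frameP fw.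
have PE : P w = theta_scale w *: t w.1.1.
  rewrite -[LHS]mulmx1 -h mulmxDr !mulmxA (theta_dir_kernel hphi hF le3 (AX Aw)) mul0mx addr0.
  by rewrite [P w *m e]mx11_scalar mul_scalar_mx.
split => //; apply: contraNneq Pi => pi0.
by rewrite PE pi0 scale0r mxE.
Qed.

(** [theta_dir] is [input_dir *m B], hence in the row space of [B], and it is a nonzero multiple of
    [t]. *)
Lemma kernel_ann w : A1 w -> t w.1.1 *m ann w.1.1 = 0.
Proof.
move=> Aw; have [_ _ [_ _ cw]] := Aw; have [_ Bn _ _] := coframeP cw.
have [PE pi0] := theta_dir_frame Aw.
have : P w *m ann w.1.1 = 0.
  by rewrite -(theta_dirE hphi hF le2 (AX Aw)) -mulmxA Bn mulmx0.
by rewrite PE -scalemxAl => /eqP; rewrite scaler_eq0 (negPf pi0) => /eqP.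
Qed.

Lemma jac_multiplier w : A1 w -> J w.1.1 *m mult w.1.1 = ann w.1.1.
Proof.
move=> Aw; have [_ _ [_ fw _]] := Aw; have [_ _ _ h] := frameP fw.
have hJ : J w.1.1 *m section_mx e (J w.1.1) = 1%:M - e *m t w.1.1 by rewrite -h addrC addKr.
by rewrite /multiplier mulmxA hJ mulmxBl mul1mx -mulmxA kernel_ann // mulmx0 subr0.
Qed.

(** Modulo [delta_mx 0 j0] every row is in the row space of [B *m J], which the multiplier kills. A
    zero entry at [j0] would make the multiplier vanish, and with it the annihilator, against
    [c *m annihilator = 1]. *)
Lemma multiplier_neq0 w : A1 w -> mult w.1.1 j0 0 != 0.
Proof.
move=> Aw; have [_ Pi [_ _ cw]] := Aw; have [cn Bn _ _] := coframeP cw.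
have P0 : P w != 0 by apply: contraNneq Pi => ->; rewrite mxE.
apply/negP => /eqP l0.
have m0 : mult w.1.1 = 0.
  rewrite -[LHS]mul1mx; apply/row_matrixP => i; rewrite row_mul row0.
  have [u [s h]] := fibre_directions hphi hF (row i 1%:M) le4 (AX Aw) P0.
  have -> : row i (1%:M : 'M[R]_m) = u *m B w.1.1 *m J w.1.1 + ((r j0 == 4%N)%:R * s) *: delta_mx
    0 j0.
    by rewrite h subrK.
  rewrite mulmxDl -!mulmxA jac_multiplier // Bn mulmx0 add0r -scalemxAl -rowE.
  have -> : row j0 (mult w.1.1) = 0; last by rewrite scaler0.
  by apply/rowP => k; rewrite !mxE ord1 -[RHS]l0 mxE.
have := cn; rewrite -jac_multiplier // m0 !mulmx0 => /matrixP /(_ 0 0).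
by rewrite !mxE eqxx => /eqP; rewrite eq_sym oner_eq0.
Qed.

Definition second_derivative (w : V) : 'rV[R]_m := \row_i Y 2 i w.

Lemma second_derivativeE w : chart w -> second_derivative w = phi_curvature phi w.1 +
  acceleration S w *m J w.1.1.
Proof. by move=> cw; apply/rowP => i; rewrite mxE (output2E phi_smooth). Qed.

Lemma residual_eq w : A1 w -> (second_derivative w *m mult w.1.1) 0 0 + resid w.1 = 0.
Proof.
move=> Aw; have [_ _ [cq _ cw]] := Aw; have [_ Bn _ _] := coframeP cw.
have -> : (second_derivative w *m mult w.1.1) 0 0 + resid w.1 = (second_derivative w *m mult w.1.1 +
    (- (phi_curvature phi w.1 *m mult w.1.1) - drift S w.1 *m ann w.1.1)) 0 0.
  by rewrite [RHS]mxE.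
rewrite second_derivativeE // mulmxDl -[acceleration S w *m _ *m _]mulmxA jac_multiplier //.
rewrite addrACA subrr add0r -mulmxBl /acceleration accel_affine // addrC addKr.
by rewrite -mulmxA Bn mulmx0 mxE.
Qed.

(** [residual_eq] is differentiated along the vector vertical at order 3: the multiplier and [y_[2]]
    stay fixed, which leaves the derivative of the residual along a nonzero multiple of [t]. *)
Lemma residual_kernel w : A1 w -> 'D_(0, t w.1.1) resid w.1 = 0.
Proof.
move=> Aw; have Xw := AX Aw; have cw := chartX Xw; have [_ _ fw] := Aw.
have oF := framed_open.
have fc x : framed x -> config S x.1 by case.
have ff x : framed x -> frame e (J x.1) \in unitmx by case.
have fcf x : framed x -> coframe c (B x.1) \in unitmx by case.
have sm := multiplier_smooth phi_smooth oF fc ff fcf.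
have sr := residual_smooth phi_smooth oF fc ff fcf.
have [d1 v1] := vertical_exists hphi hF (r j0 - 1) j0 Xw.
have d1E := vertical_top_velocity hphi hF le2 Xw v1.
have [PE pi0] := theta_dir_frame Aw.
have oA := regular_set_open.
have A1f : A1 `<=` [set w : V | framed w.1] by move=> y [].
have dl i : differentiable (fun w : V => mult w.1.1 i 0) w.
  have s : smooth A1 (fun w : V => mult w.1.1 i 0).
    apply: smooth_coord => //; apply: smooth_subset A1f _.
    by apply: (smooth_fst_comp (A := framed) (f := fun x : T => mult x.1)) => //;
      exact: open_comp_fst.
  exact: smooth_diff s Aw.
have dres := smooth_diff sr fw.
have dfst : differentiable (fst : V -> T) w.
  by apply: lin_differentiable => //; exact: lin_continuous.
have Dres : 'D_d1 (fun w : V => resid w.1) w = 'D_(d1.1) resid w.1.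
  have D1 : 'D_d1 (fst : V -> T) w = d1.1 by apply: lin_derive => //; exact: lin_continuous.
  by rewrite (derive_comp d1 dfst dres) D1.
have dres' : differentiable (fun w : V => resid w.1) w by exact: (differentiable_comp dfst dres).
have dp i : differentiable (fun w : V => Y 2 i w *: mult w.1.1 i 0) w.
  by apply: (@differentiable_scale _ _ (R : normedModType R)) => //; exact: output_diff.
have [ds Ds] := derive_sums (index_enum 'I_m) d1 (fun i (_ : true) => dp i).
have E0 : 'D_d1 (fun w : V => (\sum_i Y 2 i w *: mult w.1.1 i 0) + resid w.1) w = 0.
  rewrite (@derive_ext _ _ (R : normedModType R) A1 _ (fun=> 0)) ?derive_cst //.
  move=> y Ay; transitivity ((second_derivative y *m mult y.1.1) 0 0 + resid y.1);
    last exact: residual_eq.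
  by rewrite [in RHS]mxE; congr (_ + _); apply: eq_bigr => i _;
    rewrite [second_derivative y 0 i]mxE.
move: E0; rewrite (derive_add _ ds dres') Ds Dres d1E PE big1 => [|i _]; last first.
  rewrite (derive_scale _ (output_diff phi_smooth 2 i cw) (dl i)) v1 //.
  have -> : (2 == r j0 - 1)%N = false by rewrite r4.
  rewrite scale0r addr0 (_ : 'D_d1 _ _ = 0) ?scaler0 //.
  by apply: derive_affine => s; rewrite [(w + _).1]/= d1E /= !scaler0 !addr0.
have -> : (0, theta_scale w *: t w.1.1) = theta_scale w *: (0, t w.1.1) :> T by congr (_, _);
  rewrite scaler0.
rewrite add0r (derive_dirZ _ _ dres) => /eqP.
by rewrite scaler_eq0 (negPf pi0) => /eqP.
Qed.

Definition star_index (i : 'I_m) : nat := if i == j0 then 4%N else 2%N.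

Lemma star_index_le i b : (b < 3)%N -> (star_index i + b <= 6)%N.
Proof. by move=> b3; apply: (@leq_add _ _ 4 2) => //; rewrite /star_index; case: (i == j0). Qed.

Definition output_rows (w : V) : 'M[R]_(3, m) := \matrix_(b, i) Y (star_index i + b) i w.
(** What the law is fed along the original system, where [w = y_[kappa]]. *)
Definition closed_point (w : V) : Z := (w.1, output_rows w).
Local Notation zz := closed_point.

Lemma derive_closed_point (w d : V) : chart w -> differentiable zz w /\
  'D_d zz w = (d.1, \matrix_(b, i) 'D_d (Y (star_index i + b) i) w).
Proof.
move=> cw.
have sW : smooth chart output_rows.
  apply: smooth_mx; first exact: config_chart_open.
  move=> b i; apply: (@smooth_ext _ _ (R : normedModType R) _ (Y (star_index i + b) i));
    first exact: config_chart_open.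
    by move=> y _; rewrite mxE.
  exact: output_smooth.
have dW := smooth_diff sW cw.
have dfst : differentiable (fst : V -> T) w.
  by apply: lin_differentiable => //; exact: lin_continuous.
have D1 : 'D_d (fst : V -> T) w = d.1 by apply: lin_derive => //; exact: lin_continuous.
split; first exact: differentiable_pair.
rewrite (derive_pair d dfst dW) D1; congr (_, _); apply/matrixP => b i.
rewrite [RHS]mxE -(derive_coord d b i dW).
by have -> : (fun y => output_rows y b i) = Y (star_index i + b) i by apply: funext => y;
  rewrite mxE.
Qed.

Lemma shift_output_rows w (a : 'I_3) i : (a < 2)%N ->
  shift_rows (output_rows w) a i = Y (star_index i + a.+1) i w.
Proof.
move=> a2; rewrite mxE /pad insubT mxE mxE //=.
Qed.

Local Notation psi := (solved2 S phi j0 e c).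
Local Notation psi3 := (solved3 S phi j0 e c).
Local Notation psi4 := (solved4 S phi j0 e c).
Local Notation gain := (kernel_gain S phi j0 e c).
Local Notation target := (target_output S phi j0 e c).
Local Notation base_acc := (base_acceleration S phi j0 e c).

Lemma solved2_closed_point w : A1 w -> psi (zz w) = Y 2 j0 w.
Proof.
move=> Aw; have l0 := multiplier_neq0 Aw; have := residual_eq Aw.
rewrite mxE (bigD1 j0) //= [second_derivative w 0 j0]mxE -addrA => /eqP; rewrite addr_eq0 => /eqP h.
rewrite /solved2 /=.
have -> : \sum_(i | i != j0) mult w.1.1 i 0 * output_rows w ord0 i =
    \sum_(i | i != j0) second_derivative w 0 i * mult w.1.1 i 0.
  by apply: eq_bigr => i ij; rewrite [output_rows w _ _]mxE [second_derivative w 0 i]mxE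
    /star_index (negPf ij) addn0 mulrC.
by rewrite -h mulfK.
Qed.

Lemma target_closed_point w : A1 w -> target (zz w) = second_derivative w.
Proof.
move=> Aw; apply/rowP => i; rewrite !mxE solved2_closed_point //.
by case: eqP => [->|/eqP ij] //; rewrite ?mxE /star_index (negPf ij) addn0.
Qed.

Definition kernel_acc (w : V) : R := (acceleration S w *m e) 0 0.

Lemma acceleration_split w : A1 w ->
  acceleration S w = base_acc (zz w) + kernel_acc w *: t w.1.1.
Proof.
move=> Aw; have [_ _ [_ fw _]] := Aw; have [_ _ _ h] := frameP fw.
rewrite /base_acceleration target_closed_point // second_derivativeE; last exact: (chartX (AX Aw)).
rewrite [phi_curvature _ _ + _]addrC addrK /=.
rewrite -[LHS]mulmx1 -h mulmxDr !mulmxA addrC; congr (_ + _).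
by rewrite [acceleration S w *m e]mx11_scalar mul_scalar_mx.
Qed.

Variable w0 : V.
Hypothesis Aw0 : A1 w0.

(* Freezing the inputs at those of [w0] turns the identities on [regular_set]
   into identities in [(q, v)] alone. *)
Definition slice : set T := [set x | A1 (x, w0.2)].
Local Notation E := slice.

Lemma slice_open : open E.
Proof.
have -> : E = setT `&` (fun x => (x, w0.2)) @^-1` A1.
  by apply/seteqP; split => x; [|case].
apply: open_preimage; [exact: openT|exact: regular_set_open|].
by apply: smooth_pair => //; [exact: openT|exact: smooth_id|exact: smooth_cst].
Qed.

Let E_config x : E x -> config S x.1. Proof. by case=> _ _ []. Qed.
Let E_frame x : E x -> frame e (J x.1) \in unitmx. Proof. by case=> _ _ []. Qed.
Let E_coframe x : E x -> coframe c (B x.1) \in unitmx. Proof. by case=> _ _ []. Qed.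
Let E_ann x : E x -> t x.1 *m ann x.1 = 0. Proof. exact: kernel_ann. Qed.
Let E_mult x : E x -> mult x.1 j0 0 != 0. Proof. exact: multiplier_neq0. Qed.
Let E_resid x : E x -> 'D_(0, t x.1) resid x = 0. Proof. exact: residual_kernel. Qed.

(** Identities between outputs need a regular [w]; the lemmas on the explicit law need its state in
    the slice. *)
Definition local_domain : set V := [set w | A1 w /\ E w.1].
Local Notation A2 := local_domain.

Lemma local_domain_open : open A2.
Proof.
have o2 : open [set w : V | E w.1] by exact/open_comp_fst/slice_open.
have -> : A2 = A1 `&` [set w : V | E w.1] by [].
by apply: openI; [exact: regular_set_open|exact: o2].
Qed.

(** The open-loop motion is an instance of [derive_solved2_trajectory], with [kernel_acc] as the
    multiple of [t]; one more differentiation gives [fourth_derivative]. *)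
Lemma third_derivative w : A2 w -> Y 3 j0 w = psi3 (zz w).
Proof.
move=> [Aw Ew]; have cw := chartX (AX Aw).
have [dz Dz] := derive_closed_point (xi w) cw.
have dpsi : differentiable psi (zz w).
  exact: (smooth_diff (solved2_smooth phi_smooth slice_open E_config E_frame E_coframe E_mult)).
rewrite -[LHS]/('D_(xi w) (Y 2 j0) w).
rewrite (@derive_ext _ _ (R : normedModType R) A2 _ (fun w => psi (zz w))); first last.
- by move=> y [Ay _]; rewrite solved2_closed_point.
- by split.
- exact: local_domain_open.
rewrite (derive_comp (xi w) dz dpsi) Dz.
have -> : (xi w).1 = ((zz w).1.2, base_acc (zz w) + kernel_acc w *: t (zz w).1.1).
  by rewrite -acceleration_split.
apply: (derive_solved2_trajectory phi_smooth slice_open E_config E_frame E_coframe E_mult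
  E_resid) => // i.
by rewrite shift_output_rows // mxE (addnS (star_index i)).
Qed.

Lemma fourth_derivative w : A2 w -> Y 4 j0 w = psi4 (zz w) + kernel_acc w * gain (zz w).
Proof.
move=> Aw2; have [Aw Ew] := Aw2; have cw := chartX (AX Aw).
have [dz Dz] := derive_closed_point (xi w) cw.
have dpsi : differentiable psi3 (zz w).
  exact: (smooth_diff (solved3_smooth phi_smooth slice_open E_config E_frame E_coframe E_mult)).
rewrite -[LHS]/('D_(xi w) (Y 3 j0) w).
rewrite (@derive_ext _ _ (R : normedModType R) A2 _ (fun w => psi3 (zz w))); first last.
- by move=> y Ay; rewrite third_derivative.
- by split.
- exact: local_domain_open.
rewrite (derive_comp (xi w) dz dpsi) Dz.
have -> : (xi w).1 = ((zz w).1.2, base_acc (zz w) + kernel_acc w *: t (zz w).1.1).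
  by rewrite -acceleration_split.
apply: (derive_solved3_trajectory phi_smooth slice_open E_config E_frame E_coframe E_mult) => //
  a i a2.
by rewrite shift_output_rows // mxE (addnS (star_index i)).
Qed.

(** The vector vertical at order 3 changes [y^j0_[3]] by 1, but acts on [solved3] through the
    velocity alone, with value [theta_scale * gain]. *)
Lemma gain_neq0 w : A2 w -> gain (zz w) != 0.
Proof.
move=> Aw2; have [Aw Ew] := Aw2; have Xw := AX Aw; have cw := chartX Xw.
have [d1 v1] := vertical_exists hphi hF (r j0 - 1) j0 Xw.
have d1E := vertical_top_velocity hphi hF le2 Xw v1.
have [PE pi0] := theta_dir_frame Aw.
have [dz Dz] := derive_closed_point d1 cw.
have dpsi : differentiable psi3 (zz w).
  exact: (smooth_diff (solved3_smooth phi_smooth slice_open E_config E_frame E_coframe E_mult)).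
have v3 a i : (a <= 6)%N -> 'D_d1 (Y a i) w = ((a == 3%N) && (i == j0))%:R.
  have N5 : (5 <= N)%N by have := height_gt r j0; rewrite r4.
  by move=> a6; rewrite v1 ?r4 // (leq_trans a6) // ltnS.
have one : 'D_d1 (Y 3 j0) w = 1 by rewrite v3 // !eqxx.
have : 'D_d1 (Y 3 j0) w = theta_scale w * gain (zz w).
  rewrite (@derive_ext _ _ (R : normedModType R) A2 _ (fun w => psi3 (zz w))); first last.
  - by move=> y Ay; rewrite third_derivative.
  - by split.
  - exact: local_domain_open.
  rewrite (derive_comp d1 dz dpsi) Dz d1E PE.
  set M := \matrix_(_, _) _.
  have -> : ((0, theta_scale w *: t w.1.1), M) =
      theta_scale w *: kernel_field phi e (zz w) + (0, M) :> Z.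
    by congr ((_, _), _) => /=; rewrite ?scaler0 ?addr0 ?add0r.
  rewrite (derive_dirD _ _ dpsi) (derive_dirZ _ _ dpsi).
  rewrite (derive_solved3_row phi_smooth slice_open E_config E_frame E_coframe E_mult) ?addr0 //.
  move=> a i a2; rewrite mxE v3; last exact: (star_index_le i (ltn_ord a)).
  (* For [i = j0] the orders are 4 and 5, not 3; for other [i] the output component differs. *)
  rewrite /star_index; case: (i == j0); rewrite ?andbF ?andbT //.
rewrite one => h; apply/eqP => g0; move: h; rewrite g0 mulr0 => /eqP.
by rewrite oner_eq0.
Qed.

Lemma feedback_returns_input w : A2 w -> feedback S phi j0 e c (zz w) = pad w.2 0.
Proof.
move=> Aw2; have [Aw Ew] := Aw2; have [_ _ [cq _ cw]] := Aw; have [_ _ Bc _] := coframeP cw.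
have loop : loop_acc S phi j0 e c (zz w) = acceleration S w.
  rewrite acceleration_split // /loop_acc; congr (_ + _ *: _).
  have -> : (zz w).2 ord0 j0 = Y 4 j0 w by rewrite mxE /star_index eqxx addn0.
  by rewrite fourth_derivative // addrC addKr mulfK // gain_neq0.
rewrite /feedback loop /acceleration accel_affine // addrC addKr.
by rewrite -mulmxA Bc mulmx1.
Qed.

Lemma feedback_exists : quasi_static_feedback S phi star_index (embed w0).
Proof.
exists 3%N, (feedback_domain S phi j0 e c E), (feedback S phi j0 e c); split.
- split; last by move=> x [/E_config].
  exact: (feedback_domain_open phi_smooth slice_open E_config E_frame E_coframe E_mult).
- exact: (feedback_smooth phi_smooth slice_open E_config E_frame E_coframe E_mult).
- move=> z Fz j.
  exact: (closed_loop_output phi_smooth slice_open E_config E_frame E_coframe E_ann E_mult E_resid).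
(* [lies_over] expects a successor number of rows; [K.+1] is one more than [V] has, and [red]
   forgets the surplus row. *)
pose red (y : T * 'M[R]_(K.+1, m)) : V := (y.1, trunc K (pad y.2)).
have redE (z : jet R p m) : red (z.1, trunc K.+1 z.2) = (z.1, trunc K z.2).
  congr (_, _); apply/row_matrixP => i; rewrite !rowK pad_trunc //.
  by rewrite (leq_trans (ltn_ord i)).
exists K, [set y | A2 (red y)]; split.
- apply: (@open_comp _ _ red A2); last exact: local_domain_open.
  move=> y _; apply: lin_continuous => // a x x'; congr (_, _).
  by apply/row_matrixP => i; rewrite [RHS]linearD [X in _ = X + _]linearZ /= !rowK pad_lin.
- change (A2 (red ((embed w0).1, trunc K.+1 (embed w0).2)));
  rewrite redE /= trunc_pad -surjective_pairing; split; first exact: Aw0.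
  by rewrite /slice /mkset -surjective_pairing.
- move=> z Oz; have Aw2 : A2 (z.1, trunc K z.2) by rewrite -redE.
  have -> : (z.1, trunc 3 (wjet S phi star_index z)) = zz (z.1, trunc K z.2).
    congr (_, _); apply/matrixP => b i; rewrite !mxE (@yder_trunc _ _ _ S phi K) //.
    by rewrite (leq_trans (star_index_le i (ltn_ord b))) // addnC.
  split.
    by have [_ Ew] := Aw2; split => //; exact: gain_neq0.
  by rewrite feedback_returns_input //= pad_trunc // addnC.
Qed.
End Local.
End OpenLoop.

Unset Implicit Arguments.
Theorem theorem5 (R : realType) (m : nat)
    (S : lagrangian_system R m.+1 m)
    (phi : 'rV[R]_m.+1 -> 'rV[R]_m)
    (r : 'I_m -> nat) (l : nat)
    (X : set (('rV[R]_m.+1 * 'rV[R]_m.+1) * 'M[R]_(l.+1, m)))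
    (D : set 'M[R]_(height r, m))
    (Fq Fv : 'M[R]_(height r, m) -> 'rV[R]_m.+1)
    (Fu : 'M[R]_(height r, m) -> 'rV[R]_m)
    (hphi : submersion S phi)
    (hF : flat_parameterization S phi X D Fq Fv Fu)
    (heq : exists q u, equilibrium S q u /\ lies_over X (constant_jet q u)) :
  ((forall kappa : 'I_m -> nat, star r kappa ->
      forall O : set (('rV[R]_m.+1 * 'rV[R]_m.+1) * 'M[R]_(l.+1, m)),
        open O -> O `<=` X -> minimal_on S phi Fu O ->
        exists2 z, lies_over O z & quasi_static_feedback S phi kappa z) /\
   (exists kappa : 'I_m -> nat, star r kappa)) /\
  (forall (kappa : 'I_m -> nat)
      (hkappa : (\sum_(j < m) kappa j = m.+1 + m.+1)%N),
      (forall j, (kappa j <= r j)%N) -> ~ star r kappa ->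
      (forall z, lies_over X z -> ~ quasi_static_feedback S phi kappa z) \/
      (forall q u, equilibrium S q u -> lies_over X (constant_jet q u) ->
         singular_at phi Fq Fv hkappa q)).
Proof.
split; [split|].
- move=> kappa [j0 r4 hk] O oO OX mO.
  have -> : kappa = star_index j0 by apply: funext => i; rewrite hk.
  set A := [set w : ('rV[R]_m.+1 * 'rV[R]_m.+1) * 'M[R]_(height r + l + 8, m) | lies_over O
    (embed w)].
  have oA : open A by exact: lies_over_open.
  have AX w : A w -> flat_chart (r := r) X w by exact: OX.
  have r2 : (2 <= r j0)%N by rewrite r4.
  have [w1 Aw1 k1] := minimal_chart j0 mO.
  have [w Aw P0] := theta_dir_nonzero hphi hF r2 oA AX (ex_intro2 _ _ w1 Aw1 k1).
  have Xw := AX w Aw.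
  have cq : config S w.1.1 := flat_chart_sub hF Xw.
  have [e fe] := frame_exists (hphi.2 _ cq).
  have [c fc] := coframe_exists (input_mx_rank hphi hF r4 Xw P0).
  have [i0 Pi] : exists i, theta_dir S phi Fq j0 w 0 i != 0.
    by apply/existsP; apply: contra_neqT P0 => /existsPn h; apply/rowP => i; rewrite [RHS]mxE;
      apply/eqP/negPn/h.
  exists (embed w) => //.
  by apply: (feedback_exists hphi hF r4 oO OX (e := e) (c := c) (i0 := i0)); split.
- have [q [u [_ hX]]] := heq.
  have [j rj] : exists j, r j = 4%N.
    by apply: (order_ge4 hphi hF); eexists; exact: (lies_over_trunc r hX).
  by exists (fun i => if i == j then 4%N else 2%N), j.
(* The second alternative holds at every equilibrium in [X], since a regular Jacobian would force
   [star r kappa]. *)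
- move=> kappa hk kr ns; right => q u eqqu Xqu.
  by apply/negP => /(regular_star hphi hF eqqu Xqu kr).
Qed.
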